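(* Suppose $q,a$ are integers with $0<a<q$ and $(a,q)=1$, let $X\ge1$, and let $f$ be a smooth function on $(0,\infty)$ whose Mellin transform $\widetilde{f}(s)=\int_0^\infty f(x)x^{s}\frac{dx}{x}$ extends to a meromorphic function on $\mathbb{C}$ whose only possible pole is at $s=0$, with rapid decay as $|s|\to\infty$ in every fixed strip $-B\le\operatorname{Re}(s)\le B$. Then for any $A>0$ and $\varepsilon>0$, $$S(q,a;f,X)=\sqrt{\frac{a}{q}}\,S\Big(a,-q;f,\frac{aX}{q}\Big)+a^{-1/2}\Big(\frac{a_{-1}(f)}{2}\log(X/a)+\frac{a_0(f)}{2}+\gamma a_{-1}(f)\Big)+q^{-1/2}k\Big(\frac{q}{X}\Big)$$ $$\qquad+O\Big(a^{-1/2}(X/a)^{-A}+q^{-1/2}\frac{a}{q}\Big(\frac{X}{q}\Big)^{1/2}\Big(1+\frac{X}{q}\Big)(qX)^{\varepsilon}\Big),$$ where the implied constant depends only on $f$, $\varepsilon$ (and $A$).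
   Context: For a positive integer $r$, an integer $b$ coprime to $r$ and $Y>0$, define $$S(r,b;f,Y)=\mathop{\sum\sum}_{\substack{m,n\ge1\\ n\equiv bm\ (\mathrm{mod}\ r)}}\frac{1}{\sqrt{mn}}f\Big(\frac{mn}{Y}\Big).$$ $a_{-1}(f)$ and $a_0(f)$ are the coefficients in the Laurent expansion $\widetilde{f}(s)=\frac{a_{-1}(f)}{s}+a_0(f)+\dots$ at $s=0$; $\gamma$ is Euler's constant; and for $y>0$, $$k(y)=\frac{1}{2\pi i}\int_{(2)}y^{-s}\widetilde{f}(s)\zeta^2(\tfrac12+s)\,ds.$$ *)

(* Defs.v *)
From HB Require Import structures.
From mathcomp Require Import all_boot all_order all_algebra.
From mathcomp Require Import all_classical all_reals all_analysis.
From mathcomp Require Import complex.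

Set Implicit Arguments.
Unset Strict Implicit.
Unset Printing Implicit Defensive.

Import Order.TTheory GRing.Theory Num.Theory.
Import numFieldNormedType.Exports.
Import Normc.

Local Open Scope classical_set_scope.
Local Open Scope ring_scope.
Local Open Scope complex_scope.

Section Definitions.
Variable R : realType.
Local Notation C := R[i].
Local Notation Re := (@complex.Re R).
Local Notation Im := (@complex.Im R).

(* x ^ s for x > 0 *)
Definition cpow (x : R) (s : C) : C :=
  (x `^ Re s)%:C * (cos (Im s * ln x) +i* sin (Im s * ln x)).

Definition rsum (T : choiceType) (D : set T) (u : T -> R) : R :=
  fine (\esum_(i in D) ((EFin \o u)^\+ i)%E)
  - fine (\esum_(i in D) ((EFin \o u)^\- i)%E).

(* Unordered sum of an absolutely summable complex family; like the other
   total operators below, it is only meaningful under absolute convergence. *)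
Definition csum (T : choiceType) (D : set T) (u : T -> C) : C :=
  rsum D (fun i => Re (u i)) +i* rsum D (fun i => Im (u i)).

Definition cintegrable (D : set R) (g : R -> C) : Prop :=
  lebesgue_measure.-integrable D (fun x => (Re (g x))%:E) /\
  lebesgue_measure.-integrable D (fun x => (Im (g x))%:E).

Definition cintegral (D : set R) (g : R -> C) : C :=
  Rintegral lebesgue_measure D (fun x => Re (g x))
  +i* Rintegral lebesgue_measure D (fun x => Im (g x)).

Definition smooth_pos (f : R -> C) : Prop :=
  forall (n : nat) (x : R), 0 < x ->
    derivable (derive1n n (fun y => Re (f y))) x 1 /\
    derivable (derive1n n (fun y => Im (f y))) x 1.

Definition mellin_integrand (f : R -> C) (s : C) (x : R) : C :=
  f x * cpow x s / x%:C.

Definition mellin (f : R -> C) (s : C) : C :=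
  cintegral `]0, +oo[ (mellin_integrand f s).

(* F continues the Mellin transform of f, whose defining integral converges
   absolutely in some right half-plane. *)
Definition extends_mellin (f : R -> C) (F : C -> C) : Prop :=
  exists sigma : R, forall s : C, sigma < Re s ->
    cintegrable `]0, +oo[ (mellin_integrand f s) /\ F s = mellin f s.

Definition holomorphic_off0 (F : C -> C) : Prop :=
  forall s : C, s != 0 -> derivable (F : C^o -> C^o) s 1.

(* F(s) = am1 / s + a0 + c_1 s + c_2 s^2 + ... in a punctured disc around 0 *)
Definition laurent0 (F : C -> C) (am1 a0 : C) : Prop :=
  exists (c : nat -> C) (r : R), [/\ 0 < r, c 0%N = a0 &
    forall s : C, 0 < normc s < r ->
      ((fun N => am1 / s + \sum_(k < N) c k * s ^+ k) : nat -> C^o) @ \oo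
        --> (F s : C^o)].

Definition rapid_decay (F : C -> C) : Prop :=
  forall (B : R) (N : nat), exists K T : R, 0 < T /\
    forall s : C, - B <= Re s <= B -> T <= normc s ->
      normc (F s) <= K * (normc s) ^- N.

(* Dirichlet series, used only for Re s > 1 *)
Definition zeta (s : C) : C :=
  csum [set n : nat | (0 < n)%N] (fun n => cpow n%:R (- s)).

Definition euler_gamma : R :=
  limn (fun n => \sum_(k < n.+1) k.+1%:R^-1 - ln (n.+1%:R : R)).

(* k(y), with F the continued Mellin transform; the line is s = 2 + it, so
   that ds / (2 pi i) = dt / (2 pi). *)
Definition kfun (F : C -> C) (y : R) : C :=
  ((2 * pi)^-1)%:C *
  cintegral setT (fun t : R => let s := 2 +i* t in
    cpow y (- s) * F s * zeta (2^-1 + s) ^+ 2).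

Definition Ssum (r : nat) (b : int) (f : R -> C) (Y : R) : C :=
  csum [set p : nat * nat | [/\ (0 < p.1)%N, (0 < p.2)%N &
          (p.2%:Z = b * p.1%:Z %[mod r%:Z])%Z]]
    (fun p => ((Num.sqrt (p.1%:R * p.2%:R))^-1)%:C
              * f (p.1%:R * p.2%:R / Y)).

End Definitions.
Arguments euler_gamma {R}.

(* Main.v *)
Require Import Defs.
From HB Require Import structures.
From mathcomp Require Import all_boot all_order all_algebra.
From mathcomp Require Import all_classical all_reals all_analysis.
From mathcomp Require Import complex.
From mathcomp Require Import ring lra measurable_realfun.

(** Writing n = a m + q l splits the congruence n = a m (mod q) into three
    ranges. The terms with l = 0 form the sum of f(a m^2 / X) / m over m,
    which Euler-Maclaurin summation evaluates up to an arbitrary power of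
    X / a. For l > 0 we have m n = m q l (1 + a m / (q l)), and dropping the
    second factor leaves the double sum that equals q^(-1/2) k(q / X) by
    Mellin inversion. For l < 0, i.e. n = a m - q l with l > 0, the pair (l, n)
    runs through n = - q l (mod a), and dropping the factor 1 + n / (q l) of
    m n = (n q l / a) (1 + n / (q l)) leaves the dual sum. Both replacements
    cost the second error term, by the mean value theorem and the decay of f
    and x f'(x).

    That decay comes from Mellin inversion. The function s F(s) is entire and
    rapidly decreasing in strips, so shifting its inverse Mellin integral
    shows that x f'(x) is O(x^p) for every real p, while
    F(s) = a_{-1} / s + a_0 + ... gives the zeroth and first logarithmic
    moments of x f'(x). *)

Set Implicit Arguments.
Unset Strict Implicit.
Unset Printing Implicit Defensive.
Import Order.TTheory GRing.Theory Num.Theory.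
Import numFieldNormedType.Exports.
Local Open Scope classical_set_scope.
Local Open Scope ring_scope.

(** * Integrals over the real line and Fourier inversion *)

Section RealLineIntegrals.
Variable R : realType.
Implicit Types f g : R -> R.
Local Notation mu := (@lebesgue_measure R).

(** All analysis takes place in u = ln x, where Mellin transforms are Fourier transforms and
    dilations are translations. Estimates are proved for a real-valued function and applied to Re f
    with F and to Im f with -i F, because the real part of an integral of -i F is the imaginary part
    of that of F.

    The pole at 0 is the obstacle: it keeps the inversion integral of F from crossing Re s = 0, and
    f tends to a_{-1}, not to 0, at x = 0. One u-derivative multiplies F by s and removes the pole;
    f is recovered by integrating back from infinity, where it vanishes.

    The terms l = 0 need both the exact constant and an error of any order. Comparison with harmonic
    sums gives the constant with a weak error. The derivative of the sum in ln X is a Riemann sum of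
    a function flat at 0, hence known to any order; integrating it back from a huge X combines the
    two.

    Infinite sums enter through finite truncations with arbitrarily small loss, so only finite sums
    are interchanged with integrals. The power X^(3/2 + eps) in the error is what makes the sum over
    m converge after the mean value theorem. *)

Definition integrableR g := mu.-integrable setT (EFin \o g).
Definition intR g : R := Rintegral mu setT g.

Lemma integrableR_measurable g : integrableR g -> measurable_fun setT g.
Proof. by move=> /integrableP[/measurable_EFinP]. Qed.

Lemma integrableR_le f g : measurable_fun setT f -> integrableR g ->
  (forall x, `|f x| <= `|g x|) -> integrableR f.
Proof.
move=> mf ig fg; apply: (le_integrable measurableT _ _ ig).
  exact/measurable_EFinP.
by move=> x _ /=; rewrite lee_fin.
Qed.

Lemma integrableRD f g : integrableR f -> integrableR g ->
  integrableR (fun x => f x + g x).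
Proof.
move=> fi gi; rewrite /integrableR; have := integrableD measurableT fi gi.
by apply: eq_integrable.
Qed.

Lemma integrableRZ k g : integrableR g -> integrableR (fun x => k * g x).
Proof.
move=> gi; rewrite /integrableR; have := integrableZl measurableT k gi.
by apply: eq_integrable.
Qed.

Lemma integrableR_norm g : integrableR g -> integrableR (fun x => `|g x|).
Proof.
move=> gi; apply: (@integrableR_le _ g) => //; last by move=> x; rewrite normr_id.
exact: measurableT_comp (integrableR_measurable gi).
Qed.

Lemma integrableRM f g : integrableR f -> measurable_fun setT g ->
  (exists K, forall x, `|g x| <= K) -> integrableR (fun x => f x * g x).
Proof.
move=> fi mg [K gK]; apply: (@integrableR_le _ (fun x => K * `|f x|)).
- by apply: measurable_funM => //; exact: integrableR_measurable.
- exact/integrableRZ/integrableR_norm.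
- move=> x; rewrite !normrM normr_id mulrC ler_wpM2r// (le_trans (gK x))//.
  exact: ler_norm.
Qed.

Lemma intRD f g : integrableR f -> integrableR g ->
  intR (fun x => f x + g x) = intR f + intR g.
Proof. by move=> fi gi; rewrite /intR RintegralD. Qed.

Lemma intRB f g : integrableR f -> integrableR g ->
  intR (fun x => f x - g x) = intR f - intR g.
Proof. by move=> fi gi; rewrite /intR RintegralB. Qed.

Lemma intRZ k g : integrableR g -> intR (fun x => k * g x) = k * intR g.
Proof. by move=> gi; rewrite /intR RintegralZl. Qed.

Lemma le_intR f g : integrableR f -> integrableR g ->
  (forall x, f x <= g x) -> intR f <= intR g.
Proof. by move=> fi gi fg; rewrite /intR le_Rintegral. Qed.

Lemma norm_intR_le f g : integrableR f -> integrableR g ->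
  (forall x, `|f x| <= g x) -> `|intR f| <= intR g.
Proof.
move=> fi gi fg; apply: le_trans (le_normr_Rintegral measurableT fi) _.
by apply: le_intR => //; exact: integrableR_norm.
Qed.

Lemma eq_intR f g : f =1 g -> intR f = intR g.
Proof. by move=> /funext ->. Qed.

Lemma continuous_measurable f : continuous f -> measurable_fun setT f.
Proof. by move=> cf; exact: continuous_measurable_fun. Qed.

Lemma integral_fold (G : R -> R) : continuous G -> (forall x, 0 <= G x) ->
  (\int[mu]_x (G x)%:E =
   \int[mu]_(x in `[0%R, +oo[) (G x + G (- x))%:E)%E.
Proof.
move=> cG G0.
have mG : measurable_fun setT G by exact: continuous_measurable_fun.
have cGN : continuous (fun x => G (- x)).
  by move=> x; apply: (@continuous_comp _ _ _ -%R G); [exact: opp_continuous|exact: cG].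
rewrite (_ : setT = `[0%R, +oo[ `|` ~` `[0%R, +oo[ :> set R); last by rewrite setUv.
rewrite ge0_integral_setU//=; last 4 first.
  exact: measurableC.
  by apply/measurable_EFinP; rewrite setUv.
  by move=> x _; rewrite lee_fin.
  exact/disj_setPCl.
rewrite setCitvr integral_itv_bndo_bndc; last exact/measurable_EFinP/measurable_funTS.
have := @ge0_integration_by_substitutionNy R G 0; rewrite oppr0 => ->//; last exact: continuous_subspaceT.
rewrite -ge0_integralD//=.
- by move=> x _; rewrite lee_fin.
- exact/measurable_EFinP/measurable_funTS.
- by move=> x _; rewrite lee_fin.
- apply/measurable_EFinP; apply: measurable_funTS.
  exact: (@continuous_measurable (fun x => G (- x))).
Qed.

(** Folding the line at 0 reduces this to the half-line theorem for [F x - F (- x)], which vanishes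
    at 0 and has derivative [f x + f (- x)]. *)
Lemma ge0_FTC_R (f F : R -> R) (l l' : R) :
  continuous f -> (forall x, 0 <= f x) ->
  (forall x : R, is_derive x 1 F (f x)) ->
  F x @[x --> +oo] --> l -> F (- x) @[x --> +oo] --> l' ->
  integrableR f /\ intR f = l - l'.
Proof.
move=> cf f0 dF Fl Fl'.
suff h : (\int[mu]_x (f x)%:E = (l - l')%:E)%E.
  split; last by rewrite /intR /Rintegral h.
  apply/integrableP; split.
    by apply/measurable_EFinP; exact: continuous_measurable_fun.
  under eq_integral => x _ do rewrite /= (ger0_norm (f0 x)).
  by rewrite h ltry.
have cfN : continuous (fun x => f (- x)).
  by move=> x; apply: (@continuous_comp _ _ _ -%R f); [exact: opp_continuous|exact: cf].
have dFN (x : R) : is_derive x 1 (fun x => F x - F (- x)) (f x + f (- x)).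
  have d1 : is_derive x 1 (fun x => F (- x)) (- f (- x)).
    apply: is_derive_eq (is_derive1_comp _ _) _ => //=.
    by rewrite mulrN1.
  by rewrite -{1}[f (- x)]opprK; exact: is_deriveB.
have cFN : continuous (fun x => F x - F (- x)).
  by move=> x; apply/differentiable_continuous/derivable1_diffP; case: (dFN x).
pose G x := F x - F (- x).
have G0 : G 0 = 0 by rewrite /G oppr0 subrr.
rewrite integral_fold//.
rewrite (@ge0_continuous_FTC2y _ _ G _ (l - l'))//.
- by rewrite G0 oppe0 adde0.
- by move=> x _; rewrite addr_ge0.
- by apply: continuous_subspaceT => x; apply: cvgD; [exact: cf|exact: cfN].
- exact: cvgB.
- by apply: cvg_at_right_filter; exact: cFN.
- by move=> x _; rewrite derive1E; exact: derive_val.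
Qed.

Lemma dD f g (x : R) a b : is_derive x 1 f a -> is_derive x 1 g b ->
  is_derive x 1 (fun y => f y + g y) (a + b).
Proof. by move=> df dg; exact: is_deriveD. Qed.

Lemma dB f g (x : R) a b : is_derive x 1 f a -> is_derive x 1 g b ->
  is_derive x 1 (fun y => f y - g y) (a - b).
Proof. by move=> df dg; exact: is_deriveB. Qed.

Lemma dM f g (x : R) a b : is_derive x 1 f a -> is_derive x 1 g b ->
  is_derive x 1 (fun y => f y * g y) (a * g x + f x * b).
Proof.
move=> df dg; apply: is_derive_eq (is_deriveM _ _) _.
by rewrite addrC /GRing.scale/= mulrC.
Qed.

Lemma dZ k g (x : R) b : is_derive x 1 g b ->
  is_derive x 1 (fun y => k * g y) (k * b).
Proof. by move=> dg; exact: is_deriveZ. Qed.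

Lemma dcomp f g (x : R) a b : is_derive (g x) 1 f a -> is_derive x 1 g b ->
  is_derive x 1 (fun y => f (g y)) (a * b).
Proof. by move=> df dg; exact: is_derive1_comp. Qed.

Lemma dcst (c x : R) : is_derive x 1 (fun=> c) 0.
Proof. exact: is_derive_cst. Qed.

Lemma dlin (k c x : R) : is_derive x 1 (fun y => k * (y - c)) k.
Proof.
apply: is_derive_eq (dZ k (dB (is_derive_id x 1) (dcst c x))) _.
by rewrite subr0 mulr1.
Qed.

Lemma is_derive_continuous f (x a : R) : is_derive x 1 f a ->
  {for x, continuous f}.
Proof. by move=> [d _]; apply/differentiable_continuous/derivable1_diffP. Qed.

Lemma expRN_le_inv (x : R) : 0 <= x -> expR (- x) <= (1 + x)^-1.
Proof.
move=> x0; rewrite expRN lef_pV2 ?posrE ?expR_gt0 ?expR_ge1Dx//.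
by rewrite ltr_wpDr.
Qed.

Lemma cvgy0_expR_bound (F : R -> R) (C e : R) : 0 < e ->
  (forall t, 0 <= t -> `|F t| <= C * expR (- (e * t))) ->
  F t @[t --> +oo] --> 0.
Proof.
move=> e0 FC; apply/cvgrPdist_le => eta eta0.
near=> t.
have t0 : 0 <= t by near: t; apply: nbhs_pinfty_ge; rewrite num_real.
rewrite sub0r normrN; apply: le_trans (FC _ t0) _.
have C0 : 0 <= C.
  by have := le_trans (normr_ge0 _) (FC _ (lexx 0)); rewrite mulr0 oppr0 expR0 mulr1.
apply: le_trans (ler_wpM2l C0 (expRN_le_inv (mulr_ge0 (ltW e0) t0))) _.
rewrite ler_pdivrMr; last by rewrite ltr_wpDr// mulr_ge0// ltW.
have : C / (eta * e) <= t by near: t; apply: nbhs_pinfty_ge; rewrite num_real.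
rewrite ler_pdivrMr ?mulr_gt0// => h; rewrite mulrDr mulr1.
by apply: le_trans h _; rewrite ler_wpDl ?(ltW eta0)//; lra.
Unshelve. all: by end_near. Qed.

Lemma cvgy_lin (e c : R) : 0 < e -> (x + c) / e @[x --> +oo] --> +oo.
Proof.
move=> e0; apply/cvgryPge => A; near=> t.
have : A * e - c <= t by near: t; apply: nbhs_pinfty_ge; rewrite num_real.
by rewrite ler_pdivlMr// lerBlDr.
Unshelve. all: by end_near. Qed.

(** The integrand has [1 + cos] in place of [cos] so that it is nonnegative and the monotone form of
    the fundamental theorem applies; the contribution of 1 is subtracted later, using b = 0. The
    factor 2 comes from folding the even function on the line. *)
Lemma half_integral_exp_cos (e b : R) : 0 < e ->
  (\int[mu]_(t in `[0%R, +oo[) (2 * (expR (- (e * t)) * (1 + cos (t * b))))%:E =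
   (2 / e + 2 * e / (e ^+ 2 + b ^+ 2))%:E)%E.
Proof.
move=> e0.
have eb0 : e ^+ 2 + b ^+ 2 != 0 by rewrite gt_eqF// ltr_wpDr ?sqr_ge0 ?exprn_gt0.
pose F t := expR ((- e) * (t - 0)) * (- (2 / e)
   + 2 / (e ^+ 2 + b ^+ 2) * (b * sin (b * (t - 0)) - e * cos (b * (t - 0)))).
have dF (t : R) : is_derive t 1 F (2 * (expR (- (e * t)) * (1 + cos (t * b)))).
  apply: is_derive_eq (dM (dcomp (is_derive_expR _) (dlin _ _ _))
    (dD (dcst _ _) (dZ _ (dB (dZ _ (dcomp (is_derive_sin _) (dlin _ _ _)))
     (dZ _ (dcomp (is_derive_cos _) (dlin _ _ _)))))) ) _.
  rewrite subr0 mulNr [t * b]mulrC; field.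
  by rewrite (lt0r_neq0 e0) eb0.
have cF : continuous F by move=> t; exact: is_derive_continuous (dF t).
rewrite (@ge0_continuous_FTC2y _ _ F _ 0).
- rewrite /F subrr !mulr0 expR0 sin0 cos0 -EFinD; congr EFin; field.
  by rewrite (lt0r_neq0 e0) eb0.
- move=> x _; rewrite mulr_ge0// mulr_ge0 ?expR_ge0//.
- apply: continuous_subspaceT => t.
  have d : is_derive t 1 (fun t => 2 * (expR ((- e) * (t - 0)) * (1 + cos (b * (t - 0))))) _ :=
    dZ _ (dM (dcomp (is_derive_expR _) (dlin _ _ _))
    (dD (dcst _ _) (dcomp (is_derive_cos _) (dlin _ _ _)))).
  have := is_derive_continuous d; congr (continuous_at t _).
  by apply/funext => u; rewrite subr0 mulNr [u * b]mulrC.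
- apply: (@cvgy0_expR_bound _ (2 / e + 2 / (e ^+ 2 + b ^+ 2) * (`|b| + e)) e) => // t t0.
  rewrite /F subr0 mulNr normrM (ger0_norm (expR_ge0 _)) mulrC ler_wpM2r ?expR_ge0//.
  rewrite (le_trans (ler_normD _ _))// normrN ger0_norm ?divr_ge0 ?(ltW e0)// lerD2l.
  have p0 : 0 <= 2 / (e ^+ 2 + b ^+ 2) by rewrite divr_ge0 ?addr_ge0 ?sqr_ge0.
  rewrite normrM (ger0_norm p0) ler_wpM2l//.
  rewrite (le_trans (ler_normB _ _))// !normrM (gtr0_norm e0) lerD//.
    rewrite ler_piMr//; have := sin_max (b * t); rewrite ler_norml.
    by have := sin_le1 (b * t); have := sin_geN1 (b * t) => -> ->.
  rewrite ler_piMr ?(ltW e0)// ler_norml.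
  by have := cos_le1 (b * t); have := cos_geN1 (b * t) => -> ->.
- by move=> x _; case: (dF x).
- by apply: cvg_at_right_filter; exact: cF.
- by move=> x _; rewrite derive1E; exact: derive_val.
Qed.

Lemma cont_expR_abs (e : R) : continuous (fun t : R => expR (- (e * `|t|))).
Proof.
move=> t; apply: (@continuous_comp _ _ _ (fun t : R => - (e * `|t|)) expR).
  by apply: cvgN; apply: cvgM; [exact: cvg_cst|exact: norm_continuous].
exact: continuous_expR.
Qed.

Lemma cont_cosl (b : R) : continuous (fun t : R => cos (t * b)).
Proof.
move=> t; apply: (@continuous_comp _ _ _ (fun t : R => t * b) cos).
  exact: mulrr_continuous.
exact: continuous_cos.
Qed.

Lemma cont_sinl (b : R) : continuous (fun t : R => sin (t * b)).
Proof.
move=> t; apply: (@continuous_comp _ _ _ (fun t : R => t * b) sin).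
  exact: mulrr_continuous.
exact: continuous_sin.
Qed.

Lemma ge0_integrableR (G : R -> R) v : continuous G -> (forall x, 0 <= G x) ->
  (\int[mu]_(x in `[0%R, +oo[) (G x + G (- x))%:E = v%:E)%E ->
  integrableR G /\ intR G = v.
Proof.
move=> cG G0; rewrite -integral_fold// => h.
split; last by rewrite /intR /Rintegral h.
apply/integrableP; split.
  by apply/measurable_EFinP; exact: continuous_measurable_fun.
under eq_integral => x _ do rewrite /= (ger0_norm (G0 x)).
by rewrite h ltry.
Qed.

Lemma exp_abs_1Dcos (e b : R) : 0 < e ->
  integrableR (fun t => expR (- (e * `|t|)) * (1 + cos (t * b))) /\
  intR (fun t => expR (- (e * `|t|)) * (1 + cos (t * b))) =
  2 / e + 2 * e / (e ^+ 2 + b ^+ 2).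
Proof.
move=> e0; apply: ge0_integrableR.
- move=> t; apply: cvgM; first exact: cont_expR_abs.
  by apply: cvgD; [exact: cvg_cst|exact: cont_cosl].
- move=> x; rewrite mulr_ge0 ?expR_ge0//.
- rewrite -half_integral_exp_cos//; apply: eq_integral => x.
  rewrite inE/= in_itv/= andbT => x0.
  by rewrite normrN mulNr cosN ger0_norm//; congr EFin; ring.
Qed.

Lemma exp_abs_int (e : R) : 0 < e ->
  integrableR (fun t => expR (- (e * `|t|))) /\
  intR (fun t => expR (- (e * `|t|))) = 2 / e.
Proof.
move=> e0; have [] := exp_abs_1Dcos 0 e0.
rewrite (_ : (fun _ => _) = (fun t => 2 * expR (- (e * `|t|)))); last first.
  by apply/funext => t; rewrite mulr0 cos0 mulrC.
move=> i h; have i' : integrableR (fun t => expR (- (e * `|t|))).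
  have := integrableRZ 2^-1 i; congr integrableR; apply/funext => t.
  by rewrite mulKf.
split => //; move: h; rewrite intRZ// expr0n/= addr0 => h.
apply: (@mulfI _ 2) => //; rewrite h; field; exact: lt0r_neq0.
Qed.

(** Folding [1 + sin] at 0 cancels the sines, so its integral equals the one without the sine. *)
Lemma exp_abs_sin (e b : R) : 0 < e ->
  integrableR (fun t => expR (- (e * `|t|)) * sin (t * b)) /\
  intR (fun t => expR (- (e * `|t|)) * sin (t * b)) = 0.
Proof.
move=> e0; have [i0 v0] := exp_abs_int e0.
have [i1 v1] : integrableR (fun t => expR (- (e * `|t|)) * (1 + sin (t * b))) /\
  intR (fun t => expR (- (e * `|t|)) * (1 + sin (t * b))) = 2 / e.
  apply: ge0_integrableR.
  - move=> t; apply: cvgM; first exact: cont_expR_abs.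
    by apply: cvgD; [exact: cvg_cst|exact: cont_sinl].
  - move=> x; rewrite mulr_ge0 ?expR_ge0//.
  - have := half_integral_exp_cos 0 e0.
    rewrite expr0n/= addr0 => h; transitivity (2^-1%:E * ((2 / e + 2 * e / e ^+ 2)%:E : \bar R))%E.
      rewrite -h -ge0_integralZl//=.
      - apply: eq_integral => x; rewrite inE/= in_itv/= andbT => x0.
        rewrite normrN mulNr sinN mulr0 cos0 ger0_norm// -EFinM; congr EFin.
        by field.
      - apply/measurable_EFinP; apply: measurable_funTS; apply: continuous_measurable => t.
        apply: cvgM; first exact: cvg_cst; apply: cvgM.
          apply: (@continuous_comp _ _ _ (fun t : R => - (e * t)) expR).
            by apply: cvgN; exact: mulrl_continuous.
          exact: continuous_expR.
        by apply: cvgD; [exact: cvg_cst|exact: cont_cosl].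
    by rewrite -EFinM; congr EFin; field; exact: lt0r_neq0.
have E : (fun t => expR (- (e * `|t|)) * sin (t * b)) =
   (fun t => expR (- (e * `|t|)) * (1 + sin (t * b)) - expR (- (e * `|t|))).
  by apply/funext => t; ring.
split.
  apply: (integrableRM i0); first exact: continuous_measurable (@cont_sinl b).
  by exists 1 => t; rewrite ler_norml sin_geN1 sin_le1.
by rewrite E intRB// v0 v1 subrr.
Qed.

Lemma exp_abs_cos (e b : R) : 0 < e ->
  integrableR (fun t => expR (- (e * `|t|)) * cos (t * b)) /\
  intR (fun t => expR (- (e * `|t|)) * cos (t * b)) = 2 * e / (e ^+ 2 + b ^+ 2).
Proof.
move=> e0; have [i0 v0] := exp_abs_int e0.
have [i1 v1] := exp_abs_1Dcos b e0.
have E : (fun t => expR (- (e * `|t|)) * cos (t * b)) =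
   (fun t => expR (- (e * `|t|)) * (1 + cos (t * b)) - expR (- (e * `|t|))).
  by apply/funext => t; ring.
split.
  apply: (integrableRM i0); first exact: continuous_measurable (@cont_cosl b).
  by exists 1 => t; rewrite ler_norml cos_geN1 cos_le1.
by rewrite E intRB// v0 v1; ring.
Qed.

Lemma poisson_kernel_int (e x0 : R) : 0 < e ->
  integrableR (fun u => 2 * e / (e ^+ 2 + (u - x0) ^+ 2)) /\
  intR (fun u => 2 * e / (e ^+ 2 + (u - x0) ^+ 2)) = 2 * pi.
Proof.
move=> e0.
have p0 u : 0 < e ^+ 2 + (u - x0) ^+ 2 by rewrite ltr_wpDr ?sqr_ge0 ?exprn_gt0.
have dF (u : R) : is_derive u 1 (fun u => 2 * atan (e^-1 * (u - x0)))
    (2 * e / (e ^+ 2 + (u - x0) ^+ 2)).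
  apply: is_derive_eq (dZ _ (dcomp (is_derive1_atan _) (dlin _ _ _))) _.
  field; rewrite (lt0r_neq0 e0) (lt0r_neq0 (p0 u))//=.
have := @ge0_FTC_R _ _ (pi : R) (- pi) _ _ dF.
rewrite opprK (_ : pi + pi = 2 * pi); last by ring.
apply.
- move=> u; apply: cvgM; first exact: cvg_cst.
  apply: cvgV; first by rewrite gt_eqF.
  apply: cvgD; first exact: cvg_cst.
  apply: (@continuous_comp _ _ _ (fun u : R => u - x0) (fun x => x ^+ 2)).
    by apply: cvgB; [exact: cvg_id|exact: cvg_cst].
  exact: exprn_continuous.
- by move=> u; rewrite mulr_ge0// ?invr_ge0 ?mulr_ge0 ?(ltW (p0 _)) ?(ltW e0).
- rewrite [X in _ --> X](_ : _ = 2 * (pi / 2)); last by field.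
  apply: cvgM; first exact: cvg_cst.
  apply: (cvg_comp _ _ _ (@cvgy_atan R)).
  have := @cvgy_lin e (- x0) e0.
  by under eq_fun do rewrite mulrC.
- rewrite [X in _ --> X](_ : _ = (- 2) * (pi / 2)); last by field.
  rewrite [X in X @ _ --> _](_ : _ = (fun x => (- 2) * atan ((x + x0) / e))); last first.
    by apply/funext => x; rewrite -opprD mulrN atanN mulrN mulNr [e^-1 * _]mulrC.
  apply: cvgM; first exact: cvg_cst.
  exact: cvg_comp (cvgy_lin x0 e0) (@cvgy_atan R).
Qed.

Lemma fubini_kernel (w g : R -> R) (k : R * R -> R) :
  integrableR w -> integrableR g -> measurable_fun setT k ->
  (forall z, `|k z| <= 1) ->
  integrableR (fun t => intR (fun u => w t * g u * k (t, u))) /\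
  intR (fun t => intR (fun u => w t * g u * k (t, u))) =
  intR (fun u => intR (fun t => w t * g u * k (t, u))).
Proof.
move=> iw ig mk k1.
have mw := integrableR_measurable iw.
have mg := integrableR_measurable ig.
pose h (z : R * R) := w z.1 * g z.2 * k z.
have mh : measurable_fun setT (EFin \o h).
  apply/measurable_EFinP; apply: measurable_funM => //.
  by apply: measurable_funM; [exact: measurableT_comp mw measurable_fst|
    exact: measurableT_comp mg measurable_snd].
have i2 t : integrableR (fun u => w t * g u * k (t, u)).
  apply: integrableRM; first exact: integrableRZ.
    exact: (measurableT_comp mk (pair1_measurable t)).
  by exists 1 => u.
have i1 u : integrableR (fun t => w t * g u * k (t, u)).
  apply: integrableRM.
    by under eq_fun do rewrite mulrC; exact: integrableRZ.
    exact: (measurableT_comp mk (pair2_measurable u)).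
  by exists 1 => t.
have ih : (mu \x mu)%E.-integrable setT (EFin \o h).
  apply/integrable12ltyP => //.
  apply: (@le_lt_trans _ _ (\int[mu]_t ((`|w t| * intR (fun u => `|g u|))%:E))%E).
    apply: ge0_le_integral => //.
    - by move=> t _; apply: integral_ge0 => u _.
    - have mh' : measurable_fun setT (abse \o (EFin \o h)) by exact: measurableT_comp mh.
      have := @measurable_fun_fubini_tonelli_F _ _ _ _ R mu _ mh'; apply.
      by move=> z; exact: abse_ge0.
    - apply/measurable_EFinP; apply: measurable_funM => //.
      exact: measurableT_comp mw.
    - move=> t _.
      rewrite -[leRHS](@fineK _ (_)%:E)//= -intRZ; last exact: integrableR_norm.
      rewrite /intR /Rintegral fineK; last first.
        by apply: integrable_fin_num => //; apply: integrableRZ; exact: integrableR_norm.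
      apply: ge0_le_integral => //.
      - apply/measurable_EFinP; apply: measurableT_comp => //.
        exact: integrableR_measurable (i2 t).
      - apply/measurable_EFinP; apply: measurable_funM => //.
        exact: measurableT_comp mg.
      - by move=> u _; rewrite lee_fin /h/= !normrM ler_piMr.
  have i3 : integrableR (fun t => `|w t| * intR (fun u => `|g u|)).
    by under eq_fun do rewrite mulrC; exact/integrableRZ/integrableR_norm.
  by rewrite -[ltLHS]fineK ?ltry//; exact: integrable_fin_num i3.
split.
  have := integrable_fubini_F ih; apply: eq_integrable => // t _.
  by rewrite /fubini_F /= /intR /Rintegral fineK//; exact: integrable_fin_num (i2 t).
have := Fubini ih; rewrite /intR /Rintegral => E; congr fine.
rewrite [LHS](_ : _ = (\int[mu]_t \int[mu]_u (EFin \o h) (t, u))%E); last first.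
  by apply: eq_integral => t _; rewrite fineK//; exact: integrable_fin_num (i2 t).
rewrite E; apply: eq_integral => u _; rewrite fineK//; exact: integrable_fin_num (i1 u).
Qed.

(** The kernel has mass 2 pi. Within distance d of [x0] the oscillation of [g] is at most eta;
    farther away the kernel is O(e) times the integrable function 1 / (1 + (u - x0)^2). *)
Lemma poisson_approx g (x0 : R) : integrableR g ->
  (forall eta : R, 0 < eta -> exists2 d : R, 0 < d &
     forall u, `|u - x0| < d -> `|g u - g x0| <= eta) ->
  forall eta : R, 0 < eta -> exists2 C, 0 <= C & forall e : R, 0 < e ->
  `|intR (fun u => g u * (2 * e / (e ^+ 2 + (u - x0) ^+ 2))) - 2 * pi * g x0|
   <= eta * (2 * pi) + e * C.
Proof.
move=> ig cg eta eta0; have [d d0 gd] := cg _ eta0.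
(* For y = (u - x0)^2 at least d^2 one has (1 + y) / y <= 1 + d^-2, so the kernel is at most e D /
   (1 + y). The function [q] below then majorizes |g u - g x0| / (1 + y), up to the factor e D. *)
pose D := 2 * (1 + (d ^+ 2)^-1).
pose q (u : R) : R := `|g u| + `|g x0| * (2 * 1 / (1 ^+ 2 + (u - x0) ^+ 2)).
have D0 : 0 <= D by rewrite mulr_ge0// addr_ge0// invr_ge0 sqr_ge0.
have iq : integrableR q.
  apply: integrableRD; first exact: integrableR_norm.
  by apply: integrableRZ; case: (poisson_kernel_int x0 ltr01).
have q0 u : 0 <= q u.
  by rewrite addr_ge0// mulr_ge0// divr_ge0 ?mulr_ge0// addr_ge0 ?sqr_ge0.
exists (D * intR q).
  by rewrite mulr_ge0// Rintegral_ge0// => u _; exact: q0.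
move=> e e0; have [ip vp] := poisson_kernel_int x0 e0.
set p : R -> R := (fun u => 2 * e / (e ^+ 2 + (u - x0) ^+ 2)) in ip vp *.
have pp u : 0 < e ^+ 2 + (u - x0) ^+ 2 by rewrite ltr_wpDr ?sqr_ge0 ?exprn_gt0.
have p0 u : 0 <= p u by rewrite divr_ge0 ?(ltW (pp u))// mulr_ge0// ltW.
have igp : integrableR (fun u => g u * p u).
  apply: integrableRM => //; first exact: integrableR_measurable ip.
  exists (2 / e) => u; rewrite ger0_norm// /p ler_pdivrMr//.
  rewrite -mulrA ler_pM2l// mulrDr [e^-1 * _]mulrC expr2 mulfK ?lt0r_neq0//.
  by rewrite lerDl mulr_ge0 ?sqr_ge0// invr_ge0 ltW.
have -> : intR (fun u => g u * p u) - 2 * pi * g x0 =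
    intR (fun u => g u * p u - g x0 * p u).
  rewrite intRB//; last exact: integrableRZ.
  by rewrite intRZ// vp; ring.
have -> : eta * (2 * pi) + e * (D * intR q) = intR (fun u => eta * p u + (e * D) * q u).
  rewrite [RHS]intRD; last 2 first.
  - exact: integrableRZ ip.
  - exact: integrableRZ iq.
  by rewrite (intRZ eta ip) (intRZ (e * D) iq) vp; ring.
apply: norm_intR_le.
- have := integrableRD igp (integrableRZ (- g x0) ip).
  by congr integrableR; apply/funext => u; rewrite mulNr.
- by apply: integrableRD; exact: integrableRZ.
- move=> u; rewrite -mulrBl normrM (ger0_norm (p0 u)).
  have [ud|du] := ltP `|u - x0| d.
    apply: ler_wpDr; last by rewrite ler_wpM2r// gd.
    by apply: mulr_ge0 => //; apply: mulr_ge0 => //; exact: ltW.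
  apply: ler_wpDl; first by apply: mulr_ge0 => //; exact: ltW.
  set y := (u - x0) ^+ 2 in p p0 pp ip vp igp *.
  have dy : d ^+ 2 <= y.
    by rewrite /y -[leRHS]real_normK ?num_real// lerXn2r ?nnegrE// ltW.
  have d20 : 0 < d ^+ 2 by rewrite exprn_gt0.
  have y0 : 0 < y by exact: lt_le_trans dy.
  have pu1 : p u <= e * D / (1 + y).
    rewrite /p -/y ler_pdivlMr ?addr_gt0// mulrAC ler_pdivrMr; last exact: pp.
    rewrite /D -[2 * e * _]mulrA [2 * _]mulrC -!mulrA ler_pM2l//.
    rewrite [_ * 2]mulrC ler_pM2l//.
    apply: (@le_trans _ _ ((1 + (d ^+ 2)^-1) * y)).
      rewrite mulrDl mul1r addrC lerD2l mulrC ler_pdivlMr// mul1r//.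
    rewrite ler_wpM2l ?addr_ge0 ?invr_ge0 ?(ltW d20)//.
    by rewrite lerDr sqr_ge0.
  apply: (@le_trans _ _ (`|g u| * p u + `|g x0| * p u)).
    by rewrite -mulrDl ler_wpM2r// ler_normB.
  have eD : 0 <= e * D by rewrite mulr_ge0// ltW.
  rewrite /q -/y mulrDr lerD//.
    rewrite mulrC ler_wpM2r// (le_trans pu1)// ler_piMr// invf_le1 ?addr_gt0//.
    by rewrite lerDl ltW.
  rewrite [e * D * (_ * _)]mulrCA; apply: ler_wpM2l => //; apply: le_trans pu1 _.
  apply: ler_wpM2l => //; rewrite expr1n mulr1.
  by rewrite ler_peMl ?invr_ge0 ?addr_ge0 ?(ltW y0)// ler1n.
Qed.

Lemma le_all_eq0 (x C : R) : 0 <= C -> (forall e : R, 0 < e -> `|x| <= e * C) -> x = 0.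
Proof.
move=> C0 h; apply/eqP; rewrite -normr_le0; apply/ler_addgt0Pr => e e0.
rewrite add0r; have := h (e / (C + 1)) _; rewrite divr_gt0 ?ltr_wpDl// => /(_ isT).
move/le_trans; apply; rewrite mulrAC ler_pdivrMr ?ltr_wpDl//.
by rewrite ler_pM2l// lerDl.
Qed.

(* Abel summation of the inversion integral: the factor e^(- e |t|) has the
   Poisson kernel as Fourier transform. *)
Lemma fourier_inversion (g1 g2 A : R -> R) (k x0 : R) :
  integrableR g1 -> integrableR g2 ->
  (forall eta : R, 0 < eta -> exists2 d : R, 0 < d &
     forall u, `|u - x0| < d -> `|g1 u - g1 x0| <= eta) ->
  (forall t, A t = intR (fun u => g1 u * cos (t * (u - x0)) +
                             k * (g2 u * sin (t * (u - x0))))) ->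
  integrableR A -> integrableR (fun t => t * A t) ->
  intR A = 2 * pi * g1 x0.
Proof.
move=> i1 i2 cg hA iA itA.
have mS : measurable_fun setT (fun z : R * R => z.1 * (z.2 - x0)).
  apply: measurable_funM => //.
  by apply: measurable_funB => //; exact: measurable_snd.
have mcos : measurable_fun setT (fun z : R * R => cos (z.1 * (z.2 - x0))).
  by apply: measurableT_comp mS; apply: continuous_measurable; exact: continuous_cos.
have msin : measurable_fun setT (fun z : R * R => sin (z.1 * (z.2 - x0))).
  by apply: measurableT_comp mS; apply: continuous_measurable; exact: continuous_sin.
have cos1 x : `|cos x| <= 1 :> R by rewrite ler_norml cos_geN1 cos_le1.
have sin1 x : `|sin x| <= 1 :> R by rewrite ler_norml sin_geN1 sin_le1.
(* After exchanging the integrals the damped cosine integrates to the Poisson kernel and the damped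
   sine to 0, so [g2] disappears. *)
have key (e : R) : 0 < e -> intR (fun t => expR (- (e * `|t|)) * A t) =
   intR (fun u => g1 u * (2 * e / (e ^+ 2 + (u - x0) ^+ 2))).
  move=> e0; have [iw _] := exp_abs_int e0.
  set w := (fun t => expR (- (e * `|t|))) in iw *.
  have ic t : integrableR (fun u => w t * g1 u * cos (t * (u - x0))).
    apply: integrableRM; first exact: integrableRZ.
      exact: (measurableT_comp mcos (pair1_measurable t)).
    by exists 1 => u.
  have isn t : integrableR (fun u => w t * g2 u * sin (t * (u - x0))).
    apply: integrableRM; first exact: integrableRZ.
      exact: (measurableT_comp msin (pair1_measurable t)).
    by exists 1 => u.
  have ifub (g : R -> R) (kk : R * R -> R) : integrableR g -> measurable_fun setT kk ->
      (forall z, `|kk z| <= 1) ->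
      integrableR (fun t => intR (fun u => w t * g u * kk (t, u))).
    by move=> ig mk k1; have [] := fubini_kernel iw ig mk k1.
  have -> : intR (fun t => w t * A t) =
     intR (fun t => intR (fun u => w t * g1 u * cos (t * (u - x0))) +
                k * intR (fun u => w t * g2 u * sin (t * (u - x0)))).
    apply: eq_intR => t; rewrite -intRZ// -intRD//; last exact: integrableRZ.
    rewrite hA -intRZ; first by apply: eq_intR => u; ring.
    apply: integrableRD; last apply: integrableRZ; apply: integrableRM => //.
    - exact: (measurableT_comp mcos (pair1_measurable t)).
    - by exists 1.
    - exact: (measurableT_comp msin (pair1_measurable t)).
    - by exists 1.
  rewrite intRD; first last.
  - apply: integrableRZ; exact: (ifub _ (fun z => sin (z.1 * (z.2 - x0)))).
  - exact: (ifub _ (fun z => cos (z.1 * (z.2 - x0)))).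
  rewrite intRZ; last exact: (ifub _ (fun z => sin (z.1 * (z.2 - x0)))).
  have [_ ->] := fubini_kernel iw i2 msin (fun z => sin1 _).
  have [_ ->] := fubini_kernel iw i1 mcos (fun z => cos1 _).
  rewrite [X in _ + k * X](_ : _ = 0).
    rewrite mulr0 addr0; apply: eq_intR => u.
    have [ij vj] := exp_abs_cos (u - x0) e0.
    by rewrite -vj -intRZ//; apply: eq_intR => t; rewrite /w; ring.
  rewrite [LHS](_ : _ = intR (fun u => 0)); last first.
    apply: eq_intR => u; have [ij vj] := exp_abs_sin (u - x0) e0.
    transitivity (g2 u * intR (fun t => expR (- (e * `|t|)) * sin (t * (u - x0)))).
      by rewrite -intRZ//; apply: eq_intR => t; rewrite /w; ring.
    by rewrite vj mulr0.
  by rewrite /intR /Rintegral integral0.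
(* Since 1 - exp(-x) <= x, removing the damping costs at most e times the first absolute moment of
   [A]. *)
have lim (e : R) : 0 < e -> `|intR A - intR (fun t => expR (- (e * `|t|)) * A t)| <=
   e * intR (fun t => `|t * A t|).
  move=> e0.
  have iwA : integrableR (fun t => expR (- (e * `|t|)) * A t).
    under eq_fun do rewrite mulrC.
    apply: integrableRM => //; first exact: continuous_measurable (@cont_expR_abs e).
    exists 1 => t; rewrite ger0_norm ?expR_ge0// -expR0 ler_expR oppr_le0.
    by rewrite mulr_ge0// ltW.
  rewrite -intRB// -intRZ; last exact: integrableR_norm.
  apply: norm_intR_le.
  - have := integrableRD iA (integrableRZ (-1) iwA).
    by congr integrableR; apply/funext => u; rewrite mulN1r.
  - exact/integrableRZ/integrableR_norm.
  move=> t; rewrite -{1}[A t]mul1r -mulrBl !normrM mulrA ler_wpM2r//.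
  have h := expR_ge1Dx (- (e * `|t|)).
  rewrite ger0_norm; last first.
    rewrite subr_ge0 -expR0 ler_expR oppr_le0.
    by rewrite mulr_ge0// ltW.
  by lra.
apply/eqP; rewrite -subr_eq0; apply/eqP.
apply: (@le_all_eq0 _ (2 * pi + 1)); first by rewrite addr_ge0// mulr_ge0// pi_ge0.
move=> eta eta0.
have [C C0 hC] := poisson_approx i1 cg eta0.
pose B := intR (fun t => `|t * A t|).
have B0 : 0 <= B by exact: Rintegral_ge0.
(* This makes e (B + C) at most eta, so both the damping error and the far part of the kernel are
   absorbed. *)
pose e := eta / (B + C + 1).
have BC : 0 < B + C + 1 by rewrite ltr_wpDl ?addr_ge0.
have e0 : 0 < e by rewrite divr_gt0.
have := hC e e0; have := lim e e0; rewrite key// -/B => h1 h2.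
rewrite (_ : intR A - _ = (intR A -
   intR (fun u => g1 u * (2 * e / (e ^+ 2 + (u - x0) ^+ 2)))) +
   (intR (fun u => g1 u * (2 * e / (e ^+ 2 + (u - x0) ^+ 2))) - 2 * pi * g1 x0)); last by ring.
apply: le_trans (ler_normD _ _) _; apply: le_trans (lerD h1 h2) _.
have : e * (B + C) <= eta.
  by rewrite /e mulrAC ler_pdivrMr// ler_pM2l// lerDl.
by rewrite !mulrDr mulr1; lra.
Qed.

Lemma intR_sum (I : Type) (r : seq I) (g : I -> R -> R) : (forall i, integrableR (g i)) ->
  integrableR (fun t => \sum_(i <- r) g i t) /\
  intR (fun t => \sum_(i <- r) g i t) = \sum_(i <- r) intR (g i).
Proof.
move=> hg; elim: r => [|i r [ih1 ih2]].
  rewrite big_nil (_ : (fun t => _) = (fun t : R => 0)); last by apply/funext => t; rewrite big_nil.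
  split; last by rewrite /intR Rintegral_cst//= mul0r.
  exact: integrable0.
rewrite big_cons (_ : (fun t => _) = (fun t => g i t + \sum_(i <- r) g i t)); last first.
  by apply/funext => t; rewrite big_cons.
by split; [exact: integrableRD|rewrite intRD// ih2].
Qed.

End RealLineIntegrals.

(** * Green's theorem for closed forms and contour shifts *)

Section Green.
Variable R : realType.
Local Notation mu := (@lebesgue_measure R).
Implicit Types (g : R -> R) (P Q : R -> R -> R).

Definition segint g (a b : R) : R := Rintegral mu `[a, b] g.

Lemma segint_integrable g a b : continuous g -> mu.-integrable `[a, b] (EFin \o g).
Proof.
move=> cg; apply: continuous_compact_integrable; first exact: segment_compact.
exact: continuous_subspaceT.
Qed.

Lemma segint_split g a b c : continuous g -> a <= c -> c <= b ->
  segint g a b = segint g a c + segint g c b.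
Proof.
move=> cg ac cb; rewrite /segint.
have ig := @segint_integrable g a b cg.
have := @Rintegral_itvB R g (BLeft a) (BRight b) c ig.
rewrite !bnd_simp => /(_ ac cb) => h.
have -> : \int[mu]_(x in `[c, b]) g x = \int[mu]_(x in `]c, b]) g x.
  rewrite Rintegral_itv_obnd_cbnd//.
  apply: integrableS (@segint_integrable g c b cg) => //.
  by apply: subset_itvr; rewrite bnd_simp.
by rewrite -h addrC subrK.
Qed.

Lemma segint_cst (k a b : R) : a <= b -> segint (fun=> k) a b = k * (b - a).
Proof.
move=> ab; rewrite /segint Rintegral_cst//.
have := @lebesgue_measure_itv R `[a, b]; rewrite /= lte_fin => ->.
by case: ltgtP ab => //= -> _; rewrite subrr.
Qed.

Lemma segintB f g a b : continuous f -> continuous g ->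
  segint (fun x => f x - g x) a b = segint f a b - segint g a b.
Proof. by move=> cf cg; rewrite /segint RintegralB//; exact: segint_integrable. Qed.

Lemma segint_le f (K a b : R) : continuous f -> a <= b ->
  (forall x, a <= x <= b -> `|f x| <= K) -> `|segint f a b| <= K * (b - a).
Proof.
move=> cf ab fK; have iF := @segint_integrable f a b cf.
apply: le_trans (le_normr_Rintegral _ iF) _ => //.
rewrite -(segint_cst K ab); apply: le_Rintegral => //.
- by apply: (@segint_integrable (fun x => `|f x|)) => x; apply: cvg_norm; exact: cf.
- by apply: (@segint_integrable (fun=> K)); exact: cst_continuous.
Qed.

Lemma segint_near f (k K a b : R) : continuous f -> a <= b ->
  (forall x, a <= x <= b -> `|f x - k| <= K) ->
  `|segint f a b - k * (b - a)| <= K * (b - a).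
Proof.
move=> cf ab fK; rewrite -segint_cst// -segintB//; last exact: cst_continuous.
apply: segint_le => // x; apply: cvgB; [exact: cf|exact: cvg_cst].
Qed.

(** Real differentiability of [p] at (x, y), with partial derivatives [a] and [b], measured in the
    l^1 norm. *)
Definition affine_at (p : R -> R -> R) (x y a b : R) :=
  forall e : R, 0 < e -> exists2 d : R, 0 < d & forall x' y' : R,
    `|x' - x| < d -> `|y' - y| < d ->
    `|p x' y' - p x y - a * (x' - x) - b * (y' - y)| <= e * (`|x' - x| + `|y' - y|).

(* The shared coefficient b says that the form P dx + Q dy is closed. *)
Definition closed_form P Q := forall x y : R, exists a b c : R,
  affine_at P x y a b /\ affine_at Q x y b c.

Lemma affine_at_cont p x y a b : affine_at p x y a b ->
  {for x, continuous (p ^~ y)} /\ {for y, continuous (p x)}.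
Proof.
move=> h; have [d d0 hd] := h _ ltr01.
split; apply/cvgrPdist_le => /= e e0; near=> z.
- have zd : `|z - x| < d.
    by near: z; exists d => //= z /=; rewrite distrC.
  have := hd z y zd; rewrite subrr normr0 mulr0 subr0 addr0 mul1r => /(_ d0) h1.
  rewrite distrC; apply: (@le_trans _ _ ((1 + `|a|) * `|z - x|)).
    rewrite mulrDl mul1r -normrM -lerBlDr; apply: le_trans (lerB_dist _ _) _.
    by [].
  have : `|z - x| < e / (1 + `|a|).
    near: z; exists (e / (1 + `|a|)) => //=; last by move=> z /=; rewrite distrC.
    by rewrite divr_gt0// ltr_wpDr.
  by rewrite ltr_pdivlMr ?ltr_wpDr// mulrC => /ltW.
- have zd : `|z - y| < d.
    by near: z; exists d => //= z /=; rewrite distrC.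
  have := hd x z; rewrite subrr normr0 mulr0 subr0 add0r mul1r => /(_ d0 zd) h1.
  rewrite distrC; apply: (@le_trans _ _ ((1 + `|b|) * `|z - y|)).
    rewrite mulrDl mul1r -normrM -lerBlDr; apply: le_trans (lerB_dist _ _) _.
    by [].
  have : `|z - y| < e / (1 + `|b|).
    near: z; exists (e / (1 + `|b|)) => //=; last by move=> z /=; rewrite distrC.
    by rewrite divr_gt0// ltr_wpDr.
  by rewrite ltr_pdivlMr ?ltr_wpDr// mulrC => /ltW.
Unshelve. all: by end_near. Qed.

Lemma nested_segments (a b : nat -> R) :
  (forall n, a n <= a n.+1) -> (forall n, b n.+1 <= b n) ->
  (forall n, a n <= b n) -> exists x, forall n, a n <= x <= b n.
Proof.
move=> ai bi ab.
have aD n m : a n <= a (n + m)%N.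
  by elim: m => [|m ih]; rewrite ?addn0// addnS (le_trans ih).
have bD n m : b (n + m)%N <= b n.
  by elim: m => [|m ih]; rewrite ?addn0// addnS (le_trans (bi _)).
have anbm n m : a n <= b m.
  by rewrite (le_trans (aD n m))// (le_trans (ab _))// addnC.
have ne : range a !=set0 by exists (a 0%N), 0%N.
exists (sup (range a)) => n; apply/andP; split.
  by apply: ub_le_sup; [exists (b 0%N) => _ [m _ <-]|exists n].
by apply: ge_sup => // _ [m _ <-].
Qed.

Section Bisection.
Variables P Q : R -> R -> R.
Hypothesis PQ : closed_form P Q.

Let cP1 y : continuous (P ^~ y).
Proof. by move=> x; have [a [b [c [/affine_at_cont[]]]]] := PQ x y. Qed.
Let cQ2 x : continuous (Q x).
Proof. by move=> y; have [a [b [c [_ /affine_at_cont[]]]]] := PQ x y. Qed.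

(** The integral of P dx + Q dy counterclockwise along the boundary of a rectangle. *)
Definition circ (x1 x2 y1 y2 : R) :=
  segint (P ^~ y1) x1 x2 - segint (P ^~ y2) x1 x2
  + (segint (Q x2) y1 y2 - segint (Q x1) y1 y2).

Lemma circ_split x y w h : 0 <= w -> 0 <= h ->
  circ x (x + (w + w)) y (y + (h + h)) =
  circ x (x + w) y (y + h) + circ (x + w) (x + w + w) y (y + h) +
  (circ x (x + w) (y + h) (y + h + h) +
   circ (x + w) (x + w + w) (y + h) (y + h + h)).
Proof.
move=> w0 h0; rewrite /circ !addrA.
have hx p : continuous p -> segint p x (x + w + w) = segint p x (x + w) + segint p (x + w) (x + w + w).
  by move=> cp; rewrite -segint_split// lerDl.
have hy p : continuous p -> segint p y (y + h + h) = segint p y (y + h) + segint p (y + h) (y + h + h).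
  by move=> cp; rewrite -segint_split// lerDl.
rewrite !hx; [|exact: cP1|exact: cP1].
rewrite !hy; [|exact: cQ2|exact: cQ2].
by ring.
Qed.

(** The affine parts cancel: the horizontal edges contribute - b h w and the vertical ones b w h,
    with the same [b] by closedness. Only the remainders are left, at most 2 e (w + h) per unit of
    length of each pair of opposite edges. *)
Lemma circ_local (x y e : R) : 0 < e -> exists2 d : R, 0 < d &
  forall x1 x2 y1 y2 : R, x1 <= x <= x2 -> y1 <= y <= y2 ->
    x2 - x1 < d -> y2 - y1 < d ->
    `|circ x1 x2 y1 y2| <= 2 * e * (x2 - x1 + (y2 - y1)) ^+ 2.
Proof.
move=> e0; have [a [b [c [hP hQ]]]] := PQ x y.
have [d1 d10 {}hP] := hP _ e0; have [d2 d20 {}hQ] := hQ _ e0.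
exists (Num.min d1 d2); first by rewrite lt_min d10.
move=> x1 x2 y1 y2 /andP[xx1 xx2] /andP[yy1 yy2].
rewrite !lt_min => /andP[w1 w2] /andP[h1 h2].
set w := x2 - x1 in w1 w2 *; set h := y2 - y1 in h1 h2 *.
have in1 (u : R) : x1 <= u <= x2 -> `|u - x| <= w.
  by move=> /andP[u1 u2]; rewrite /w ler_norml; apply/andP; split; lra.
have in2 (u : R) : y1 <= u <= y2 -> `|u - y| <= h.
  by move=> /andP[u1 u2]; rewrite /h ler_norml; apply/andP; split; lra.
have x12 : x1 <= x2 by exact: le_trans xx2.
have y12 : y1 <= y2 by exact: le_trans yy2.
have y1i : y1 <= y1 <= y2 by rewrite lexx.
have y2i : y1 <= y2 <= y2 by rewrite lexx andbT.
have x1i : x1 <= x1 <= x2 by rewrite lexx.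
have x2i : x1 <= x2 <= x2 by rewrite lexx andbT.
have A1 : `|segint (fun u => P u y1 - P u y2) x1 x2 - (- (b * h)) * (x2 - x1)| <=
    (2 * e * (w + h)) * (x2 - x1).
  apply: segint_near => //; first by move=> u; apply: cvgB; exact: cP1.
  move=> u ui.
  have E1 := hP u y1 (le_lt_trans (in1 _ ui) w1) (le_lt_trans (in2 _ y1i) h1).
  have E2 := hP u y2 (le_lt_trans (in1 _ ui) w1) (le_lt_trans (in2 _ y2i) h1).
  rewrite (_ : P u y1 - P u y2 - _ =
    (P u y1 - P x y - a * (u - x) - b * (y1 - y)) -
    (P u y2 - P x y - a * (u - x) - b * (y2 - y))); last by rewrite /h; ring.
  apply: le_trans (ler_normB _ _) _; apply: le_trans (lerD E1 E2) _.
  rewrite -mulrDr -mulrA mulrCA ler_pM2l//.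
  have := in1 _ ui; have := in2 _ y1i; have := in2 _ y2i; lra.
have A2 : `|segint (fun u => Q x2 u - Q x1 u) y1 y2 - (b * w) * (y2 - y1)| <=
    (2 * e * (w + h)) * (y2 - y1).
  apply: segint_near => //; first by move=> u; apply: cvgB; exact: cQ2.
  move=> u ui.
  have E1 := hQ x2 u (le_lt_trans (in1 _ x2i) w2) (le_lt_trans (in2 _ ui) h2).
  have E2 := hQ x1 u (le_lt_trans (in1 _ x1i) w2) (le_lt_trans (in2 _ ui) h2).
  rewrite (_ : Q x2 u - Q x1 u - _ =
    (Q x2 u - Q x y - b * (x2 - x) - c * (u - y)) -
    (Q x1 u - Q x y - b * (x1 - x) - c * (u - y))); last by rewrite /w; ring.
  apply: le_trans (ler_normB _ _) _; apply: le_trans (lerD E1 E2) _.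
  rewrite -mulrDr -mulrA mulrCA ler_pM2l//.
  have := in2 _ ui; have := in1 _ x1i; have := in1 _ x2i; lra.
rewrite /circ -!segintB//.
rewrite (_ : _ + _ = (segint (fun u => P u y1 - P u y2) x1 x2 - (- (b * h)) * (x2 - x1))
   + (segint (fun u => Q x2 u - Q x1 u) y1 y2 - (b * w) * (y2 - y1))); last first.
  by rewrite /w /h; ring.
apply: le_trans (ler_normD _ _) _; apply: le_trans (lerD A1 A2) _.
by rewrite le_eqVlt; apply/orP; left; apply/eqP; rewrite /w /h; ring.
Qed.

(** Goursat's bisection: one of the four quarters keeps at least a quarter of the absolute value.
    After n steps the loss 4^n is compensated exactly by the quadratic bound of [circ_local] at the
    common point of the nested rectangles. *)
Lemma green_rectangle x1 x2 y1 y2 : x1 <= x2 -> y1 <= y2 -> circ x1 x2 y1 y2 = 0.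
Proof.
move=> x12 y12; pose w n := (x2 - x1) / 2 ^+ n; pose h n := (y2 - y1) / 2 ^+ n.
have w0 n : 0 <= w n by rewrite divr_ge0 ?subr_ge0// exprn_ge0.
have h0 n : 0 <= h n by rewrite divr_ge0 ?subr_ge0// exprn_ge0.
have wS n : w n = w n.+1 + w n.+1.
  by rewrite /w exprS; field; rewrite expf_neq0.
have hS n : h n = h n.+1 + h n.+1.
  by rewrite /h exprS; field; rewrite expf_neq0.
pose c n x y := circ x (x + w n) y (y + h n).
(* The two booleans tell whether the right half and the upper half are kept. The statement covers
   every corner at every level, so that [choice] turns it into a selection function for the
   recursion. *)
have step : forall z : nat * R * R, exists ij : bool * bool,
    `|c z.1.1 z.1.2 z.2| <= 4 * `|c z.1.1.+1 (z.1.2 + ij.1%:R * w z.1.1.+1)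
                               (z.2 + ij.2%:R * h z.1.1.+1)|.
  move=> [[n x] y] /=; have := @circ_split x y _ _ (w0 n.+1) (h0 n.+1).
  rewrite -wS -hS -/(c n x y) => E.
  apply: contrapT => /forallNP H.
  have {H} H (i j : bool) : `|c n.+1 (x + i%:R * w n.+1) (y + j%:R * h n.+1)| < `|c n x y| / 4.
    have /negP := H (i, j); rewrite -ltNge /= => H'.
    by rewrite ltr_pdivlMr// mulrC.
  have := H false false; have := H true false; have := H false true; have := H true true.
  rewrite !mul0r !mul1r !addr0 /c => h1 h2 h3 h4.
  move: E; move: h1 h2 h3 h4.
  set c1 := circ _ _ _ _; set c2 := circ _ _ _ _; set c3 := circ _ _ _ _.
  set c4 := circ _ _ _ _; set cc := circ _ _ _ _ => h1 h2 h3 h4 E.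
  have : `|c2| <= `|cc| + `|c4| + (`|c3| + `|c1|).
    rewrite -[c2]/(c n x y) E; apply: le_trans (ler_normD _ _) _.
    by apply: lerD; apply: le_trans (ler_normD _ _) _.
  by lra.
have [sel hsel] := choice step.
pose z := fix z n : R * R := if n is m.+1 then
   ((z m).1 + (sel (m, (z m).1, (z m).2)).1%:R * w m.+1,
    (z m).2 + (sel (m, (z m).1, (z m).2)).2%:R * h m.+1) else (x1, y1).
have zc n : `|circ x1 x2 y1 y2| <= 4 ^+ n * `|c n (z n).1 (z n).2|.
  elim: n => [|n ih].
    by rewrite expr0 mul1r /c /= /w /h expr0 !divr1 ![_ + (_ - _)]addrC !subrK.
  apply: le_trans ih _; rewrite exprSr -[leRHS]mulrA ler_pM2l ?exprn_gt0//.
  exact: (hsel (n, (z n).1, (z n).2)).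
have b01 (b : bool) (t : R) : 0 <= t -> 0 <= b%:R * t <= t.
  by case: b => t0; rewrite ?mul1r ?mul0r lexx t0.
have [x hx] : exists x, forall n, (z n).1 <= x <= (z n).1 + w n.
  apply: nested_segments => n; last by rewrite lerDl.
  - by rewrite /= lerDl; case/andP: (b01 (sel (n, (z n).1, (z n).2)).1 _ (w0 n.+1)).
  - by rewrite (wS n) /= -addrA lerD2l lerD2r; case/andP: (b01 (sel (n, (z n).1, (z n).2)).1 _ (w0 n.+1)).
have [y hy] : exists y, forall n, (z n).2 <= y <= (z n).2 + h n.
  apply: nested_segments => n; last by rewrite lerDl.
  - by rewrite /= lerDl; case/andP: (b01 (sel (n, (z n).1, (z n).2)).2 _ (h0 n.+1)).
  - by rewrite (hS n) /= -addrA lerD2l lerD2r; case/andP: (b01 (sel (n, (z n).1, (z n).2)).2 _ (h0 n.+1)).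
apply: (@le_all_eq0 _ _ (2 * (x2 - x1 + (y2 - y1)) ^+ 2)).
  by rewrite mulr_ge0// sqr_ge0.
move=> e e0; have [d d0 hd] := circ_local x y e0.
have small (t : R) : 0 <= t -> exists N, forall n, (N <= n)%N -> t / 2 ^+ n < d.
  move=> t0; have [N tN] : exists N : nat, t / d < N%:R.
    exists (Num.truncn (t / d)).+1; rewrite truncnS_gt// num_real//.
  exists N => n Nn; rewrite ltr_pdivrMr ?exprn_gt0// mulrC -ltr_pdivrMr//.
  apply: lt_trans tN _; apply: (@le_lt_trans _ _ n%:R); first by rewrite ler_nat.
  by rewrite -natrX ltr_nat ltn_expl.
have [N1 hN1] := small (x2 - x1) (ltac:(by rewrite subr_ge0)).
have [N2 hN2] := small (y2 - y1) (ltac:(by rewrite subr_ge0)).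
pose n := maxn N1 N2.
have := zc n.
have := hd _ _ _ _ (hx n) (hy n).
rewrite ![_ + w n - _]addrAC ![_ + h n - _]addrAC !subrr !add0r.
rewrite hN1 ?leq_maxl// hN2 ?leq_maxr// => /(_ isT isT) hh H.
apply: le_trans H _; apply: le_trans (ler_wpM2l _ hh) _; first exact: exprn_ge0.
rewrite le_eqVlt; apply/orP; left; apply/eqP.
rewrite /w /h -mulrDl exprMn exprVn -exprM mulnC exprM.
have -> : (2 ^+ 2 : R) = 4 by ring.
by field; rewrite expf_neq0.
Qed.

End Bisection.

(** Green's theorem on the strip cut at height T. The exponent 2 serves twice: one factor 1 / (1 +
    y^2) makes the tails of the vertical lines integrable, the other makes them O(1 / (1 + T^2)),
    like the horizontal edges. *)
Lemma strip_shift P Q (K c1 c2 : R) : closed_form P Q -> c1 <= c2 ->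
  (forall x y, c1 <= x <= c2 -> `|P x y| <= K / (1 + y ^+ 2) ^+ 2) ->
  (forall x y, c1 <= x <= c2 -> `|Q x y| <= K / (1 + y ^+ 2) ^+ 2) ->
  [/\ integrableR (Q c1), integrableR (Q c2) & intR (Q c1) = intR (Q c2)].
Proof.
move=> PQ c12 hP hQ.
have c1i : c1 <= c1 <= c2 by rewrite lexx.
have c2i : c1 <= c2 <= c2 by rewrite lexx andbT.
have K0 : 0 <= K.
  by have := le_trans (normr_ge0 _) (hQ c1 0 c1i); rewrite expr0n/= addr0 expr1n divr1.
have cP y : continuous (P ^~ y).
  by move=> x; have [a [b [c [/affine_at_cont[]]]]] := PQ x y.
have cQ x : continuous (Q x).
  by move=> y; have [a [b [c [_ /affine_at_cont[]]]]] := PQ x y.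
pose q (y : R) : R := 2 * 1 / (1 ^+ 2 + (y - 0) ^+ 2).
have [iq vq] := poisson_kernel_int (0 : R) ltr01; rewrite -/q in iq vq.
have p1 (y : R) : 1 <= 1 + y ^+ 2 by rewrite lerDl sqr_ge0.
have p0 (y : R) : 0 < 1 + y ^+ 2 by exact: lt_le_trans (p1 y).
have q0 y : 0 <= q y by rewrite /q divr_ge0 ?mulr_ge0// expr1n subr0 ltW.
have qE y : q y = 2 / (1 + y ^+ 2) by rewrite /q expr1n subr0 mulr1.
clearbody q.
have iQ (c : R) : c1 <= c <= c2 -> integrableR (Q c).
  move=> ci; apply: (@integrableR_le _ _ (fun y => K * q y)).
  - exact: continuous_measurable.
  - exact: integrableRZ.
  - move=> y; apply: le_trans (hQ _ _ ci) _.
    rewrite ger0_norm ?mulr_ge0// qE ler_wpM2l// expr2 invfM.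
    rewrite ler_wpM2r ?invr_ge0 ?(ltW (p0 y))//.
    by apply: (@le_trans _ _ 1); rewrite ?invf_le1// ler1n.
have tail (c T : R) : c1 <= c <= c2 -> 0 <= T ->
    `|intR (Q c) - segint (Q c) (- T) T| <= K / (1 + T ^+ 2) * (2 * pi).
  move=> ci T0; rewrite -vq -intRZ// /segint Rintegral_mkcond -/(intR _).
  have ir : integrableR (Q c \_ `[(- T), T]).
    apply: (integrableR_le _ (iQ _ ci)) => [|y].
      have mQ := integrableR_measurable (iQ _ ci).
      by apply/(measurable_restrictT _ _).1 => //; apply: measurable_funTS.
    by rewrite patchE; case: ifP => // _; rewrite normr0.
  rewrite -intRB//; last exact: iQ.
  apply: norm_intR_le => //; last 2 first.
    exact: integrableRZ.
  move=> y; rewrite patchE; case: ifPn => [_|yT].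
    by rewrite subrr normr0 mulr_ge0// divr_ge0// ltW.
  rewrite subr0; apply: le_trans (hQ _ _ ci) _.
  rewrite qE -mulrA ler_wpM2l// expr2 invfM.
  have h : (1 + y ^+ 2)^-1 <= (1 + T ^+ 2)^-1.
    rewrite lef_pV2 ?posrE// lerD2l -[leRHS]real_normK ?num_real//.
    rewrite lerXn2r ?nnegrE//; move: yT; rewrite notin_setE/= in_itv/= => /negP.
    by rewrite -ler_norml -ltNge => /ltW.
  apply: ler_pM => //; rewrite ?invr_ge0 ?(ltW (p0 y))//.
  by rewrite ler_peMl ?invr_ge0 ?(ltW (p0 y))// ler1n.
  have := integrableRD (iQ _ ci) (integrableRZ (-1) ir).
  by congr integrableR; apply/funext => u; rewrite mulN1r.
split; [exact: iQ|exact: iQ|].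
apply/eqP; rewrite -subr_eq0; apply/eqP.
apply: (@le_all_eq0 _ _ (K * (4 * pi + 2 * (c2 - c1)))).
  by rewrite mulr_ge0// addr_ge0// mulr_ge0// ?pi_ge0// subr_ge0.
(* With this height 1 / (1 + T^2) is at most e. *)
move=> e e0; pose T := 1 + e^-1.
have T0 : 0 < T by rewrite addr_gt0// invr_gt0.
have Te : (1 + T ^+ 2)^-1 <= e.
  rewrite -[e]invrK lef_pV2 ?posrE ?invr_gt0//.
  apply: (@le_trans _ _ T); first by rewrite /T lerDr.
  by apply: (@le_trans _ _ (T ^+ 2)); [rewrite expr2 ler_peMl ?(ltW T0)// /T lerDl invr_ge0 ltW|rewrite lerDr].
have g := green_rectangle PQ c12 (_ : - T <= T); rewrite /circ in g.
have {}g := g (ge0_cp (ltW T0)).2.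
have hT1 := tail _ _ c1i (ltW T0); have hT2 := tail _ _ c2i (ltW T0).
have hseg y : `|segint (P ^~ y) c1 c2| <= K / (1 + y ^+ 2) * (c2 - c1).
  apply: segint_le => // x xi; apply: le_trans (hP _ _ xi) _.
  rewrite ler_wpM2l// lef_pV2 ?posrE ?exprn_gt0// [leRHS]expr2 ler_peMl ?(ltW (p0 y))//.
have g1 := hseg T; have g2 := hseg (- T); rewrite sqrrN in g2.
rewrite (_ : intR (Q c1) - intR (Q c2) =
   (intR (Q c1) - segint (Q c1) (- T) T) - (intR (Q c2) - segint (Q c2) (- T) T)
   + (segint (P ^~ (- T)) c1 c2 - segint (P ^~ T) c1 c2)); last by lra.
apply: (@le_trans _ _ (K / (1 + T ^+ 2) * (4 * pi + 2 * (c2 - c1)))).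
  apply: le_trans (ler_normD _ _) _; rewrite mulrDr; apply: lerD.
    apply: le_trans (ler_normB _ _) _; lra.
  apply: le_trans (ler_normB _ _) _; lra.
rewrite mulrAC [e * _]mulrC ler_wpM2l// mulr_ge0// addr_ge0// mulr_ge0 ?pi_ge0//.
by rewrite subr_ge0.
Qed.

End Green.

(** * Transforms along vertical lines *)

Section LineTransforms.
Variable R : realType.
Implicit Types g : R -> R.
Local Notation mu := (@lebesgue_measure R).

(** The exponent is a currency: one power of 1 + t^2 buys integrability, and one pays for a factor
    t. *)
Definition decays n g := continuous g /\
  exists K : R, forall t, `|g t| <= K / (1 + t ^+ 2) ^+ n.

Lemma oneDsq_ge1 (t : R) : 1 <= 1 + t ^+ 2.
Proof. by rewrite lerDl sqr_ge0. Qed.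

Lemma oneDsq_gt0 (t : R) : 0 < 1 + t ^+ 2.
Proof. exact: lt_le_trans (oneDsq_ge1 t). Qed.
Hint Resolve oneDsq_ge1 oneDsq_gt0 : core.

Lemma norm_le_oneDsq (t : R) : `|t| <= 1 + t ^+ 2.
Proof.
rewrite -[t ^+ 2]real_normK ?num_real//.
by have := sqr_ge0 (`|t| - 2^-1); rewrite expr2; lra.
Qed.

Lemma decaysW n g : decays n.+1 g -> decays n g.
Proof.
move=> [cg [K gK]]; split => //; exists K => t; apply: le_trans (gK t) _.
have K0 : 0 <= K.
  have := le_trans (normr_ge0 _) (gK 0).
  by rewrite expr0n/= addr0 expr1n divr1.
rewrite ler_wpM2l// lef_pV2 ?posrE ?exprn_gt0// [(1 + t ^+ 2) ^+ n.+1]exprS ler_peMl//.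
by rewrite ltW// exprn_gt0.
Qed.

Lemma decaysM n g : decays n.+1 g -> decays n (fun t => t * g t).
Proof.
move=> [cg [K gK]]; split; first by move=> t; apply: cvgM; [exact: cvg_id|exact: cg].
exists K => t; rewrite normrM.
apply: (@le_trans _ _ ((1 + t ^+ 2) * (K / (1 + t ^+ 2) ^+ n.+1))).
  by apply: ler_pM => //; exact: norm_le_oneDsq.
rewrite [(1 + t ^+ 2) ^+ n.+1]exprS le_eqVlt; apply/orP; left; apply/eqP; field.
by rewrite expf_neq0//= lt0r_neq0.
Qed.

Lemma decaysD n f g : decays n f -> decays n g -> decays n (fun t => f t + g t).
Proof.
move=> [cf [K fK]] [cg [L gL]]; split; first by move=> t; apply: cvgD; [exact: cf|exact: cg].
exists (K + L) => t; rewrite mulrDl; apply: le_trans (ler_normD _ _) _.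
exact: lerD.
Qed.

Lemma decaysZ n k g : decays n g -> decays n (fun t => k * g t).
Proof.
move=> [cg [K gK]]; split; first by move=> t; apply: cvgM; [exact: cvg_cst|exact: cg].
by exists (`|k| * K) => t; rewrite normrM -mulrA ler_wpM2l.
Qed.

Lemma decaysN n g : decays n g -> decays n (fun t => - g t).
Proof. by move=> /(decaysZ (-1)); under eq_fun do rewrite mulN1r. Qed.

Lemma oneDsqV_integrable : integrableR (fun t : R => (1 + t ^+ 2)^-1).
Proof.
have [i _] := poisson_kernel_int (0 : R) ltr01.
have := integrableRZ 2^-1 i; congr integrableR; apply/funext => t.
by rewrite subr0 expr1n mulr1 mulrA mulVf ?mul1r.
Qed.

Lemma decays_integrable n g : decays n.+1 g -> integrableR g.
Proof.
elim: n => [|n ih]; last by move=> /decaysW.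
move=> [cg [K gK]]; apply: (integrableR_le _ (integrableRZ K oneDsqV_integrable)).
  exact: continuous_measurable.
by move=> t; rewrite (le_trans (gK t))// expr1 ler_norm.
Qed.

(** The real part of the integral of (g1 + i g2)(t) exp(-i t u). *)
Definition trig g1 g2 (u : R) : R :=
  intR (fun t => g1 t * cos (t * u) + g2 t * sin (t * u)).

Lemma abs_cos_le1 (x : R) : `|cos x| <= 1.
Proof. by rewrite ler_norml cos_geN1 cos_le1. Qed.

Lemma abs_sin_le1 (x : R) : `|sin x| <= 1.
Proof. by rewrite ler_norml sin_geN1 sin_le1. Qed.

Lemma trig_integrable g1 g2 u : integrableR g1 -> integrableR g2 ->
  integrableR (fun t => g1 t * cos (t * u) + g2 t * sin (t * u)).
Proof.
move=> i1 i2; apply: integrableRD; apply: integrableRM => //.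
- exact: continuous_measurable (@cont_cosl R u).
- by exists 1 => t; exact: abs_cos_le1.
- exact: continuous_measurable (@cont_sinl R u).
- by exists 1 => t; exact: abs_sin_le1.
Qed.

Lemma trig_bound g1 g2 u : integrableR g1 -> integrableR g2 ->
  `|trig g1 g2 u| <= intR (fun t => `|g1 t| + `|g2 t|).
Proof.
move=> i1 i2; apply: norm_intR_le.
- exact: trig_integrable.
- by apply: integrableRD; exact: integrableR_norm.
move=> t; apply: le_trans (ler_normD _ _) _; rewrite !normrM; apply: lerD.
  by rewrite ler_piMr// abs_cos_le1.
by rewrite ler_piMr// abs_sin_le1.
Qed.

Lemma trig_derive g1 g2 (u : R) : decays 2 g1 -> decays 2 g2 ->
  is_derive u 1 (trig g1 g2) (trig (fun t => t * g2 t) (fun t => - (t * g1 t)) u).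
Proof.
move=> d1 d2.
have i1 := decays_integrable d1; have i2 := decays_integrable d2.
have it1 := decays_integrable (decaysM d1); have it2 := decays_integrable (decaysM d2).
pose f (v t : R) := g1 t * cos (t * v) + g2 t * sin (t * v).
have dx (x y : R) : is_derive x 1 (f ^~ y) (y * g2 y * cos (y * x) - y * g1 y * sin (y * x)).
  have dl : is_derive x 1 (fun v => y * v) y.
    by have := dZ y (is_derive_id x 1); rewrite mulr1.
  apply: is_derive_eq (dD (dZ _ (dcomp (is_derive_cos _) dl)) (dZ _ (dcomp (is_derive_sin _) dl))) _.
  by ring.
have G0 (y : R) : 0 <= `|y * g1 y| + `|y * g2 y| by rewrite addr_ge0.
have iG : integrableR (fun y => `|y * g1 y| + `|y * g2 y|).
  by apply: integrableRD; exact: integrableR_norm.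
have uI : u \in `](u - 1), (u + 1)[ by rewrite in_itv/=; apply/andP; split; lra.
have h1 : forall x, `](u - 1), (u + 1)[%classic x -> mu.-integrable setT (EFin \o f x).
  by move=> x _; exact: trig_integrable.
have h2 : forall x y : R, `](u - 1), (u + 1)[%classic x -> setT y -> derivable (f ^~ y) x 1.
  by move=> x y _ _; case: (dx x y).
have h3 : forall x y : R, `](u - 1), (u + 1)[%classic x -> setT y ->
    `|partial1of2 f x y| <= `|y * g1 y| + `|y * g2 y|.
  move=> x y _ _; rewrite partial1of2E (@derive_val _ _ _ _ _ _ _ (dx x y)).
  apply: le_trans (ler_normB _ _) _; rewrite addrC !(normrM _ (cos _)) !(normrM _ (sin _)).
  apply: lerD; first by rewrite ler_piMr// abs_sin_le1.
  by rewrite ler_piMr// abs_cos_le1.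
have D := derivable_under_integral measurableT uI h1 h2 G0 iG h3.
have E := differentiation_under_integral measurableT uI h1 h2 G0 iG h3.
apply: DeriveDef; first exact: D.
rewrite -derive1E [LHS]E /trig; apply: eq_intR => t.
by rewrite partial1of2E (@derive_val _ _ _ _ _ _ _ (dx u t)); ring.
Qed.

(* u |-> e^{-cu} Re (int g(t) e^{-itu} dt): a vertical-line Mellin inversion
   integral in the variable u = ln x. *)
Definition lineM (c : R) g1 g2 (u : R) : R := expR (- (c * u)) * trig g1 g2 u.

(** For G = g1 + i g2 on the line Re s = c, differentiating exp(-s u) multiplies G by -s; the two
    new components are the real and imaginary part of (c + i t) G. *)
Lemma lineM_derive c g1 g2 (u : R) : decays 2 g1 -> decays 2 g2 ->
  is_derive u 1 (lineM c g1 g2)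
    (- lineM c (fun t => c * g1 t - t * g2 t) (fun t => c * g2 t + t * g1 t) u).
Proof.
move=> d1 d2.
have i1 := decays_integrable d1; have i2 := decays_integrable d2.
have it1 := decays_integrable (decaysM d1); have it2 := decays_integrable (decaysM d2).
have de : is_derive u 1 (fun u => expR (- (c * u))) (expR (- (c * u)) * (- c)).
  have dl : is_derive u 1 (fun v => - (c * v)) (- c).
    by have := dZ (- c) (is_derive_id u 1); rewrite mulr1; under eq_fun do rewrite mulNr.
  exact: dcomp (is_derive_expR _) dl.
apply: is_derive_eq (dM de (trig_derive u d1 d2)) _.
have E : trig (fun t => c * g1 t - t * g2 t) (fun t => c * g2 t + t * g1 t) u =
   c * trig g1 g2 u - trig (fun t => t * g2 t) (fun t => - (t * g1 t)) u.
  rewrite /trig -intRZ; last exact: trig_integrable.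
  rewrite -intRB; last 2 first.
  - by apply: integrableRZ; exact: trig_integrable.
  - apply: trig_integrable => //.
    by have := integrableRZ (-1) it1; under eq_fun do rewrite mulN1r.
  by apply: eq_intR => t; ring.
by rewrite /lineM E; ring.
Qed.

Lemma expR_abs_le (u v K b : R) : 0 <= K -> v <= K * expR (- (b * u)) ->
  v <= K * expR (b * u) -> v <= K * expR (- (b * `|u|)).
Proof.
move=> K0 h1 h2; have [u0|u0] := leP 0 u; first by rewrite ger0_norm.
by rewrite ltr0_norm// mulrN opprK.
Qed.

Lemma exp_abs_le_integrable g (K b : R) : 0 < b -> measurable_fun setT g ->
  (forall u, `|g u| <= K * expR (- (b * `|u|))) -> integrableR g.
Proof.
move=> b0 mg gK; have [ie _] := exp_abs_int b0.
apply: (integrableR_le mg (integrableRZ K ie)) => u.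
by rewrite (le_trans (gK u))// ler_norm.
Qed.

(** Half of the exponential rate absorbs the factor u, by b |u| <= exp(b |u|). *)
Lemma exp_abs_leM g (K b : R) : 0 < b ->
  (forall u, `|g u| <= K * expR (- ((b + b) * `|u|))) ->
  forall u, `|u * g u| <= K / b * expR (- (b * `|u|)).
Proof.
move=> b0 gK u; rewrite normrM; apply: le_trans (ler_wpM2l _ (gK u)) _ => //.
have K0 : 0 <= K.
  by have := le_trans (normr_ge0 _) (gK 0); rewrite normr0 mulr0 oppr0 expR0 mulr1.
rewrite mulrDl opprD expRD mulrCA -[K / b * _]mulrA ler_wpM2l//.
rewrite mulrA ler_wpM2r ?expR_ge0// -[leRHS]mulr1 ler_pdivlMl// mulrA.
rewrite expRN ler_pdivrMr ?expR_gt0// mul1r.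
by apply: le_trans (expR_ge1Dx _); rewrite lerDr.
Qed.

Lemma cosB1_le (x : R) : `|cos x - 1| <= x ^+ 2.
Proof.
rewrite -[x ^+ 2]real_normK ?num_real//.
have sinb (y : R) : `|sin y| <= `|y|.
  wlog y0 : y / 0 <= y.
    move=> H; have [/H//|/ltW y0] := leP 0 y.
    by have := H (- y); rewrite sinN !normrN oppr_ge0; apply.
  have [->|yn0] := eqVneq y 0; first by rewrite sin0.
  have [|z _] := @MVT_segment _ sin cos 0 y y0.
    by apply: continuous_subspaceT; exact: continuous_sin.
  rewrite sin0 !subr0 => ->; rewrite normrM ler_piMl//; exact: abs_cos_le1.
wlog x0 : x / 0 <= x.
  move=> H; have [/H//|/ltW x0] := leP 0 x.
  by have := H (- x); rewrite cosN !normrN oppr_ge0; apply.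
have [|z] := @MVT_segment _ cos (fun y => - sin y) 0 x x0.
  by apply: continuous_subspaceT; exact: continuous_cos.
rewrite in_itv/= cos0 subr0 => /andP[z0 zx] ->.
rewrite normrM normrN expr2 ler_wpM2r// (le_trans (sinb z))//.
by rewrite !ger0_norm.
Qed.

Lemma sinB_le (x : R) : `|sin x - x| <= `|x| ^+ 3.
Proof.
wlog x0 : x / 0 <= x.
  move=> H; have [/H//|/ltW x0] := leP 0 x.
  by have := H (- x); rewrite sinN !normrN oppr_ge0 opprK addrC distrC; apply.
have dS (z : R) : is_derive z 1 (fun y => sin y - y) (cos z - 1).
  exact: dB (is_derive_sin z) (is_derive_id z 1).
have [|z] := @MVT_segment _ (fun y => sin y - y) (fun y => cos y - 1) 0 x x0.
  by apply: continuous_subspaceT => z; exact: is_derive_continuous (dS z).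
rewrite in_itv/= sin0 !subr0 => /andP[z0 zx] ->.
rewrite normrM exprSr ler_wpM2r// (le_trans (cosB1_le z))//.
by rewrite ger0_norm// lerXn2r// nnegrE.
Qed.

Lemma sinB_le_sqr (x : R) : `|sin x - x| <= x ^+ 2.
Proof.
wlog x0 : x / 0 <= x.
  move=> H; have [/H//|/ltW x0] := leP 0 x.
  by have := H (- x); rewrite sinN sqrrN opprK addrC distrC oppr_ge0; apply.
have dS (z : R) : is_derive z 1 (fun y => sin y - y) (cos z - 1).
  exact: dB (is_derive_sin z) (is_derive_id z 1).
have [|z] := @MVT_segment _ (fun y => sin y - y) (fun y => cos y - 1) 0 x x0.
  by apply: continuous_subspaceT => z; exact: is_derive_continuous (dS z).
rewrite in_itv/= sin0 !subr0 => /andP[z0 zx] ->.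
rewrite normrM (ger0_norm x0) expr2 ler_wpM2r//.
have [|y] := @MVT_segment _ cos (fun y => - sin y) 0 z z0.
  by apply: continuous_subspaceT; exact: continuous_cos.
rewrite cos0 subr0 => _ ->; rewrite normrM normrN (ger0_norm z0).
by apply: le_trans zx; rewrite ler_piMl// abs_sin_le1.
Qed.

End LineTransforms.

(** * Complex differentiability and the Cauchy-Riemann equations *)

Section ComplexDifferentiable.
Local Open Scope complex_scope.
Variable R : realType.
Local Notation C := R[i].
Local Notation Re := (@complex.Re R).
Local Notation Im := (@complex.Im R).
Local Notation normc := (@Normc.normc R).
Implicit Types (G : C -> C) (s z : C).

Lemma normc_sqrtE z : normc z = Num.sqrt (Re z ^+ 2 + Im z ^+ 2).
Proof. by case: z. Qed.

Lemma normc_ge0 z : 0 <= normc z.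
Proof. by rewrite normc_sqrtE sqrtr_ge0. Qed.
Hint Resolve normc_ge0 : core.

Lemma normc_sq z : normc z ^+ 2 = Re z ^+ 2 + Im z ^+ 2.
Proof. by rewrite normc_sqrtE sqr_sqrtr// addr_ge0 ?sqr_ge0. Qed.

Lemma Re_le_normc z : `|Re z| <= normc z.
Proof.
rewrite -(@ler_sqr _ `|Re z|) ?nnegrE// normc_sq real_normK ?num_real//.
by rewrite lerDl sqr_ge0.
Qed.

Lemma Im_le_normc z : `|Im z| <= normc z.
Proof.
rewrite -(@ler_sqr _ `|Im z|) ?nnegrE// normc_sq real_normK ?num_real//.
by rewrite lerDr sqr_ge0.
Qed.

Lemma normc_le z : normc z <= `|Re z| + `|Im z|.
Proof.
rewrite -(@ler_sqr _ (normc z)) ?nnegrE ?addr_ge0// normc_sq sqrrD !real_normK ?num_real//.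
by rewrite addrAC lerDl mulrn_wge0// mulr_ge0.
Qed.

Lemma normc_gt0 z : (0 < normc z) = (z != 0).
Proof.
rewrite lt_neqAle normc_ge0 andbT eq_sym; congr negb.
by apply/eqP/eqP => [/Normc.eq0_normc//|->]; rewrite Normc.normc0.
Qed.

Lemma normr_normc z : `|z| = (normc z)%:C.
Proof. by case: z. Qed.

Lemma normcD z s : normc (z + s) <= normc z + normc s.
Proof. by rewrite -lecR rmorphD/= -!normr_normc ler_normD. Qed.

Lemma normcN z : normc (- z) = normc z.
Proof. by rewrite !normc_sqrtE; case: z => a b /=; rewrite !sqrrN. Qed.

Lemma normcB z s : normc (z - s) <= normc z + normc s.
Proof. by rewrite -(normcN s) normcD. Qed.

Lemma normcR (x : R) : normc x%:C = `|x|.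
Proof. by rewrite normc_sqrtE /= expr0n/= addr0 sqrtr_sqr. Qed.

(** A division-free form of complex differentiability, with the real-valued modulus, in which z = s
    is no special case. *)
Definition cdiff G s := exists L : C, forall e : R, 0 < e ->
  exists2 d : R, 0 < d & forall z, normc (z - s) < d ->
    normc (G z - G s - (z - s) * L) <= e * normc (z - s).

Lemma realC_gt0 (e : R) : 0 < e -> 0 < e%:C :> C.
Proof. by rewrite ltcR. Qed.

Lemma derivable_cdiff G s : derivable (G : C^o -> C^o) s 1 -> cdiff G s.
Proof.
move=> /cvg_ex[/= L /cvgrPdist_lt hL]; exists (L : C) => e e0.
have := hL _ (realC_gt0 e0).
move=> [/= d d0 hd].
(* The neighbourhood filter of R[i] yields a radius in R[i]; being positive, it is real. *)
have dE : d = (Re d)%:C.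
  by move: (gtr0_real d0); case: (d) => a b; rewrite complex_real /= => /eqP ->.
have rd0 : 0 < Re d by move: d0; rewrite dE ltcR.
exists (Re d) => // z zd.
have [->|zs] := eqVneq z s.
  by rewrite !subrr mul0r subr0 Normc.normc0 mulr0.
have zs0 : z - s != 0 by rewrite subr_eq0.
have := hd (z - s); rewrite /ball_/= sub0r normrN normr_normc dE ltcR zd => /(_ isT zs0).
rewrite normr_normc ltcR => /ltW.
have -> : (z - s) *: (1 : C^o) + s = z by rewrite /GRing.scale/= mulr1 subrK.
move=> h; rewrite -(mulrC (normc (z - s))) -[X in normc X]opprK normcN opprB.
have -> : (z - s) * L - (G z - G s) = (z - s) * (L - (z - s)^-1 *: (G z - G s : C^o)).
  by rewrite mulrBr /GRing.scale/= mulVKf.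
by rewrite Normc.normcM ler_wpM2l.
Qed.

Lemma cdiff_near G G' s (r : R) : 0 < r ->
  (forall z, normc (z - s) < r -> G' z = G z) -> cdiff G s -> cdiff G' s.
Proof.
move=> r0 h [L hL]; exists L => e e0; have [d d0 hd] := hL e e0.
exists (Num.min d r); first by rewrite lt_min d0.
move=> z; rewrite lt_min => /andP[zd zr]; rewrite !h ?subrr ?Normc.normc0//.
exact: hd.
Qed.

Lemma cdiff_id s : cdiff id s.
Proof.
exists 1 => e e0; exists 1 => // z _.
by rewrite mulr1 subrr Normc.normc0 mulr_ge0// ltW.
Qed.

Lemma cdiff_cst (k : C) s : cdiff (fun=> k) s.
Proof.
exists 0 => e e0; exists 1 => // z _.
by rewrite subrr mulr0 subrr Normc.normc0 mulr_ge0// ltW.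
Qed.

Lemma cdiffM G1 G2 s : cdiff G1 s -> cdiff G2 s -> cdiff (fun z => G1 z * G2 z) s.
Proof.
move=> [L1 h1] [L2 h2]; exists (L1 * G2 s + G1 s * L2) => e e0.
(* With |h| <= e' <= 1, these are the factors of e' |h| in the bounds [a1], [a2], [a3] for the three
   remainder terms of the product. *)
pose M := normc (G1 s) + normc L1 * (normc L2 + 1) + (normc (G2 s) + normc L2 + 1).
have M0 : 0 < M by rewrite /M ltr_wpDl ?addr_ge0 ?mulr_ge0 ?addr_ge0// ltr_wpDl ?addr_ge0.
pose e' := Num.min 1 (e / M).
have e'0 : 0 < e' by rewrite lt_min ltr01 divr_gt0.
have e'1 : e' <= 1 by rewrite ge_min lexx.
have e'M : e' * M <= e by rewrite -ler_pdivlMr// ge_min lexx orbT.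
clearbody e'.
have [d1 d10 hd1] := h1 _ e'0; have [d2 d20 hd2] := h2 _ e'0.
exists (Num.min e' (Num.min d1 d2)); first by rewrite !lt_min e'0 d10.
move=> z; rewrite !lt_min => /and3P[ze z1 z2].
have {hd1} := hd1 _ z1; have {hd2} := hd2 _ z2.
set h := z - s in ze z1 z2 *; set E1 := G1 z - _ - _; set E2 := G2 z - _ - _ => b2 b1.
have G2z : G2 z = G2 s + h * L2 + E2 by rewrite /E2; ring.
have G1z : G1 z = G1 s + h * L1 + E1 by rewrite /E1; ring.
have -> : G1 z * G2 z - G1 s * G2 s - h * (L1 * G2 s + G1 s * L2) =
   G1 s * E2 + h * L1 * (h * L2 + E2) + E1 * (G2 s + h * L2 + E2).
  by rewrite G1z G2z; ring.
have nh := normc_ge0 h.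
apply: le_trans (ler_wpM2r nh e'M).
have hE2 : normc E2 <= 1 * 1.
  apply: le_trans b2 _; apply: ler_pM => //; first exact: ltW.
  exact: le_trans (ltW ze) e'1.
have hL2 : normc (h * L2) <= normc L2.
  by rewrite Normc.normcM ler_piMl// (le_trans (ltW ze)).
have a1 : normc (G1 s * E2) <= normc (G1 s) * (e' * normc h).
  by rewrite Normc.normcM ler_wpM2l.
have a2 : normc (h * L1 * (h * L2 + E2)) <= normc h * normc L1 * (e' * (normc L2 + 1)).
  rewrite !Normc.normcM ler_wpM2l ?mulr_ge0//.
  apply: le_trans (normcD _ _) _; rewrite mulrDr lerD//.
    by rewrite Normc.normcM ler_wpM2r// ltW.
  apply: le_trans b2 _; rewrite ler_wpM2l ?(ltW e'0)//.
  exact: le_trans (ltW ze) e'1.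
have a3 : normc (E1 * (G2 s + h * L2 + E2)) <= e' * normc h * (normc (G2 s) + normc L2 + 1).
  rewrite Normc.normcM; apply: ler_pM => //.
  apply: le_trans (normcD _ _) _; apply: lerD; last by rewrite mul1r in hE2.
  by apply: le_trans (normcD _ _) _; rewrite lerD2l.
apply: le_trans (normcD _ _) _; apply: le_trans (lerD (le_trans (normcD _ _) (lerD a1 a2)) a3) _.
by rewrite le_eqVlt; apply/orP; left; apply/eqP; rewrite /M; ring.
Qed.

Definition cexp z : C := (expR (Re z))%:C * (cos (Im z) +i* sin (Im z)).

Lemma cReM z s : Re (z * s) = Re z * Re s - Im z * Im s.
Proof. by case: z s => [a b] [c d]. Qed.
Lemma cImM z s : Im (z * s) = Re z * Im s + Im z * Re s.
Proof. by case: z s => [a b] [c d]. Qed.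
Lemma cReD z s : Re (z + s) = Re z + Re s. Proof. by case: z s => [a b] [c d]. Qed.
Lemma cImD z s : Im (z + s) = Im z + Im s. Proof. by case: z s => [a b] [c d]. Qed.
Lemma cReN z : Re (- z) = - Re z. Proof. by case: z. Qed.
Lemma cImN z : Im (- z) = - Im z. Proof. by case: z. Qed.
Lemma complexP z s : Re z = Re s -> Im z = Im s -> z = s.
Proof. by case: z s => [a b] [c d] /= -> ->. Qed.

Lemma cexpD z s : cexp (z + s) = cexp z * cexp s.
Proof.
apply: complexP; rewrite /cexp !(cReM, cImM, cReD, cImD) /= expRD ?cosD ?sinD; ring.
Qed.

Lemma normc_cexp z : normc (cexp z) = expR (Re z).
Proof.
rewrite /cexp Normc.normcM normcR ger0_norm ?expR_ge0//.
by rewrite normc_sqrtE /= cos2Dsin2 sqrtr1 mulr1.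
Qed.

Lemma expR_taylor (a : R) : `|a| <= 2^-1 -> `|expR a - 1 - a| <= 2 * a ^+ 2.
Proof.
rewrite ler_norml => /andP[a1 a2].
have h1 := expR_ge1Dx a; have h2 := expR_ge1Dx (- a).
rewrite ger0_norm; last by lra.
have ea : expR a <= (1 - a)^-1.
  by rewrite -[expR a]invrK -expRN lef_pV2 ?posrE ?expR_gt0//; lra.
apply: (@le_trans _ _ ((1 - a)^-1 - 1 - a)); first by lra.
have -> : (1 - a)^-1 - 1 - a = a ^+ 2 / (1 - a) by field; lra.
rewrite mulrC ler_wpM2r ?sqr_ge0// -[leRHS]invrK lef_pV2 ?posrE; lra.
Qed.

Lemma sin_le_abs (y : R) : `|sin y| <= `|y|.
Proof.
wlog y0 : y / 0 <= y.
  move=> H; have [/H//|/ltW y0] := leP 0 y.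
  by have := H (- y); rewrite sinN !normrN oppr_ge0; apply.
have [|z _] := @MVT_segment _ sin cos 0 y y0.
  by apply: continuous_subspaceT; exact: continuous_sin.
rewrite sin0 !subr0 => ->; rewrite normrM ler_piMl//; exact: abs_cos_le1.
Qed.

Lemma cexp_taylor z : normc z <= 2^-1 -> normc (cexp z - 1 - z) <= 10 * normc z ^+ 2.
Proof.
move=> z2; set a := Re z; set b := Im z.
have a2 : `|a| <= 2^-1 by exact: le_trans (Re_le_normc z) z2.
have b2 : `|b| <= 2^-1 by exact: le_trans (Im_le_normc z) z2.
have ea := expR_taylor a2; have cb := cosB1_le b; have sb := sinB_le b.
have sb1 := sin_le_abs b.
have aa : `|a| * `|b| <= normc z ^+ 2.
  by rewrite expr2; apply: ler_pM => //; [exact: Re_le_normc|exact: Im_le_normc].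
have a22 : a ^+ 2 <= normc z ^+ 2 by rewrite normc_sq lerDl sqr_ge0.
have b22 : b ^+ 2 <= normc z ^+ 2 by rewrite normc_sq lerDr sqr_ge0.
have e1 : `|expR a - 1| <= 2 * `|a|.
  rewrite (_ : expR a - 1 = (expR a - 1 - a) + a); last by ring.
  apply: le_trans (ler_normD _ _) _.
  have : 2 * a ^+ 2 <= `|a|.
    rewrite -(real_normK (num_real a)) expr2 mulrA ler_piMl//; lra.
  lra.
apply: le_trans (normc_le _) _.
have -> : Re (cexp z - 1 - z) = expR a * cos b - 1 - a.
  by rewrite /cexp !(cReD, cReN, cReM)/= mul0r subr0.
have -> : Im (cexp z - 1 - z) = expR a * sin b - b.
  by rewrite /cexp !(cImD, cImN, cImM)/= mul0r addr0 subr0.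
have r1 : `|expR a * cos b - 1 - a| <= 4 * normc z ^+ 2.
  rewrite (_ : _ - _ - _ = (expR a - 1 - a) * cos b + (1 + a) * (cos b - 1)); last by ring.
  apply: le_trans (ler_normD _ _) _; rewrite !normrM.
  have h1 : `|expR a - 1 - a| * `|cos b| <= 2 * normc z ^+ 2.
    rewrite -[leRHS]mulr1; apply: ler_pM => //; last exact: abs_cos_le1.
    by apply: le_trans ea _; rewrite ler_pM2l.
  have h2 : `|1 + a| * `|cos b - 1| <= 2 * normc z ^+ 2.
    apply: ler_pM => //; last exact: le_trans cb _.
    by apply: le_trans (ler_normD _ _) _; rewrite normr1; lra.
  lra.
have r2 : `|expR a * sin b - b| <= 3 * normc z ^+ 2.
  rewrite (_ : _ - _ = (expR a - 1) * sin b + (sin b - b)); last by ring.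
  apply: le_trans (ler_normD _ _) _; rewrite !normrM.
  have h1 : `|expR a - 1| * `|sin b| <= 2 * normc z ^+ 2.
    apply: (@le_trans _ _ (2 * `|a| * `|b|)); first by apply: ler_pM.
    by rewrite -mulrA ler_pM2l.
  have h2 : `|b| ^+ 3 <= normc z ^+ 2.
    apply: le_trans b22; rewrite -[leRHS]real_normK ?num_real// exprS.
    by rewrite ler_piMl ?sqr_ge0//; lra.
  lra.
have := sqr_ge0 (normc z); move: r1 r2; lra.
Qed.

Lemma cdiff_cexp (k : R) s : cdiff (fun z => cexp (k%:C * z)) s.
Proof.
exists (k%:C * cexp (k%:C * s)) => e e0.
pose M := 10 * expR (Re (k%:C * s)) * (1 + k ^+ 2).
have k1 : 0 < 1 + k ^+ 2 by rewrite ltr_wpDr ?sqr_ge0.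
have M0 : 0 < M by rewrite !mulr_gt0// expR_gt0.
(* The first radius keeps |k h| <= 1/2, where [cexp_taylor] applies, by |k| <= 1 + k^2; the second
   turns the quadratic remainder M |h|^2 into e |h|. *)
exists (Num.min ((2 * (1 + k ^+ 2))^-1) (e / M)).
  by rewrite lt_min invr_gt0 mulr_gt0// divr_gt0.
move=> z; rewrite lt_min => /andP[z1 z2]; set h := z - s in z1 z2 *.
have -> : cexp (k%:C * z) - cexp (k%:C * s) - h * (k%:C * cexp (k%:C * s)) =
    cexp (k%:C * s) * (cexp (k%:C * h) - 1 - k%:C * h).
  have -> : k%:C * z = k%:C * s + k%:C * h by rewrite /h; ring.
  by rewrite cexpD; ring.
have nk : normc (k%:C * h) <= 2^-1.
  rewrite Normc.normcM normcR; apply: (@le_trans _ _ ((1 + k ^+ 2) * normc h)).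
    by rewrite ler_wpM2r// norm_le_oneDsq.
  by move: z1; rewrite invfM ltr_pdivlMr// mulrC => /ltW.
rewrite Normc.normcM normc_cexp; apply: le_trans (ler_wpM2l (expR_ge0 _) (cexp_taylor nk)) _.
rewrite Normc.normcM normcR exprMn real_normK ?num_real//.
apply: (@le_trans _ _ (M * normc h * normc h)).
  rewrite /M [expR _ * _]mulrCA -!mulrA ler_pM2l// ler_pM2l ?expR_gt0//.
  by rewrite [leLHS]mulrA -!expr2 ler_wpM2r ?sqr_ge0// lerDr.
rewrite ler_wpM2r// mulrC -ler_pdivlMr//; exact: ltW.
Qed.

(** The Cauchy-Riemann equations, with L = a + i b: the increment of G is (a dx - b dy) + i (b dx +
    a dy) to first order. *)
Lemma cdiff_affine G x y : cdiff G (x +i* y) -> exists a b : R,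
  affine_at (fun x y => Im (G (x +i* y))) x y b a /\
  affine_at (fun x y => Re (G (x +i* y))) x y a (- b).
Proof.
move=> [L hL]; exists (Re L), (Im L); split => e e0; have [d d0 hd] := hL e e0;
  (exists (d / 2); first by rewrite divr_gt0) => x' y' xd yd.
- have nz : normc ((x' +i* y') - (x +i* y)) <= `|x' - x| + `|y' - y| by exact: normc_le.
  have nd : normc ((x' +i* y') - (x +i* y)) < d by apply: le_lt_trans nz _; lra.
  apply: le_trans (le_trans (hd _ nd) (ler_wpM2l (ltW e0) nz)).
  apply: le_trans (Im_le_normc _); rewrite !(cImD, cImN, cImM)/=.
  by rewrite le_eqVlt; apply/orP; left; apply/eqP; congr `|_|; ring.
- have nz : normc ((x' +i* y') - (x +i* y)) <= `|x' - x| + `|y' - y| by exact: normc_le.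
  have nd : normc ((x' +i* y') - (x +i* y)) < d by apply: le_lt_trans nz _; lra.
  apply: le_trans (le_trans (hd _ nd) (ler_wpM2l (ltW e0) nz)).
  apply: le_trans (Re_le_normc _); rewrite !(cReD, cReN, cReM)/=.
  by rewrite le_eqVlt; apply/orP; left; apply/eqP; congr `|_|; ring.
Qed.

Definition entire G := forall s, cdiff G s.

(** This is the form Im (G ds); on a vertical line it restricts to Re G dy, the integrand of the
    inversion integrals. The shared coefficient is Re of the derivative of G. *)
Lemma entire_closed_form G : entire G ->
  closed_form (fun x y => Im (G (x +i* y))) (fun x y => Re (G (x +i* y))).
Proof.
move=> hG x y; have [a [b [h1 h2]]] := cdiff_affine (hG (x +i* y)).
by exists b, a, (- b).
Qed.

End ComplexDifferentiable.

(** * Inversion integrals of entire functions and the shift of their lines *)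

Section VerticalLines.
Local Open Scope complex_scope.
Variable R : realType.
Local Notation C := R[i].
Local Notation Re := (@complex.Re R).
Local Notation Im := (@complex.Im R).
Local Notation normc := (@Normc.normc R).
Implicit Types (G F : C -> C) (s z : C) (f : R -> C).
Hint Resolve normc_ge0 oneDsq_ge1 oneDsq_gt0 : core.

Lemma box_bounded (p : R -> R -> R) :
  (forall x y, exists a b : R, affine_at p x y a b) ->
  forall B T : R, exists M : R, forall x y : R, `|x| <= B -> `|y| <= T -> `|p x y| <= M.
Proof.
move=> hp B T; pose g (z : R * R) : R := p z.1 z.2.
have cg : continuous g.
  move=> [x y]; have [a [b hab]] := hp x y; have [d d0 hd] := hab _ ltr01.
  apply/cvgrPdist_le => /= e e0.
  pose d' := Num.min d (e / (2 * (1 + `|a| + `|b|))).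
  have ab0 : 0 < 1 + `|a| + `|b| by rewrite -addrA ltr_wpDr// addr_ge0.
  have d'0 : 0 < d' by rewrite lt_min d0 divr_gt0// mulr_gt0.
  exists (ball x d', ball y d'); first by split; exact: nbhsx_ballx.
  move=> [x' y'] [/=]; rewrite /ball/= !lt_min (distrC x) (distrC y).
  move=> /andP[x1 x2] /andP[y1 y2]; rewrite distrC /g/=.
  have := hd x' y'; rewrite x1 y1 => /(_ isT isT) h.
  rewrite (_ : p x' y' - p x y = (p x' y' - p x y - a * (x' - x) - b * (y' - y))
    + (a * (x' - x) + b * (y' - y))); last by ring.
  apply: le_trans (ler_normD _ _) _; apply: le_trans (lerD h (ler_normD _ _)) _.
  rewrite !normrM mul1r.
  set X := `|x' - x| in x2 *; set Y := `|y' - y| in y2 *.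
  move: x2 y2; rewrite !ltr_pdivlMr ?mulr_gt0// => x2 y2.
  have X0 : 0 <= X := normr_ge0 _. have Y0 : 0 <= Y := normr_ge0 _.
  have bX : 0 <= `|b| * X by rewrite mulr_ge0. have aY : 0 <= `|a| * Y by rewrite mulr_ge0.
  lra.
have K : compact (g @` (`[(- B), B] `*` `[(- T), T])).
  apply: continuous_compact; first exact: continuous_subspaceT.
  by apply: compact_setX; exact: segment_compact.
have [M [_ hM]] := compact_bounded K.
exists (M + 1) => x y xB yT; apply: (hM (M + 1)); first by rewrite ltrDl.
by exists (x, y) => //=; rewrite !in_itv/= -!ler_norml.
Qed.

Definition rline G (c t : R) : R := Re (G (c +i* t)).
Definition iline G (c t : R) : R := Im (G (c +i* t)).

Lemma entire_affine G : entire G ->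
  (forall x y : R, exists a b : R, affine_at (rline G) x y a b) /\
  (forall x y : R, exists a b : R, affine_at (iline G) x y a b).
Proof.
move=> hG; split => x y; have [a [b [h1 h2]]] := cdiff_affine (hG (x +i* y)).
  by exists a, (- b).
by exists b, a.
Qed.

(** Rapid decay controls G only beyond some radius, with |s| in place of y; compactness supplies the
    bounded part of the strip. *)
Lemma strip_bound G (B : R) n : entire G -> rapid_decay G ->
  exists2 K : R, 0 <= K & forall x y : R, `|x| <= B ->
    normc (G (x +i* y)) <= K / (1 + y ^+ 2) ^+ n.
Proof.
move=> eG rG; have [K [T [T0 hK]]] := rG B (2 * n)%N.
have [h1 h2] := entire_affine eG.
(* The radius is at least 1 so that 1 + y^2 <= 2 |s|^2 beyond it. This explains the exponent 2 n
   above and the factor 2^n in the constant. *)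
pose T1 := Num.max T 1.
have T11 : 1 <= T1 by rewrite le_max lexx orbT.
have T1T : T <= T1 by rewrite le_max lexx.
have [M1 hM1] := box_bounded h1 B T1; have [M2 hM2] := box_bounded h2 B T1.
have pT : 0 <= (1 + T1 ^+ 2) ^+ n by apply: exprn_ge0; exact/ltW/oneDsq_gt0.
exists (`|K| * 2 ^+ n + (`|M1| + `|M2|) * (1 + T1 ^+ 2) ^+ n).
  by apply: addr_ge0; apply: mulr_ge0.
move=> x y xB; rewrite mulrDl.
set s := x +i* y.
have yn0 : 0 < (1 + y ^+ 2) ^+ n by apply: exprn_gt0; exact: oneDsq_gt0.
have [Ts|Ts] := leP T1 (normc s).
  apply: ler_wpDr; first by rewrite mulr_ge0 ?mulr_ge0 ?addr_ge0 ?invr_ge0 ?(ltW yn0).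
  apply: le_trans (hK s _ (le_trans T1T Ts)) _.
    by rewrite -ler_norml.
  apply: le_trans (ler_wpM2r _ (ler_norm K)) _.
    by rewrite invr_ge0; apply: exprn_ge0; exact: normc_ge0.
  rewrite -mulrA ler_wpM2l// ler_pdivlMr//.
  have ns : 0 < normc s by apply: lt_le_trans Ts; exact: lt_le_trans T11.
  rewrite mulrC ler_pdivrMr ?exprn_gt0// exprM -exprMn.
  apply: lerXn2r; rewrite ?nnegrE; first exact/ltW/oneDsq_gt0.
    by apply: mulr_ge0 => //; exact: sqr_ge0.
  rewrite mulr_natl mulr2n lerD//.
    by rewrite -[leLHS](expr1n _ 2) lerXn2r ?nnegrE ?normc_ge0//; apply: le_trans Ts.
  by rewrite normc_sq lerDr sqr_ge0.
have yT : `|y| <= T1 by apply: le_trans (Im_le_normc s) (ltW Ts).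
apply: ler_wpDl; first by apply: mulr_ge0; [exact: mulr_ge0|rewrite invr_ge0 ltW].
apply: le_trans (normc_le _) _; rewrite ler_pdivlMr//.
apply: ler_pM; [by []|exact: ltW| |].
  apply: lerD; first exact: le_trans (hM1 _ _ xB yT) (ler_norm _).
  exact: le_trans (hM2 _ _ xB yT) (ler_norm _).
apply: lerXn2r; rewrite ?nnegrE; [exact/ltW/oneDsq_gt0|exact/ltW/oneDsq_gt0|].
rewrite lerD2l -(real_normK (num_real y)).
by apply: lerXn2r; rewrite ?nnegrE//; exact: le_trans T11.
Qed.

Lemma line_continuous G c : (forall t : R, cdiff G (c +i* t)) ->
  continuous (rline G c) /\ continuous (iline G c).
Proof.
move=> hG; split => t; have [a [b [h1 h2]]] := cdiff_affine (hG t).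
  by have [] := affine_at_cont h2.
by have [] := affine_at_cont h1.
Qed.

Lemma entire_decays G n c : entire G -> rapid_decay G ->
  decays n (rline G c) /\ decays n (iline G c).
Proof.
move=> eG rG; have [K K0 hK] := strip_bound `|c| n eG rG.
have [c1 c2] := line_continuous (c := c) (fun t => eG (c +i* t)).
split; split => //; exists K => t.
  exact: le_trans (Re_le_normc _) (hK _ _ (lexx _)).
exact: le_trans (Im_le_normc _) (hK _ _ (lexx _)).
Qed.

(** The real part of the integral of G(s) exp(-s u) dt over s = c + i t. The factor 1 / (2 pi) is
    left out and reappears as [2 * pi] in the inversion formulas. *)
Definition LM G c u := lineM c (rline G c) (iline G c) u.

Lemma entireM G1 G2 : entire G1 -> entire G2 -> entire (fun s => G1 s * G2 s).
Proof. by move=> h1 h2 s; exact: cdiffM. Qed.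

Lemma Re_mul_cexp z s :
  Re (z * cexp s) = expR (Re s) * (Re z * cos (Im s) - Im z * sin (Im s)).
Proof. by rewrite /cexp !(cReM, cImM)/=; ring. Qed.

(** The function G(s) exp(-u s) is entire, and its exponential factor is bounded on the strip
    between the lines, so the decay of G suffices for [strip_shift]. *)
Lemma LM_shift G c1 c2 u : entire G -> rapid_decay G -> LM G c1 u = LM G c2 u.
Proof.
move=> eG rG; wlog c12 : c1 c2 / c1 <= c2.
  by move=> H; have [/H//|/ltW/H] := leP c1 c2.
pose E s := G s * cexp ((- u)%:C * s).
have eE : entire E by apply: entireM => // s; exact: cdiff_cexp.
have [K K0 hK] := strip_bound (`|c1| + `|c2|) 2 eG rG.
have nE x y : c1 <= x <= c2 -> normc (E (x +i* y)) <=
    K * expR (`|u| * (`|c1| + `|c2|)) / (1 + y ^+ 2) ^+ 2.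
  move=> /andP[x1 x2].
  have xB : `|x| <= `|c1| + `|c2|.
    rewrite ler_norml; apply/andP; split.
      by have := lerNnormlW (lexx `|c1|); have := normr_ge0 c2; lra.
    by have := ler_norm c2; have := normr_ge0 c1; lra.
  rewrite Normc.normcM mulrAC; apply: ler_pM => //; first exact: hK.
  rewrite normc_cexp cReM/= mul0r subr0 ler_expR.
  apply: le_trans (ler_norm _) _; rewrite normrM normrN.
  by rewrite ler_wpM2l.
have EL c : intR (fun t => Re (E (c +i* t))) = LM G c u.
  have [/decays_integrable i1 /decays_integrable i2] := entire_decays 1 c eG rG.
  rewrite /LM /lineM /trig -intRZ; last exact: trig_integrable.
  apply: eq_intR => t; rewrite /E Re_mul_cexp cReM cImM/= /rline /iline.
  rewrite !mul0r subr0 addr0 (_ : - u * c = - (c * u)); last by ring.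
  by rewrite (_ : - u * t = - (t * u)) ?cosN ?sinN; [ring|ring].
rewrite -!EL.
have [//||_ _ ->//] := strip_shift (entire_closed_form eE) c12 (K := K * expR (`|u| * (`|c1| + `|c2|))).
- by move=> x y xi; exact: le_trans (Im_le_normc _) (nE _ _ xi).
- by move=> x y xi; exact: le_trans (Re_le_normc _) (nE _ _ xi).
Qed.

Lemma rapidM G : rapid_decay G -> rapid_decay (fun s => s * G s).
Proof.
move=> rG B N; have [K [T [T0 hK]]] := rG B N.+1.
exists K, T; split => // s sB Ts; have ns : 0 < normc s by exact: lt_le_trans Ts.
rewrite Normc.normcM; apply: le_trans (ler_wpM2l _ (hK s sB Ts)) _ => //.
by rewrite exprS invfM mulrCA mulVKf// lt0r_neq0.
Qed.

Lemma rapidZ G k : rapid_decay G -> rapid_decay (fun s => k * G s).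
Proof.
move=> rG B N; have [K [T [T0 hK]]] := rG B N.
exists (normc k * K), T; split => // s sB Ts.
by rewrite Normc.normcM -mulrA ler_wpM2l// hK.
Qed.

(** The rate c is unrelated to the line b of integration: moving the integral to Re s = c produces
    any exponential rate, of either sign. *)
Lemma LM_bound G c : entire G -> rapid_decay G ->
  exists2 K : R, 0 <= K & forall b u : R, `|LM G b u| <= K * expR (- (c * u)).
Proof.
move=> eG rG; have [d1 d2] := entire_decays 1 c eG rG.
have i1 := decays_integrable d1; have i2 := decays_integrable d2.
exists (intR (fun t => `|rline G c t| + `|iline G c t|)).
  by apply: Rintegral_ge0 => t _; rewrite addr_ge0.
move=> b u; rewrite (LM_shift b c)// /LM /lineM normrM ger0_norm ?expR_ge0// mulrC.
by rewrite ler_wpM2r ?expR_ge0// trig_bound.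
Qed.

Lemma LM_abs_bound G b : entire G -> rapid_decay G ->
  exists2 K : R, 0 <= K & forall c u : R, `|LM G c u| <= K * expR (- (b * `|u|)).
Proof.
move=> eG rG; have [K1 K10 h1] := LM_bound b eG rG; have [K2 K20 h2] := LM_bound (- b) eG rG.
exists (K1 + K2); first exact: addr_ge0.
move=> c u; apply: expR_abs_le; first exact: addr_ge0.
  by apply: le_trans (h1 c u) _; rewrite ler_wpM2r ?expR_ge0// lerDl.
apply: le_trans (h2 c u) _; rewrite mulNr opprK ler_wpM2r ?expR_ge0//.
by rewrite lerDr.
Qed.

Lemma line_mulE G c : (fun t => c * rline G c t - t * iline G c t) = rline (fun s => s * G s) c
  /\ (fun t => c * iline G c t + t * rline G c t) = iline (fun s => s * G s) c.
Proof. by split; apply/funext => t; rewrite /rline /iline ?cReM ?cImM. Qed.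

Lemma LM_derive G (c u : R) : decays 2 (rline G c) -> decays 2 (iline G c) ->
  is_derive (u : R) 1 (LM G c) (- LM (fun s => s * G s) c u).
Proof.
move=> d1 d2; have := lineM_derive c u d1 d2.
by have [-> ->] := line_mulE G c.
Qed.

Lemma LM_continuous G c : entire G -> rapid_decay G -> continuous (LM G c).
Proof.
move=> eG rG u; have [d1 d2] := entire_decays 2 c eG rG.
exact: is_derive_continuous (LM_derive u d1 d2).
Qed.

Lemma eq_LM G1 G2 c : (forall t : R, G1 (c +i* t) = G2 (c +i* t)) -> LM G1 c = LM G2 c.
Proof.
move=> h; apply/funext => u; rewrite /LM (_ : rline G1 c = rline G2 c); last first.
  by apply/funext => t; rewrite /rline h.
by rewrite (_ : iline G1 c = iline G2 c)//; apply/funext => t; rewrite /iline h.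
Qed.

Lemma LM_integrable G : entire G -> rapid_decay G ->
  [/\ integrableR (LM G 0), integrableR (fun u => u * LM G 0 u) &
      integrableR (fun u => u * (u * LM G 0 u))].
Proof.
(* Each factor u halves the rate: 4, then 2, then 1. *)
move=> eG rG; have [K K0 hK] := LM_abs_bound (2 + 2) eG rG.
have cL := continuous_measurable (@LM_continuous G 0 eG rG).
have mid : measurable_fun setT (fun u : R => u) by [].
have hK1 := exp_abs_leM (ltr0Sn R 1) (hK 0).
have E2 : (2 : R) = 1 + 1 by ring.
have hK2 := exp_abs_leM ltr01 (fun u => eq_ind _ (fun x => _ <= _ * expR (- (x * _))) (hK1 u) _ E2).
split.
- exact: exp_abs_le_integrable (hK 0).
- by apply: exp_abs_le_integrable hK1 => //; exact: measurable_funM.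
- by apply: exp_abs_le_integrable hK2 => //; do 2 apply: measurable_funM => //.
Qed.

Lemma rline_cont_at G c x0 : continuous (rline G c) ->
  forall eta : R, 0 < eta -> exists2 d : R, 0 < d &
     forall u, `|u - x0| < d -> `|rline G c u - rline G c x0| <= eta.
Proof.
move=> cG eta eta0; have /cvgrPdist_le/(_ _ eta0)[d /= d0 hd] := cG x0.
by exists d => // u ud; rewrite distrC; apply: hd => /=; rewrite distrC.
Qed.

(** Multiplication by -i makes the imaginary part of an integral the real part of another one; this
    is how [LM], which only records real parts, gives access to both. *)
Lemma rot_iline G c t : iline (fun s => (0 -i* 1) * G s) c t = - rline G c t.
Proof. by rewrite /iline /rline cImM/=; ring. Qed.
Lemma rot_rline G c t : rline (fun s => (0 -i* 1) * G s) c t = iline G c t.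
Proof. by rewrite /iline /rline cReM/=; ring. Qed.

(* Fourier inversion on the line Re s = 0, at the point i x0. *)
Lemma LM_inversion G (x0 : R) : entire G -> rapid_decay G ->
  intR (fun u => cos (u * x0) * LM G 0 u -
                 sin (u * x0) * LM (fun s => (0 -i* 1) * G s) 0 u) = 2 * pi * rline G 0 x0.
Proof.
move=> eG rG; pose G' s := (0 -i* 1) * G s.
have eG' : entire G' by apply: entireM => // s; exact: cdiff_cst.
have rG' : rapid_decay G' by exact: rapidZ.
have [d1 d2] := entire_decays 1 0 eG rG.
have i1 := decays_integrable d1; have i2 := decays_integrable d2.
have iA (k : R -> R) : measurable_fun setT k ->
    integrableR (fun u => k u * LM G 0 u) -> integrableR (fun u => k u * LM G' 0 u) ->
    integrableR (fun u => k u * (cos (u * x0) * LM G 0 u - sin (u * x0) * LM G' 0 u)).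
  move=> mk j1 j2.
  have k1 : integrableR (fun u => k u * LM G 0 u * cos (u * x0)).
    apply: integrableRM => //; first exact: continuous_measurable (@cont_cosl R x0).
    by exists 1 => t; exact: abs_cos_le1.
  have k2 : integrableR (fun u => k u * LM G' 0 u * sin (u * x0)).
    apply: integrableRM => //; first exact: continuous_measurable (@cont_sinl R x0).
    by exists 1 => t; exact: abs_sin_le1.
  have := integrableRD k1 (integrableRZ (-1) k2); congr integrableR.
  by apply/funext => u; ring.
have [j1 j2 _] := LM_integrable eG rG; have [j1' j2' _] := LM_integrable eG' rG'.
have := @fourier_inversion R (rline G 0) (iline G 0)
  (fun u => cos (u * x0) * LM G 0 u - sin (u * x0) * LM G' 0 u) 1 x0 i1 i2.
rewrite -/G'; apply.
- by apply: rline_cont_at; case: d1.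
- move=> u; rewrite /LM /lineM mul0r oppr0 expR0 !mul1r /trig.
  have t1 := trig_integrable u i1 i2.
  have t2 : integrableR (fun t => rline G' 0 t * cos (t * u) + iline G' 0 t * sin (t * u)).
    have [/decays_integrable ? /decays_integrable ?] := entire_decays 1 0 eG' rG'.
    exact: trig_integrable.
  rewrite -!intRZ// -intRB; [|exact: integrableRZ|exact: integrableRZ].
  apply: eq_intR => t; rewrite rot_iline rot_rline mul1r.
  rewrite (_ : u * (t - x0) = t * u - u * x0); last by ring.
  by rewrite cosB sinB; ring.
- have e1 (g : R -> R) : (fun u => 1 * g u) = g by apply/funext => u; rewrite mul1r.
  have := iA (fun=> 1) (measurable_cst _).
  rewrite (e1 (LM G 0)) (e1 (LM G' 0)).
  by rewrite (e1 (fun u => cos (u * x0) * LM G 0 u - sin (u * x0) * LM G' 0 u)); apply.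
- by apply: iA.
Qed.

Lemma LM_int0 G : entire G -> rapid_decay G -> intR (LM G 0) = 2 * pi * Re (G 0).
Proof.
move=> eG rG; rewrite -(LM_inversion 0 eG rG); apply: eq_intR => u.
by rewrite mulr0 cos0 sin0; ring.
Qed.

(** The first moment is a derivative at 0 of the Fourier transform. It is obtained from
    [LM_inversion] at a small point i x0, minus its value at 0: replacing cos(u x0) by 1 and sin(u
    x0) by u x0 costs x0^2 times second moments, while Re (G (i x0)) is Re (G 0) - x0 Im L up to e
    x0. *)
Lemma LM_int1 G L : entire G -> rapid_decay G ->
  (forall e : R, 0 < e -> exists2 d : R, 0 < d & forall z, normc (z - 0) < d ->
    normc (G z - G 0 - (z - 0) * L) <= e * normc (z - 0)) ->
  intR (fun u => u * LM (fun s => (0 -i* 1) * G s) 0 u) = 2 * pi * Im L.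
Proof.
move=> eG rG hL; pose G' s := (0 -i* 1) * G s.
have eG' : entire G' by apply: entireM => // s; exact: cdiff_cst.
have rG' : rapid_decay G' by exact: rapidZ.
have [j1 j2 j3] := LM_integrable eG rG; have [j1' j2' j3'] := LM_integrable eG' rG'.
rewrite -/G'; apply/eqP; rewrite -subr_eq0; apply/eqP.
pose W := intR (fun u => `|u * (u * LM G 0 u)| + `|u * (u * LM G' 0 u)|).
have W0 : 0 <= W by apply: Rintegral_ge0 => u _; rewrite addr_ge0.
apply: (@le_all_eq0 _ _ (2 * pi + W)); first by rewrite addr_ge0// mulr_ge0// pi_ge0.
move=> e e0; have [d d0 hd] := hL e e0.
pose x0 := Num.min (d / 2) (Num.min e 1).
have x00 : 0 < x0 by rewrite !lt_min e0 divr_gt0//=.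
have x0d : x0 < d by rewrite gt_min ltr_pdivrMr// ltr_pMr// ltr1n.
have x0e : x0 <= e by rewrite !ge_min lexx orbT.
have x01 : x0 <= 1 by rewrite !ge_min lexx !orbT.
clearbody x0.
rewrite -(ler_pM2l x00).
have I1 := LM_inversion x0 eG rG; rewrite -/G' in I1.
have I0 := LM_int0 eG rG.
have nz : normc (0 +i* x0) = x0 by rewrite normc_sqrtE/= expr0n/= add0r sqrtr_sqr gtr0_norm.
have B1 : `|rline G 0 x0 - Re (G 0) + x0 * Im L| <= e * x0.
  have := hd (0 +i* x0); rewrite subr0 nz => /(_ x0d).
  apply: le_trans; apply: le_trans (Re_le_normc _); rewrite !(cReD, cReN, cReM)/=.
  by rewrite /rline le_eqVlt; apply/orP; left; apply/eqP; congr `|_|; ring.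
have ic : integrableR (fun u => cos (u * x0) * LM G 0 u).
  under eq_fun do rewrite mulrC.
  apply: integrableRM => //; first exact: continuous_measurable (@cont_cosl R x0).
  by exists 1 => t; exact: abs_cos_le1.
have is' : integrableR (fun u => sin (u * x0) * LM G' 0 u).
  under eq_fun do rewrite mulrC.
  apply: integrableRM => //; first exact: continuous_measurable (@cont_sinl R x0).
  by exists 1 => t; exact: abs_sin_le1.
have ics : integrableR (fun u => cos (u * x0) * LM G 0 u - sin (u * x0) * LM G' 0 u).
  have := integrableRD ic (integrableRZ (-1) is'); congr integrableR.
  by apply/funext => u; ring.
have B2 : `|intR (fun u => (cos (u * x0) * LM G 0 u - sin (u * x0) * LM G' 0 u - LM G 0 u)
      + x0 * (u * LM G' 0 u))| <= x0 ^+ 2 * W.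
  rewrite /W -intRZ; last by apply: integrableRD; exact: integrableR_norm.
  apply: norm_intR_le.
  - apply: integrableRD; last exact: integrableRZ.
    have := integrableRD ics (integrableRZ (-1) j1); congr integrableR.
    by apply/funext => u; ring.
  - by apply: integrableRZ; apply: integrableRD; exact: integrableR_norm.
  move=> u; move: (LM G 0 u) (LM G' 0 u) => la lb.
  rewrite (_ : _ + _ = (cos (u * x0) - 1) * la - (sin (u * x0) - u * x0) * lb); last by ring.
  apply: le_trans (ler_normB _ _) _; rewrite !(mulrA u) -!expr2 !normrM mulrDr; apply: lerD.
    rewrite mulrA ler_wpM2r//; apply: le_trans (cosB1_le _) _.
    by rewrite -expr2 real_normK ?num_real// exprMn mulrC.
  rewrite mulrA ler_wpM2r//.
  rewrite (_ : x0 ^+ 2 * _ = (u * x0) ^+ 2); last by rewrite -expr2 real_normK ?num_real//; ring.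
  exact: sinB_le_sqr.
have B3 : intR (fun u => (cos (u * x0) * LM G 0 u - sin (u * x0) * LM G' 0 u - LM G 0 u)
      + x0 * (u * LM G' 0 u)) = 2 * pi * rline G 0 x0 - 2 * pi * Re (G 0)
      + x0 * intR (fun u => u * LM G' 0 u).
  rewrite intRD; [|have := integrableRD ics (integrableRZ (-1) j1); congr integrableR;
    by apply/funext => u; ring|exact: integrableRZ].
  by rewrite intRB// intRZ// I1 I0.
rewrite B3 in B2.
have -> : x0 * `|intR (fun u => u * LM G' 0 u) - 2 * pi * Im L| =
  `|x0 * intR (fun u => u * LM G' 0 u) - 2 * pi * (x0 * Im L)|.
  by rewrite -[X in X * `|_|](gtr0_norm x00) -normrM; congr `|_|; ring.
rewrite (_ : x0 * intR _ - _ = (2 * pi * rline G 0 x0 - 2 * pi * Re (G 0)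
      + x0 * intR (fun u => u * LM G' 0 u)) - 2 * pi * (rline G 0 x0 - Re (G 0) + x0 * Im L)); last by ring.
apply: le_trans (ler_normB _ _) _.
have p0 : 0 <= 2 * pi :> R by rewrite mulr_ge0// pi_ge0.
rewrite (normrM (2 * pi)) (ger0_norm p0).
apply: le_trans (lerD B2 (ler_wpM2l p0 B1)) _.
rewrite (_ : x0 * (e * _) = e * x0 * W + 2 * pi * (e * x0)); last by ring.
by rewrite lerD2r ler_wpM2r// expr2 ler_wpM2r// ltW.
Qed.

End VerticalLines.

(** * Mellin inversion *)

Section MellinInversion.
Local Open Scope complex_scope.
Variable R : realType.
Local Notation C := R[i].
Local Notation Re := (@complex.Re R).
Local Notation Im := (@complex.Im R).
Local Notation normc := (@Normc.normc R).
Local Notation mu := (@lebesgue_measure R).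
Implicit Types (G F : C -> C) (s z : C) (f : R -> C).
Hint Resolve normc_ge0 : core.

Lemma Im_mul_cexp z s :
  Im (z * cexp s) = expR (Re s) * (Re z * sin (Im s) + Im z * cos (Im s)).
Proof. by rewrite /cexp !(cReM, cImM)/=; ring. Qed.

(** The substitution x = exp v is made between the segments [exp(-n), exp n] and [-n, n], and
    monotone convergence lets n grow. *)
Lemma exp_subst_ge0 (G : R -> R) : (forall x : R, 0 < x -> {for x, continuous G}) ->
  (forall x : R, 0 < x -> 0 <= G x) ->
  (\int[mu]_(x in `]0%R, +oo[) (G x)%:E = \int[mu]_v (G (expR v) * expR v)%:E)%E.
Proof.
move=> cG G0.
pose An (n : nat) := `[expR (- n%:R : R), expR n%:R]%classic.
pose Bn (n : nat) := `[(- n%:R : R), n%:R]%classic.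
have nN (n : nat) : - n%:R <= n%:R :> R by apply: (@le_trans _ _ 0); rewrite ?oppr_le0.
have UA : \bigcup_n An n = `]0%R, +oo[%classic.
  apply/seteqP; split => x /=.
    by move=> [n _]; rewrite /An/= !in_itv/= andbT => /andP[h _]; exact: lt_le_trans (expR_gt0 _) h.
  rewrite in_itv/= andbT => x0; exists (Num.truncn `|ln x|).+1 => //.
  have h : `|ln x| <= (Num.truncn `|ln x|).+1%:R by rewrite ltW// truncnS_gt.
  move: h; rewrite ler_norml /An/= in_itv/= => /andP[h1 h2].
  by rewrite -[X in _ <= X <= _](lnK x0) !ler_expR h1.
have UB : \bigcup_n Bn n = setT.
  apply/seteqP; split => x //= _; exists (Num.truncn `|x|).+1 => //.
  by rewrite /Bn/= in_itv/= -ler_norml ltW// truncnS_gt.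
have cGe : continuous (fun v => G (expR v) * expR v).
  move=> v; apply: cvgM; last exact: continuous_expR.
  apply: (@continuous_comp _ _ _ expR G); first exact: continuous_expR.
  by apply: cG; exact: expR_gt0.
have cwA n : {within An n, continuous G}.
  apply: continuous_in_subspaceT => x; rewrite inE /An/= in_itv/= => /andP[h _].
  by apply: cG; exact: lt_le_trans (expR_gt0 _) h.
have dE : derive1 (@expR R) = @expR R by apply/funext => x; rewrite derive1E derive_val.
have eqn n : (\int[mu]_(x in An n) (G x)%:E = \int[mu]_(v in Bn n) (G (expR v) * expR v)%:E)%E.
  rewrite /An /Bn (@integration_by_substitution_increasing _ expR)//.
  - apply: eq_integral => v _; congr EFin.
    by rewrite dE.
  - by move=> x y _ _ xy; rewrite ltr_expR.
  - by rewrite dE; move=> x _; exact: continuous_expR.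
  - rewrite dE; apply/cvg_ex; exists (expR (- n%:R)).
    by apply: cvg_at_right_filter; exact: continuous_expR.
  - rewrite dE; apply/cvg_ex; exists (expR n%:R).
    by apply: cvg_at_left_filter; exact: continuous_expR.
  - split; first by move=> x _; exact: derivable_expR.
      by apply: cvg_at_right_filter; exact: continuous_expR.
    by apply: cvg_at_left_filter; exact: continuous_expR.
  - exact: (cwA n).
have c1 : (\int[mu]_(x in An n) (G x)%:E @[n --> \oo] --> \int[mu]_(x in `]0%R, +oo[) (G x)%:E)%E.
  rewrite -UA; apply: ge0_nondecreasing_set_cvg_integral.
  - apply/nondecreasing_seqP => n; rewrite subsetEset => x; rewrite /An/= !in_itv/=.
    move=> /andP[h1 h2]; apply/andP; split.
      by apply: le_trans h1; rewrite ler_expR lerN2 ler_nat.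
    by apply: le_trans h2 _; rewrite ler_expR ler_nat.
  - by move=> n; exact: measurable_itv.
  - move=> n; apply/measurable_EFinP; apply: subspace_continuous_measurable_fun => //.
    exact: measurable_itv.
  - move=> n x; rewrite /An/= in_itv/= lee_fin => /andP[h _].
    by apply: G0; exact: lt_le_trans (expR_gt0 _) h.
have c2 : (\int[mu]_(v in Bn n) (G (expR v) * expR v)%:E @[n --> \oo] -->
    \int[mu]_v (G (expR v) * expR v)%:E)%E.
  rewrite -UB; apply: ge0_nondecreasing_set_cvg_integral.
  - apply/nondecreasing_seqP => n; rewrite subsetEset => x; rewrite /Bn/= !in_itv/=.
    move=> /andP[h1 h2]; apply/andP; split.
      by apply: le_trans h1; rewrite lerN2 ler_nat.
    by apply: le_trans h2 _; rewrite ler_nat.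
  - by move=> n; exact: measurable_itv.
  - by move=> n; apply/measurable_EFinP; apply: measurable_funTS; exact: continuous_measurable.
  - move=> n x _; rewrite lee_fin mulr_ge0 ?expR_ge0// G0//; exact: expR_gt0.
move: c1; under eq_fun do rewrite eqn.
by move=> c1; apply: cvg_unique c1 c2.
Qed.

(** The signed case follows by writing G as the difference of the nonnegative functions |G| + G and
    |G|. *)
Lemma exp_subst (G : R -> R) : (forall x : R, 0 < x -> {for x, continuous G}) ->
  mu.-integrable `]0, +oo[ (EFin \o G) ->
  integrableR (fun v => G (expR v) * expR v) /\
  intR (fun v => G (expR v) * expR v) = Rintegral mu `]0, +oo[ G.
Proof.
move=> cG iG.
have cN (x : R) : 0 < x -> {for x, continuous (fun x => `|G x|)}.
  by move=> x0; apply: cvg_norm; exact: cG.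
have iN : mu.-integrable `]0, +oo[ (EFin \o (fun x => `|G x|)).
  by have := integrable_abse iG; apply: eq_integrable.
have E1 := exp_subst_ge0 cN (fun x _ => normr_ge0 _).
have cS (x : R) : 0 < x -> {for x, continuous (fun x => `|G x| + G x)}.
  by move=> x0; apply: cvgD; [exact: cN|exact: cG].
have S0 (x : R) : 0 < x -> 0 <= `|G x| + G x.
  by move=> _; rewrite -lerBlDr sub0r -normrN ler_norm.
have E2 := exp_subst_ge0 cS S0.
have iS : mu.-integrable `]0, +oo[ (EFin \o (fun x => `|G x| + G x)).
  have h : mu.-integrable `]0, +oo[ (fun x => (`|G x|%R)%:E + (G x)%:E)%E.
    by apply: integrableD.
  by apply: eq_integrable h.
have mGe : measurable_fun setT (fun v => G (expR v) * expR v).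
  apply: continuous_measurable => v; apply: cvgM; last exact: continuous_expR.
  apply: (@continuous_comp _ _ _ expR G); first exact: continuous_expR.
  by apply: cG; exact: expR_gt0.
have iGe : integrableR (fun v => G (expR v) * expR v).
  apply/integrableP; split; first exact/measurable_EFinP.
  under eq_integral do rewrite /= normrM (ger0_norm (expR_ge0 _)).
  rewrite -E1.
  have : (\int[mu]_(x in `]0%R, +oo[) (`|G x|)%:E \is a fin_num)%E.
    by apply: integrable_fin_num iN.
  rewrite ge0_fin_numE//.
  by apply: integral_ge0 => x _; rewrite lee_fin.
split => //.
have iNe : integrableR (fun v => `|G (expR v)| * expR v).
  have := integrableR_norm iGe; congr integrableR; apply/funext => v.
  by rewrite normrM (ger0_norm (expR_ge0 _)).
have V1 : intR (fun v => `|G (expR v)| * expR v) = Rintegral mu `]0, +oo[ (fun x => `|G x|).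
  by rewrite /intR /Rintegral E1.
have V2 : intR (fun v => (`|G (expR v)| + G (expR v)) * expR v) =
    Rintegral mu `]0, +oo[ (fun x => `|G x| + G x).
  by rewrite /intR /Rintegral E2.
have := V2; rewrite RintegralD//.
rewrite -V1 (_ : (fun v => (_ + _) * _) = (fun v => `|G (expR v)| * expR v + G (expR v) * expR v)).
  by rewrite intRD// => /addrI.
by apply/funext => v; rewrite mulrDl.
Qed.

(** U + i V is the transform of g1 + i g2, and U cos(t x0) + V sin(t x0) is the integral of g1 cos(t
    (v - x0)) - g2 sin(t (v - x0)), the shape of [fourier_inversion] with k = -1. *)
Lemma fourier_inversion_line (U V g1 g2 : R -> R) (x0 : R) :
  integrableR g1 -> integrableR g2 -> {for x0, continuous g1} ->
  decays 2 U -> decays 2 V ->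
  (forall t, U t = intR (fun v => g1 v * cos (t * v) - g2 v * sin (t * v))) ->
  (forall t, V t = intR (fun v => g1 v * sin (t * v) + g2 v * cos (t * v))) ->
  trig U V x0 = 2 * pi * g1 x0.
Proof.
move=> i1 i2 cg dU dV hU hV.
have cs (g : R -> R) (t : R) : integrableR g -> integrableR (fun v => g v * cos (t * v)).
  move=> ig; apply: integrableRM => //.
    by under eq_fun do rewrite mulrC; exact: continuous_measurable (@cont_cosl R t).
  by exists 1 => v; exact: abs_cos_le1.
have sn (g : R -> R) (t : R) : integrableR g -> integrableR (fun v => g v * sin (t * v)).
  move=> ig; apply: integrableRM => //.
    by under eq_fun do rewrite mulrC; exact: continuous_measurable (@cont_sinl R t).
  by exists 1 => v; exact: abs_sin_le1.
have dA : decays 2 (fun t => U t * cos (t * x0) + V t * sin (t * x0)).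
  have dm (W k : R -> R) : decays 2 W -> continuous k -> (forall t, `|k t| <= 1) -> decays 2 (fun t => W t * k t).
    move=> [cW [K hK]] ck k1; split; first by move=> t; apply: cvgM; [exact: cW|exact: ck].
    by exists K => t; apply: le_trans (hK t); rewrite normrM ler_piMr.
  apply: decaysD; apply: dm => //.
  - exact: cont_cosl.
  - by move=> t; exact: abs_cos_le1.
  - exact: cont_sinl.
  - by move=> t; exact: abs_sin_le1.
rewrite /trig; apply: (@fourier_inversion R g1 g2 _ (-1) x0) => //.
- move=> eta eta0; have /cvgrPdist_le/(_ _ eta0)[d /= d0 hd] := cg.
  by exists d => // u ud; rewrite distrC; apply: hd => /=; rewrite distrC.
- move=> t; rewrite hU hV [_ * cos _]mulrC [_ * sin (t * x0)]mulrC.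
  have j1 : integrableR (fun v => g1 v * cos (t * v) - g2 v * sin (t * v)).
    have := integrableRD (cs _ t i1) (integrableRZ (-1) (sn _ t i2)).
    by congr integrableR; apply/funext => v; ring.
  have j2 : integrableR (fun v => g1 v * sin (t * v) + g2 v * cos (t * v)).
    by apply: integrableRD; [exact: sn|exact: cs].
  rewrite -!intRZ// -intRD; [|exact: integrableRZ|exact: integrableRZ].
  apply: eq_intR => v; rewrite (_ : t * (v - x0) = t * v - t * x0); last by ring.
  by rewrite cosB sinB; ring.
- exact: decays_integrable dA.
- exact: decays_integrable (decaysM dA).
Qed.

Lemma cpow_cexp (x : R) s : 0 < x -> cpow x s = cexp ((ln x)%:C * s).
Proof.
move=> x0; rewrite /cpow /cexp cReM cImM/= !mul0r subr0 addr0.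
rewrite /powR gt_eqF// [ln x * Im s]mulrC; congr (_ %:C * _).
by rewrite mulrC.
Qed.

Lemma smooth_pos_continuous f (x : R) : smooth_pos f -> 0 < x ->
  {for x, continuous (fun y => Re (f y))} /\ {for x, continuous (fun y => Im (f y))}.
Proof.
move=> sf x0; have [d1 d2] := sf 0%N x x0.
by split; apply/differentiable_continuous/derivable1_diffP.
Qed.

(** Under x = exp v the Mellin transform at s is the Fourier transform of exp(Re s v) f(exp v) at
    frequency Im s. Convergence at the real point Re s, where the oscillating factors are 1 and 0,
    gives the integrability of each component separately. *)
Lemma mellin_line f s : smooth_pos f ->
  cintegrable `]0, +oo[ (mellin_integrand f s) ->
  cintegrable `]0, +oo[ (mellin_integrand f (Re s)%:C) ->
  let g1 v := expR (Re s * v) * Re (f (expR v)) in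
  let g2 v := expR (Re s * v) * Im (f (expR v)) in
  [/\ integrableR g1, integrableR g2,
    Re (mellin f s) = intR (fun v => g1 v * cos (Im s * v) - g2 v * sin (Im s * v)) &
    Im (mellin f s) = intR (fun v => g1 v * sin (Im s * v) + g2 v * cos (Im s * v))].
Proof.
move=> sf is1 is0 g1 g2.
have cexpc (k : R) : continuous (fun x : R => expR (k * x)).
  move=> x; apply: (@continuous_comp _ _ _ (fun x : R => k * x) expR); first exact: mulrl_continuous.
  exact: continuous_expR.
have Rm z (x : R) : 0 < x -> Re (mellin_integrand f z x) = expR (Re z * ln x) / x *
    (Re (f x) * cos (Im z * ln x) - Im (f x) * sin (Im z * ln x)).
  move=> x0; rewrite /mellin_integrand cpow_cexp// -fmorphV/= cReM/= mulr0 subr0.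
  by rewrite Re_mul_cexp cReM cImM/= !mul0r subr0 addr0 ![ln x * _]mulrC; ring.
have Imm z (x : R) : 0 < x -> Im (mellin_integrand f z x) = expR (Re z * ln x) / x *
    (Re (f x) * sin (Im z * ln x) + Im (f x) * cos (Im z * ln x)).
  move=> x0; rewrite /mellin_integrand cpow_cexp// -fmorphV/= cImM/= mulr0 add0r.
  by rewrite Im_mul_cexp cReM cImM/= !mul0r subr0 addr0 ![ln x * _]mulrC; ring.
have clnk (k x : R) : 0 < x -> {for x, continuous (fun y => k * ln y)}.
  by move=> x0; apply: cvgM; [exact: cvg_cst|exact: continuous_ln].
have cEx (k x : R) : 0 < x -> {for x, continuous (fun y => expR (k * ln y) / y)}.
  move=> x0; apply: cvgM; last by apply: cvgV; [rewrite gt_eqF|exact: cvg_id].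
  by apply: (@continuous_comp _ _ _ (fun y => k * ln y) expR); [exact: clnk|exact: continuous_expR].
have ccos (k x : R) : 0 < x -> {for x, continuous (fun y => cos (k * ln y))}.
  by move=> x0; apply: (@continuous_comp _ _ _ (fun y => k * ln y) cos); [exact: clnk|exact: continuous_cos].
have csin (k x : R) : 0 < x -> {for x, continuous (fun y => sin (k * ln y))}.
  by move=> x0; apply: (@continuous_comp _ _ _ (fun y => k * ln y) sin); [exact: clnk|exact: continuous_sin].
pose Gr z x := expR (Re z * ln x) / x *
    (Re (f x) * cos (Im z * ln x) - Im (f x) * sin (Im z * ln x)).
pose Gi z x := expR (Re z * ln x) / x *
    (Re (f x) * sin (Im z * ln x) + Im (f x) * cos (Im z * ln x)).
have cr z (x : R) : 0 < x -> {for x, continuous (Gr z)}.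
  move=> x0; have [f1 f2] := smooth_pos_continuous sf x0; apply: cvgM; first exact: cEx.
  by apply: cvgB; apply: cvgM => //; [exact: ccos|exact: csin].
have ci z (x : R) : 0 < x -> {for x, continuous (Gi z)}.
  move=> x0; have [f1 f2] := smooth_pos_continuous sf x0; apply: cvgM; first exact: cEx.
  by apply: cvgD; apply: cvgM => //; [exact: csin|exact: ccos].
have key z : cintegrable `]0, +oo[ (mellin_integrand f z) ->
  [/\ integrableR (fun v => Gr z (expR v) * expR v), integrableR (fun v => Gi z (expR v) * expR v),
    intR (fun v => Gr z (expR v) * expR v) = Re (mellin f z) &
    intR (fun v => Gi z (expR v) * expR v) = Im (mellin f z)].
  move=> [h1 h2].
  have [||a1 a2] := @exp_subst (Gr z); first exact: cr.
    apply: eq_integrable h1 => // x; rewrite inE/= in_itv/= andbT => x0.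
    by rewrite /= Rm.
  have [||b1 b2] := @exp_subst (Gi z); first exact: ci.
    apply: eq_integrable h2 => // x; rewrite inE/= in_itv/= andbT => x0.
    by rewrite /= Imm.
  split => //; rewrite ?a2 ?b2 /mellin /cintegral/=; apply: eq_Rintegral => x;
    by rewrite inE/= in_itv/= andbT => x0; rewrite ?Rm ?Imm.
have [k1 k2 _ _] := key _ is0; have [_ _ k3 k4] := key _ is1.
have EE v : expR (Re s * v) / expR v * expR v = expR (Re s * v).
  by rewrite divfK// gt_eqF// expR_gt0.
split.
- move: k1; congr integrableR; apply/funext => v; rewrite /Gr/= expRK mul0r cos0 sin0.
  by rewrite /g1 -[in RHS]EE; ring.
- move: k2; congr integrableR; apply/funext => v; rewrite /Gi/= expRK mul0r cos0 sin0.
  by rewrite /g2 -[in RHS]EE; ring.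
- rewrite -k3; apply: eq_intR => v; by rewrite /Gr expRK /g1 /g2 -[in RHS]EE; ring.
- rewrite -k4; apply: eq_intR => v; by rewrite /Gi expRK /g1 /g2 -[in RHS]EE; ring.
Qed.

Lemma mellin_inversion f F (sigma c x0 : R) : smooth_pos f ->
  (forall s : C, sigma < Re s ->
    cintegrable `]0, +oo[ (mellin_integrand f s) /\ F s = mellin f s) ->
  sigma < c -> decays 2 (rline F c) -> decays 2 (iline F c) ->
  LM F c x0 = 2 * pi * Re (f (expR x0)) /\
  LM (fun s => (0 -i* 1) * F s) c x0 = 2 * pi * Im (f (expR x0)).
Proof.
move=> sf hF sc dr di.
have cs t : sigma < Re (c +i* t) by [].
have [is0 _] := hF c%:C sc.
have ce : {for x0, continuous (fun v => expR (c * v))}.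
  by apply: (@continuous_comp _ _ _ (fun x : R => c * x) expR);
    [exact: mulrl_continuous|exact: continuous_expR].
have [f1 f2] := smooth_pos_continuous sf (expR_gt0 x0).
have cf1 : {for x0, continuous (fun v => Re (f (expR v)))}.
  by apply: (@continuous_comp _ _ _ expR (fun y => Re (f y))); [exact: continuous_expR|].
have cf2 : {for x0, continuous (fun v => Im (f (expR v)))}.
  by apply: (@continuous_comp _ _ _ expR (fun y => Im (f y))); [exact: continuous_expR|].
have ml t := mellin_line sf (hF (c +i* t) (cs t)).1 is0.
have [i1 i2 _ _] := ml 0; rewrite /= in i1 i2.
have ee : expR (- (c * x0)) * expR (c * x0) = 1 by rewrite -expRD addrC subrr expR0.
split; rewrite /LM /lineM.
  rewrite (fourier_inversion_line i1 i2 _ dr di).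
  - by rewrite mulrCA [expR _ * (_ * _)]mulrA ee mul1r.
  - exact: cvgM.
  - by move=> t; rewrite /rline (hF _ (cs t)).2; have [_ _ -> _] := ml t.
  - by move=> t; rewrite /iline (hF _ (cs t)).2; have [_ _ _ ->] := ml t.
have i1' : integrableR (fun v => - (expR (c * v) * Re (f (expR v)))).
  by have := integrableRZ (-1) i1; under eq_fun do rewrite mulN1r.
rewrite (@fourier_inversion_line _ _ (fun v => expR (c * v) * Im (f (expR v)))
  (fun v => - (expR (c * v) * Re (f (expR v)))) x0 i2 i1').
- by rewrite mulrCA [expR _ * (_ * _)]mulrA ee mul1r.
- exact: cvgM.
- by move: di; congr decays; apply/funext => t; rewrite rot_rline.
- by have := decaysN dr; congr decays; apply/funext => t; rewrite rot_iline.
- move=> t; rewrite rot_rline /iline (hF _ (cs t)).2; have [_ _ _ ->/=] := ml t.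
  by apply: eq_intR => v; ring.
- move=> t; rewrite rot_iline /rline (hF _ (cs t)).2; have [_ _ ->/= _] := ml t.
  rewrite -mulN1r -intRZ; first by apply: eq_intR => v; ring.
  have := trig_integrable t i1 (integrableRZ (-1) i2); congr integrableR.
  by apply/funext => v; rewrite ![v * t]mulrC; ring.
Qed.

End MellinInversion.

(** * Decay and moments of x f'(x) *)

Section FlatData.
Local Open Scope complex_scope.
Variable R : realType.
Local Notation C := R[i].
Local Notation Re := (@complex.Re R).
Local Notation Im := (@complex.Im R).
Local Notation normc := (@Normc.normc R).
Implicit Types (G F : C -> C) (s z : C) (f : R -> C).

Lemma cvg_normc (u : nat -> C) (l : C) : ((u : nat -> C^o) @ \oo --> (l : C^o)) ->
  forall e : R, 0 < e -> exists N, forall n, (N <= n)%N -> normc (u n - l) <= e.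
Proof.
move=> /cvgrPdist_lt h e e0; have [N _ hN] := h _ (realC_gt0 e0).
exists N => n Nn; have := hN n Nn; rewrite /= normr_normc ltcR => /ltW.
by rewrite -normcN opprB.
Qed.

Lemma normcX z n : normc (z ^+ n) = normc z ^+ n.
Proof.
elim: n => [|n ih]; first by rewrite !expr0 Normc.normc1.
by rewrite !exprS Normc.normcM ih.
Qed.

(** Convergence at the single point r / 2 bounds the coefficients geometrically, and on the disc of
    radius r / 4 the series is dominated by one of ratio 1/2. *)
Lemma laurent_bound F am1 a0 : laurent0 F am1 a0 -> exists K rho : R,
  [/\ 0 < rho, 0 <= K & forall s, 0 < normc s < rho ->
    normc (s * F s - am1 - s * a0) <= K * normc s ^+ 2].
Proof.
move=> [c [r [r0 c0 h]]].
pose s1 : C := (r / 2)%:C.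
have r20 : 0 < r / 2 by rewrite divr_gt0.
have ns1 : normc s1 = r / 2 by rewrite normcR gtr0_norm.
have hs1 : 0 < normc s1 < r.
  by rewrite ns1 r20/= ltr_pdivrMr// ltr_pMr// ltr1n.
have [N hN] := cvg_normc (h s1 hs1) ltr01.
(* From index N on the partial sums are within 1 of the limit, so each later term, a difference of
   two of them, is at most 2; the finitely many earlier terms are added. *)
pose M := 2 + \sum_(k < N) normc (c k * s1 ^+ k).
have M0 : 0 <= M by rewrite addr_ge0// sumr_ge0// => k _; exact: normc_ge0.
have hc k : normc (c k) * (r / 2) ^+ k <= M.
  rewrite -ns1 -normcX -Normc.normcM.
  have [kN|Nk] := ltnP k N.
    rewrite /M (bigD1 (Ordinal kN))//= addrCA lerDl addr_ge0//.
    by rewrite sumr_ge0// => i _; exact: normc_ge0.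
  apply: (@le_trans _ _ 2); last by rewrite lerDl sumr_ge0// => i _; exact: normc_ge0.
  have e : c k * s1 ^+ k = (am1 / s1 + \sum_(i < k.+1) c i * s1 ^+ i - F s1)
     - (am1 / s1 + \sum_(i < k) c i * s1 ^+ i - F s1).
    by rewrite big_ord_recr/=; ring.
  rewrite e; apply: le_trans (normcB _ _) _.
  apply: le_trans (lerD (hN _ _) (hN _ Nk)) _; first exact: leqW.
  by [].
exists (2 * M / (r / 2)), (r / 2 / 2); split.
- by rewrite divr_gt0.
- by rewrite divr_ge0 ?mulr_ge0// ltW.
move=> s /andP[s0 sr].
have sn0 : s != 0 by rewrite -normc_gt0.
pose x := normc s / (r / 2).
have x0 : 0 <= x by rewrite divr_ge0 ?normc_ge0// ltW.
have x2 : x <= 2^-1 by rewrite ler_pdivrMr// mulrC ltW.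
have sr' : 0 < normc s < r.
  by rewrite s0/= (lt_le_trans sr)// ler_pdivrMr// ler_pdivrMr// -mulrA ler_peMr// ?(ltW r0)//; lra.
have hk k : normc (c k * s ^+ k) <= M * x ^+ k.
  rewrite Normc.normcM normcX /x expr_div_n [M * _]mulrA mulrAC ler_wpM2r//.
    by apply: exprn_ge0; exact: normc_ge0.
  by rewrite ler_pdivlMr ?exprn_gt0.
(* The closed form is the geometric sum for x <= 1/2, with one factor x kept outside. *)
have part n : normc (\sum_(k < n.+1) c k * s ^+ k - a0) <= M * x * (2 - 2 * 2^-1 ^+ n).
  elim: n => [|n ih].
    by rewrite big_ord_recr big_ord0/= add0r expr0 mulr1 c0 subrr Normc.normc0 expr0 mulr1 subrr mulr0.
  rewrite big_ord_recr/= addrAC; apply: le_trans (normcD _ _) _.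
  apply: le_trans (lerD ih (hk _)) _.
  have : x ^+ n.+1 <= x * 2^-1 ^+ n.
    by rewrite exprS ler_wpM2l// lerXn2r ?nnegrE// invr_ge0.
  move=> /(ler_wpM2l M0) hx; rewrite [2^-1 ^+ n.+1]exprS.
  move: hx; set y := 2^-1 ^+ n; set z := x ^+ n.+1 => hx.
  have -> : M * x * (2 - 2 * (2^-1 * y)) = M * x * (2 - 2 * y) + M * (x * y) by field.
  by rewrite lerD2l.
have lim : normc (F s - am1 / s - a0) <= 2 * M * x.
  apply/ler_addgt0Pr => e e0; have [N' hN'] := cvg_normc (h s sr') e0.
  rewrite (_ : F s - _ - _ = (\sum_(k < N'.+1) c k * s ^+ k - a0)
     - (am1 / s + \sum_(k < N'.+1) c k * s ^+ k - F s)); last by ring.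
  apply: le_trans (normcB _ _) _; apply: lerD; last exact: hN'.
  apply: le_trans (part _) _; rewrite (_ : 2 * M * x = M * x * 2) ?ler_wpM2l//; last by ring.
    exact: mulr_ge0.
  by rewrite gerBl mulr_ge0// exprn_ge0// invr_ge0.
have -> : s * F s - am1 - s * a0 = s * (F s - am1 / s - a0) by field.
rewrite Normc.normcM; apply: le_trans (ler_wpM2l (normc_ge0 _) lim) _.
by rewrite /x le_eqVlt; apply/orP; left; apply/eqP; ring.
Qed.

Definition resF F (am1 : C) s : C := if s == 0 then am1 else s * F s.

Section ResF.
Variables (F : C -> C) (am1 a0 : C).
Hypothesis (F_hol : holomorphic_off0 F) (F_laurent : laurent0 F am1 a0)
  (F_decay : rapid_decay F).

Lemma F_cdiff s : s != 0 -> cdiff F s.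
Proof. by move=> s0; apply: derivable_cdiff; exact: F_hol. Qed.

Lemma resF_deriv0 (e : R) : 0 < e -> exists2 d : R, 0 < d & forall z, normc (z - 0) < d ->
  normc (resF F am1 z - resF F am1 0 - (z - 0) * a0) <= e * normc (z - 0).
Proof.
move=> e0; have [K [rho [rho0 K0 hK]]] := laurent_bound F_laurent.
exists (Num.min rho (e / (K + 1))); first by rewrite lt_min rho0 divr_gt0// ltr_wpDl.
move=> z; rewrite subr0 lt_min => /andP[z1 z2]; rewrite /resF eqxx.
have [->|z0] := eqVneq z 0; first by rewrite subrr mul0r subrr Normc.normc0 mulr0.
have nz : 0 < normc z by rewrite normc_gt0.
apply: le_trans (hK z _) _; first by rewrite nz.
rewrite expr2 mulrA ler_wpM2r ?(ltW nz)//.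
move: z2; rewrite ltr_pdivlMr ?ltr_wpDl// => /ltW; apply: le_trans.
by rewrite mulrC ler_wpM2l ?(ltW nz)// lerDl.
Qed.

Lemma resF_entire : entire (resF F am1).
Proof.
move=> s; have [->|s0] := eqVneq s 0.
  by exists a0 => e e0; exact: resF_deriv0.
have ns : 0 < normc s by rewrite normc_gt0.
apply: (@cdiff_near R (fun s => s * F s) _ s _ ns); last first.
  by apply: cdiffM; [exact: cdiff_id|exact: F_cdiff].
move=> z zs; rewrite /resF; case: eqP => // z0; move: zs.
by rewrite z0 sub0r normcN ltxx.
Qed.

Lemma resF_rapid : rapid_decay (resF F am1).
Proof.
move=> B N; have [K [T [T0 hK]]] := rapidM F_decay B N.
exists K, T; split => // s sB Ts; rewrite /resF; case: eqP => [s0|_]; last exact: hK.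
by move: Ts; rewrite s0 Normc.normc0 leNgt T0.
Qed.

(** On Re s = c one has |s| >= |c|, so dividing s F(s) by s costs only 1 / |c|. *)
Lemma F_line_decays n c : c != 0 -> decays n (rline F c) /\ decays n (iline F c).
Proof.
move=> c0; have cn t : c +i* t != 0 :> C by rewrite eq_complex/= negb_and c0.
have [c1 c2] := line_continuous (fun t => F_cdiff (cn t)).
have [K K0 hK] := strip_bound `|c| n resF_entire resF_rapid.
have cc : 0 < `|c| by rewrite normr_gt0.
have nF t : normc (F (c +i* t)) <= (K / `|c|) / (1 + t ^+ 2) ^+ n.
  have := hK c t (lexx _); rewrite /resF (negPf (cn t)) Normc.normcM => h.
  rewrite mulrAC ler_pdivlMr//; apply: le_trans h; rewrite mulrC ler_wpM2r ?normc_ge0//.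
  exact: (Re_le_normc (c +i* t)).
by split; split => //; exists (K / `|c|) => t; apply: le_trans (nF t);
  [exact: Re_le_normc|exact: Im_le_normc].
Qed.

End ResF.

(** Both E - D and E + D are nondecreasing. *)
Lemma mvt_compare (D E D' E' : R -> R) (a b : R) : a <= b ->
  (forall x : R, a <= x <= b -> is_derive x 1 D (D' x)) ->
  (forall x : R, a <= x <= b -> is_derive x 1 E (E' x)) ->
  (forall x : R, a <= x <= b -> `|D' x| <= E' x) ->
  `|D b - D a| <= E b - E a.
Proof.
move=> ab hD hE hle.
have mono (H dH : R -> R) : (forall x : R, a <= x <= b -> is_derive x 1 H (dH x)) ->
    (forall x : R, a <= x <= b -> 0 <= dH x) -> H a <= H b.
  move=> hH H0.
  have [||x xab] := @MVT_segment R H dH a b ab.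
  - by move=> x /[!in_itv]/= /andP[/ltW h1 /ltW h2]; apply: hH; rewrite h1.
  - apply: derivable_within_continuous => x /[!in_itv]/= xab.
    by case: (hH x xab).
  move=> e; rewrite -subr_ge0 e mulr_ge0 ?subr_ge0//; apply: H0.
  by move: xab; rewrite in_itv.
have h1 := mono _ _ (fun x xab => dB (hE x xab) (hD x xab)).
have h2 := mono _ _ (fun x xab => dD (hE x xab) (hD x xab)).
have {}h1 : E a - D a <= E b - D b.
  by apply: h1 => x xab; rewrite subr_ge0; exact: le_trans (ler_norm _) (hle x xab).
have {}h2 : E a + D a <= E b + D b.
  apply: h2 => x xab; rewrite -lerBlDr sub0r; apply: le_trans (hle x xab).
  by rewrite -normrN ler_norm.
by rewrite ler_norml; apply/andP; split; lra.
Qed.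

(* Everything needed about a real-valued f, in the variable u = ln x: kap j is
   (- d/du)^(j+1) f(e^u), it decays exponentially at both ends, and its zeroth
   and first moments are the Laurent coefficients. *)
Definition flat_data (f1 : R -> R) (m a : R) (kap : nat -> R -> R) : Prop :=
  [/\ forall u : R, is_derive u 1 (fun u => f1 (expR u)) (- kap 0%N u),
     forall j (u : R), is_derive u 1 (kap j) (- kap j.+1 u),
     forall j (p : R), exists2 K : R, 0 <= K & forall u, `|kap j u| <= K * expR (p * u),
     forall c : R, 0 < c -> exists2 K : R, 0 <= K &
       forall u, `|f1 (expR u)| <= K * expR (- (c * u)) &
     [/\ integrableR (kap 0%N), integrableR (fun u => u * kap 0%N u),
       intR (kap 0%N) = m & intR (fun u => u * kap 0%N u) = a]].

Lemma expRN_small (c e : R) : 0 < c -> 0 < e -> forall u : R, exists2 w : R, u <= w & expR (- (c * w)) <= e.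
Proof.
move=> c0 e0 u; exists (Num.max u (e^-1 / c)); first by rewrite le_max lexx.
set w := Num.max _ _.
have w1 : e^-1 / c <= w by rewrite le_max lexx orbT.
have w0 : 0 <= w by apply: le_trans w1; rewrite divr_ge0 ?invr_ge0 ?ltW.
apply: le_trans (expRN_le_inv (mulr_ge0 (ltW c0) w0)) _.
rewrite -[leRHS]invrK lef_pV2 ?posrE ?invr_gt0//; last by rewrite ltr_wpDr// mulr_ge0// ltW.
move: w1; rewrite ler_pdivrMr// mulrC => w1; apply: le_trans w1 _.
by rewrite lerDr.
Qed.

Lemma LM_bound_line F c : decays 2 (rline F c) -> decays 2 (iline F c) ->
  exists2 K : R, 0 <= K & forall u, `|LM F c u| <= K * expR (- (c * u)).
Proof.
move=> d1 d2; have i1 := decays_integrable d1; have i2 := decays_integrable d2.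
exists (intR (fun t => `|rline F c t| + `|iline F c t|)).
  by apply: Rintegral_ge0 => t _; rewrite addr_ge0.
move=> u; rewrite /LM /lineM normrM ger0_norm ?expR_ge0// mulrC.
by rewrite ler_wpM2r ?expR_ge0// trig_bound.
Qed.

Lemma exp_lin_derive (k u : R) : is_derive u 1 (fun u => expR (k * u)) (k * expR (k * u)).
Proof.
have dl : is_derive u 1 (fun v => k * v) k by have := dZ k (is_derive_id u 1); rewrite mulr1.
by apply: is_derive_eq (dcomp (is_derive_expR _) dl) _; rewrite mulrC.
Qed.

(** Stated for general [FF] in order to serve for F with Re f and for -i F with Im f. The inversion
    integral of [FF] cannot be moved by [LM_shift], because of the pole; its derivative can, being
    an integral of the entire function G. So all u-derivatives and bounds come from G, and the
    integrals over Re s = c0 and Re s = 2 agree because they have equal derivatives and both vanish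
    at infinity. *)
Lemma flat_core (FF G : C -> C) (L : C) (f1 : R -> R) (c0 : R) :
  entire G -> rapid_decay G -> (forall s, s != 0 -> G s = s * FF s) ->
  (forall e : R, 0 < e -> exists2 d : R, 0 < d & forall z, normc (z - 0) < d ->
    normc (G z - G 0 - (z - 0) * L) <= e * normc (z - 0)) ->
  (forall c : R, c != 0 -> decays 2 (rline FF c) /\ decays 2 (iline FF c)) ->
  0 < c0 -> (forall u, LM FF c0 u = 2 * pi * f1 (expR u)) ->
  (exists kap, flat_data f1 (Re (G 0)) (Re L) kap) /\
  (forall u, LM FF 2 u = 2 * pi * f1 (expR u)).
Proof.
move=> eG rG GF GL dF c00 hf.
have p0 : 0 < 2 * pi :> R by rewrite mulr_gt0// pi_gt0.
have pn0 : 2 * pi != 0 :> R by rewrite lt0r_neq0.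
pose mulS (G : C -> C) s := s * G s.
pose kap j u : R := (2 * pi)^-1 * LM (iter j mulS G) 0 u.
have eI j : entire (iter j mulS G).
  by elim: j => //= j ih; apply: entireM => // s; exact: cdiff_id.
have rI j : rapid_decay (iter j mulS G) by elim: j => //= j ih; exact: rapidM.
have dFF (c u : R) : c != 0 -> is_derive u 1 (fun u => (2 * pi)^-1 * LM FF c u) (- kap 0%N u).
  move=> cn0; have [d1 d2] := dF c cn0.
  apply: is_derive_eq (dZ _ (LM_derive u d1 d2)) _.
  rewrite /kap/= mulrN; congr (- (_ * _)); rewrite (LM_shift 0 c)//.
  congr (_ u); apply: eq_LM => t; rewrite GF// eq_complex/= negb_and cn0//.
have fE : (fun u => f1 (expR u)) = (fun u => (2 * pi)^-1 * LM FF c0 u).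
  by apply/funext => u; rewrite hf mulKf.
have hd1 (u : R) : is_derive u 1 (fun u => f1 (expR u)) (- kap 0%N u).
  by rewrite fE; apply: dFF; rewrite gt_eqF.
have hkap j (p : R) : exists2 K : R, 0 <= K & forall u, `|kap j u| <= K * expR (p * u).
  have [K K0 hK] := LM_bound (- p) (eI j) (rI j).
  exists ((2 * pi)^-1 * K); first by rewrite mulr_ge0// invr_ge0 ltW.
  move=> u; rewrite /kap normrM ger0_norm ?invr_ge0 ?(ltW p0)// -mulrA ler_wpM2l ?invr_ge0 ?(ltW p0)//.
  by have := hK 0 u; rewrite mulNr opprK.
have [K1 K10 hK1] : exists2 K : R, 0 <= K & forall u, `|f1 (expR u)| <= K * expR (- (c0 * u)).
  have [d1 d2] := dF c0 (lt0r_neq0 c00); have [K K0 hK] := LM_bound_line d1 d2.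
  exists ((2 * pi)^-1 * K); first by rewrite mulr_ge0// invr_ge0 ltW.
  move=> u; have -> : f1 (expR u) = (2 * pi)^-1 * LM FF c0 u by rewrite hf mulKf.
  by rewrite normrM ger0_norm ?invr_ge0 ?(ltW p0)// -mulrA ler_wpM2l ?invr_ge0 ?(ltW p0).
split.
  exists kap; split; [exact: hd1| |exact: hkap| |].
  - move=> j u; have [d1 d2] := entire_decays 2 0 (eI j) (rI j).
    by apply: is_derive_eq (dZ _ (LM_derive u d1 d2)) _; rewrite mulrN.
  (* The bound for [kap 0] with rate c is integrated from u to a far point w, where f1 is already
     negligible by its known decay with rate c0. *)
  - move=> c c_gt0; have [K K0 hK] := hkap 0%N (- c).
    exists (K / c); first by rewrite divr_ge0// ltW.
    move=> u; apply/ler_addgt0Pr => e e0.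
    have [w uw hw] := @expRN_small c0 (e / (K1 + 1)) c00 (ltac:(by rewrite divr_gt0// ltr_wpDl)) u.
    have := @mvt_compare (fun u => f1 (expR u)) (fun u => - (K / c) * expR ((- c) * u))
      (fun u => - kap 0%N u) (fun u => K * expR ((- c) * u)) u w uw (fun x _ => hd1 x).
    have dE (x : R) : is_derive x 1 (fun u => - (K / c) * expR ((- c) * u)) (K * expR ((- c) * x)).
      by apply: is_derive_eq (dZ _ (exp_lin_derive _ _)) _; field; rewrite gt_eqF.
    move=> /(_ (fun x _ => dE x)) cmp.
    have {}cmp := cmp (fun x _ => eq_ind_r (fun y => y <= _) (hK x) (normrN _)).
    have fw := hK1 w.
    have fw' : `|f1 (expR w)| <= e.
      apply: le_trans fw _; apply: le_trans (ler_wpM2l K10 hw) _.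
      by rewrite mulrCA ler_piMr ?(ltW e0)// ler_pdivrMr ?ltr_wpDl// mul1r lerDl.
    have : `|f1 (expR u)| <= `|f1 (expR w) - f1 (expR u)| + `|f1 (expR w)|.
      by have := ler_normB (f1 (expR w)) (f1 (expR w) - f1 (expR u)); rewrite subKr [leRHS]addrC.
    have : 0 <= K / c * expR ((- c) * w) by rewrite mulr_ge0 ?expR_ge0// divr_ge0// ltW.
    rewrite -[- (c * u)]mulNr; move: cmp fw'; lra.
  - have [j1 j2 _] := LM_integrable eG rG; split.
    + exact: integrableRZ.
    + by have := integrableRZ (2 * pi)^-1 j2; congr integrableR; apply/funext => u; rewrite /kap/=; ring.
    + by rewrite /kap/= intRZ// LM_int0// mulKf.
    + rewrite (_ : (fun u => _) = (fun u => (2 * pi)^-1 * (u * LM G 0 u))); last first.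
        by apply/funext => u; rewrite /kap/=; ring.
      (* [LM_int1] computes the moment for -i times a function and returns an imaginary part;
         applied to i G it returns Im (i L) = Re L. *)
      rewrite intRZ//; pose iG s := (0 +i* 1) * G s.
      have eiG : entire iG by apply: entireM => // s; exact: cdiff_cst.
      have riG : rapid_decay iG by exact: rapidZ.
      have ii : (0 -i* 1) * (0 +i* 1) = 1 :> C by apply: complexP; rewrite ?cReM ?cImM/=; ring.
      have -> : LM G 0 = LM (fun s => (0 -i* 1) * iG s) 0.
        by apply: eq_LM => t; rewrite /iG mulrA ii mul1r.
      rewrite (@LM_int1 _ iG ((0 +i* 1) * L))//; first by rewrite mulKf// cImM/=; ring.
      move=> e e0; have [d d0 hd] := GL e e0; exists d => // z zd; apply: le_trans (hd z zd).
      rewrite /iG (_ : _ - _ - _ = (0 +i* 1) * (G z - G 0 - (z - 0) * L)); last by ring.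
      by rewrite Normc.normcM normc_sqrtE/= expr0n expr1n/= add0r sqrtr1 mul1r.
have [d1 d2] := dF 2 (ltac:(by rewrite pnatr_eq0)).
have [K2 K20 hK2] := LM_bound_line d1 d2.
pose D u := (2 * pi)^-1 * LM FF 2 u - f1 (expR u).
have dD0 (u : R) : is_derive u 1 D 0.
  have h1 : is_derive u 1 (fun u => (2 * pi)^-1 * LM FF 2 u) (- kap 0%N u).
    by apply: dFF; rewrite pnatr_eq0.
  by apply: is_derive_eq (dB h1 (hd1 u)) _; rewrite subrr.
move=> u; suff D0 : D u = 0.
  by move/subr0_eq: D0 => <-; rewrite mulVKf.
apply: (@le_all_eq0 _ _ 1) => // e e0; rewrite mulr1.
pose m := Num.min c0 2; have m0 : 0 < m by rewrite lt_min c00 ltr0n.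
have hD w : 0 <= w -> `|D w| <= (K2 / (2 * pi) + K1) * expR (- (m * w)).
  move=> w0; rewrite mulrDl; apply: le_trans (ler_normB _ _) _; apply: lerD.
    rewrite normrM ger0_norm ?invr_ge0 ?(ltW p0)// mulrC mulrAC ler_wpM2r ?invr_ge0 ?(ltW p0)//.
    apply: le_trans (hK2 w) _; rewrite ler_wpM2l// ler_expR lerN2 ler_wpM2r//.
    by rewrite ge_min lexx orbT.
  apply: le_trans (hK1 w) _; rewrite ler_wpM2l// ler_expR lerN2 ler_wpM2r//.
  by rewrite ge_min lexx.
pose K3 := K2 / (2 * pi) + K1; have K30 : 0 <= K3 by rewrite addr_ge0// divr_ge0// ltW.
have [w uw hw] := @expRN_small m (e / (K3 + 1)) m0 (ltac:(by rewrite divr_gt0// ltr_wpDl)) (Num.max u 0).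
move: uw; rewrite ge_max => /andP[uw w0].
have cst : `|D w - D u| <= 0 - 0.
  apply: (@mvt_compare D (fun=> 0) (fun=> 0) (fun=> 0)) => // x _; by rewrite normr0.
have -> : D u = D w by apply/esym/eqP; rewrite -subr_eq0 -normr_le0; move: cst; rewrite subrr.
apply: le_trans (hD w w0) _; apply: le_trans (ler_wpM2l K30 hw) _.
by rewrite mulrCA ler_piMr ?(ltW e0)// ler_pdivrMr ?ltr_wpDl// mul1r lerDl.
Qed.

Lemma flat_of_mellin f F am1 a0 : smooth_pos f -> extends_mellin f F ->
  holomorphic_off0 F -> laurent0 F am1 a0 -> rapid_decay F ->
  [/\ exists kap, flat_data (fun x => Re (f x)) (Re am1) (Re a0) kap,
      exists kap, flat_data (fun x => Im (f x)) (Im am1) (Im a0) kap,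
      forall u, LM F 2 u = 2 * pi * Re (f (expR u)) &
      forall u, LM (fun s => (0 -i* 1) * F s) 2 u = 2 * pi * Im (f (expR u))].
Proof.
move=> sf [sigma hF] Fh Fl Fd.
(* To the right both of the abscissa of convergence and of the pole. *)
pose c0 : R := Num.max sigma 0 + 1.
have c00 : 0 < c0 by rewrite ltr_wpDl// le_max lexx orbT.
have c0s : sigma < c0 by rewrite ltr_pwDr// le_max lexx.
have eG := resF_entire Fh Fl; have rG := resF_rapid am1 Fd.
have dF (c : R) : c != 0 -> decays 2 (rline F c) /\ decays 2 (iline F c).
  exact: (F_line_decays Fh Fl Fd).
have [d1 d2] := dF c0 (lt0r_neq0 c00).
have inv x0 := mellin_inversion x0 sf hF c0s d1 d2.
have GF s : s != 0 -> resF F am1 s = s * F s by rewrite /resF => /negPf ->.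
have [h1 h2] := @flat_core F (resF F am1) a0 (fun x => Re (f x)) c0 eG rG GF (resF_deriv0 Fl) dF c00 (fun u => (inv u).1).
pose G' s := (0 -i* 1) * resF F am1 s.
have eG' : entire G' by apply: entireM => // s; exact: cdiff_cst.
have rG' : rapid_decay G' by exact: rapidZ.
have [|||h3 h4] := @flat_core (fun s => (0 -i* 1) * F s) G' ((0 -i* 1) * a0) (fun x => Im (f x)) c0 eG' rG' _ _ _ c00 (fun u => (inv u).2).
- by move=> s s0; rewrite /G' GF//; ring.
- move=> e e0; have [d d0 hd] := resF_deriv0 Fl e0; exists d => // z zd.
  apply: le_trans (hd z zd).
  rewrite /G' (_ : _ - _ - _ = (0 -i* 1) * (resF F am1 z - resF F am1 0 - (z - 0) * a0)); last by ring.
  by rewrite Normc.normcM normc_sqrtE/= expr0n sqrrN expr1n/= add0r sqrtr1 mul1r.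
- move=> c cn0; have [e1 e2] := dF c cn0; split.
    by move: e2; congr decays; apply/funext => t; rewrite rot_rline.
  by have := decaysN e1; congr decays; apply/funext => t; rewrite rot_iline.
split => //.
- by move: h1; rewrite /resF eqxx.
- move: h3; rewrite /G' /resF eqxx !cReM/= !mul0r !sub0r !mulN1r !opprK.
  by [].
Qed.

End FlatData.

(** * Harmonic sums and Euler--Maclaurin summation *)

Section Harmonic.
Variable R : realType.

Definition harm (n : nat) : R := \sum_(k < n) k.+1%:R^-1.

Lemma harmS n : harm n.+1 = harm n + n.+1%:R^-1.
Proof. by rewrite /harm big_ord_recr. Qed.

Lemma ln_lower (x : R) : 0 < x -> 1 - x^-1 <= ln x.
Proof.
move=> x0; have := @le_ln1Dx R (x^-1 - 1).
rewrite (addrC 1) subrK lnV ?posrE// ltrBrDr addNr invr_gt0 => /(_ x0).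
by lra.
Qed.

Lemma ln_upper (x : R) : 0 < x -> ln x <= x - 1.
Proof.
by move=> x0; have := @le_ln1Dx R (x - 1); rewrite (addrC 1) subrK ltrBrDr addNr => /(_ x0).
Qed.

(** The sequence H_N - ln N, with N = n + 1, decreases, while H_N - ln N - 1/N increases; both
    follow from 1/(N+1) <= ln((N+1)/N) <= 1/N. *)
Lemma euler_gammaP n : (0 : R) <= harm n.+1 - ln n.+1%:R - euler_gamma <= n.+1%:R^-1.
Proof.
pose g n : R := harm n.+1 - ln n.+1%:R.
have e1 (x : R) : 0 < x -> 1 - x / (x + 1) = (x + 1)^-1.
  by move=> x0; field; rewrite lt0r_neq0// addr_gt0.
have e2 (x : R) : 0 < x -> (x + 1) / x - 1 = x^-1.
  by move=> x0; field; rewrite lt0r_neq0.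
have lnS k : (k.+2%:R^-1 : R) <= ln (k.+2%:R : R) - ln (k.+1%:R : R) <= (k.+1%:R^-1 : R).
  have k1 : 0 < k.+1%:R :> R by rewrite ltr0n.
  have k2 : 0 < k.+2%:R :> R by rewrite ltr0n.
  have kS : k.+2%:R = k.+1%:R + 1 :> R by rewrite -natr1.
  rewrite -ln_div ?posrE//; apply/andP; split.
    apply: le_trans (ln_lower (divr_gt0 k2 k1)).
    by rewrite invf_div kS e1.
  apply: le_trans (ln_upper (divr_gt0 k2 k1)) _.
  by rewrite kS e2.
have gS k : g k.+1 = g k + k.+2%:R^-1 - (ln k.+2%:R - ln k.+1%:R).
  by rewrite /g harmS; ring.
have gdec : nonincreasing_seq g.
  by apply/nonincreasing_seqP => k; rewrite gS -addrA gerDl subr_le0; case/andP: (lnS k).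
have hinc k j : g k - k.+1%:R^-1 <= g (k + j)%N - (k + j).+1%:R^-1.
  elim: j => [|j ih]; first by rewrite addn0.
  rewrite addnS; apply: le_trans ih _; rewrite gS -subr_ge0.
  rewrite (_ : _ - _ = (k + j).+1%:R^-1 - (ln (k + j).+2%:R - ln (k + j).+1%:R)); last by ring.
  by rewrite subr_ge0; case/andP: (lnS (k + j)%N).
have lb k : forall j, g k - k.+1%:R^-1 <= g j.
  move=> j; apply: (@le_trans _ _ (g (k + j)%N)); last by apply: gdec; exact: leq_addl.
  apply: le_trans (hinc k j) _; rewrite gerBl invr_ge0//.
have gcv : cvgn g.
  apply: nonincreasing_is_cvgn => //; exists (g 0%N - 1%:R^-1) => _ [j _ <-]; exact: lb.
have ge : euler_gamma = limn g by [].
rewrite -/(g n) ge; apply/andP; split.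
  by rewrite subr_ge0; apply: nonincreasing_cvgn_ge.
rewrite lerBlDr -lerBlDl; apply: limr_ge => //; exact: nearW.
Qed.

(** The bound must hold for every real y, since y is later integrated over the line. For y < 0 the
    sum is empty and exp(-y) absorbs |y| and gamma; for y >= 0 the term exp y / M pays for what the
    cutoff at M discards. *)
Lemma harm_trunc : exists2 C : R, 0 <= C & forall (M : nat) (y : R), (0 < M)%N ->
  `|\sum_(j < M) (if (0 < j)%N && (ln j%:R <= y) then (j%:R)^-1 else 0) - y - euler_gamma|
   <= C * (expR (- y) + expR y / M%:R).
Proof.
pose gam : R := euler_gamma.
exists (4 + `|gam|); first by rewrite addr_ge0.
move=> M y M0; have Mp : 0 < M%:R :> R by rewrite ltr0n.
have eM : 0 <= expR y / M%:R by rewrite divr_ge0 ?expR_ge0.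
have C1 : 0 <= 4 + `|gam| by rewrite addr_ge0.
have [y0|y0] := ltP y 0.
  rewrite big1 => [|j _]; last first.
    case: ifP => // /andP[j0]; rewrite leNgt => /negP[].
    by apply: lt_le_trans y0 _; rewrite ln_ge0// ler1n.
  rewrite sub0r; apply: (@le_trans _ _ (`|y| + `|gam|)); first by rewrite -(normrN y) ler_normB.
  apply: (@le_trans _ _ ((4 + `|gam|) * expR (- y))); last by rewrite ler_wpM2l// lerDl.
  have e1 := expR_ge1Dx (- y); rewrite ltr0_norm// mulrDl.
  have : `|gam| * 1 <= `|gam| * expR (- y) by rewrite ler_wpM2l//; lra.
  lra.
pose n := (Num.truncn (expR y)).
have ny : n%:R <= expR y < n.+1%:R by rewrite truncn_itv// expR_ge0.
have n1 : (0 < n)%N.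
  rewrite -ltnS -(ltr_nat R); apply: le_lt_trans (andP ny).2.
  by rewrite -expR0 ler_expR.
have lnj j : (0 < j)%N -> (ln j%:R <= y) = (j <= n)%N.
  move=> j0; rewrite -ler_expR lnK ?posrE ?ltr0n//; apply/idP/idP => h.
    by rewrite -ltnS -(ltr_nat R); apply: le_lt_trans h _; case/andP: ny.
  by apply: le_trans (andP ny).1; rewrite ler_nat.
pose N := minn n M.-1.
have sumE : \sum_(j < M) (if (0 < j)%N && (ln j%:R <= y) then (j%:R)^-1 else 0) = harm N.
  case: M M0 {Mp eM} @N => // M _ N; rewrite big_ord_recl/= add0r.
  transitivity (\sum_(i < M | (i < n)%N) (i.+1%:R)^-1 : R).
    by rewrite [RHS]big_mkcond/=; apply: eq_bigr => i _; rewrite /bump/= add1n lnj.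
  rewrite /harm /N /minn/=; case: ltnP => [nM|Mn].
    by rewrite -(big_ord_widen_cond M predT (fun i => i.+1%:R^-1 : R)) 1?ltnW.
  by apply: eq_bigl => i; rewrite (leq_trans (ltn_ord i)).
rewrite sumE -/gam.
have np : 0 < n%:R :> R by rewrite ltr0n.
have B1 : `|harm n - y - gam| <= 4 * expR (- y).
  have := euler_gammaP n.-1; rewrite (prednK n1) -/gam => /andP[g0 g1].
  have nn : n%:R^-1 <= 2 * expR (- y).
    rewrite expRN -[2 / _]invf_div; rewrite lef_pV2 ?posrE ?divr_gt0 ?expR_gt0//.
    rewrite ler_pdivrMr//; apply: le_trans (ltW (andP ny).2) _.
    by rewrite -natr1 mulr_natr mulr2n lerD2l ler1n.
  have l1 : ln n%:R <= y by rewrite lnj.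
  have l2 : y <= ln n%:R + n%:R^-1.
    have : y < ln n.+1%:R by rewrite -ltr_expR lnK ?posrE ?ltr0n//; case/andP: ny.
    have := ln_upper (divr_gt0 (ltr0Sn R n) np); rewrite ln_div ?posrE ?ltr0n//.
    have -> : n.+1%:R / n%:R - 1 = n%:R^-1 :> R by rewrite -natr1; field; rewrite lt0r_neq0.
    lra.
  rewrite ler_norml; apply/andP; split; lra.
have B2 : `|harm N - harm n| <= expR y / M%:R.
  rewrite /N /minn; case: ltnP => [_|Mn]; first by rewrite subrr normr0.
  have hd k : harm (M.-1 + k) - harm M.-1 <= k%:R / M%:R.
    elim: k => [|k ih]; first by rewrite addn0 subrr mul0r.
    have -> : k.+1%:R / M%:R = k%:R / M%:R + M%:R^-1 :> R by rewrite -natr1 mulrDl mul1r.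
    rewrite addnS harmS addrAC lerD// lef_pV2 ?posrE ?ltr0n// ler_nat.
    by rewrite -(prednK M0) ltnS leq_addr.
  have hm k : harm M.-1 <= harm (M.-1 + k).
    elim: k => [|k ih]; first by rewrite addn0.
    by rewrite addnS harmS; apply: le_trans ih _; rewrite lerDl invr_ge0.
  have := hd (n - M.-1)%N; have := hm (n - M.-1)%N; rewrite subnKC// => h1 h2.
  rewrite distrC ger0_norm ?subr_ge0//; apply: le_trans h2 _.
  rewrite ler_pM2r ?invr_gt0//; apply: le_trans (andP ny).1.
  by rewrite ler_nat leq_subr.
rewrite (_ : _ - _ - _ = (harm N - harm n) + (harm n - y - gam)); last by ring.
apply: le_trans (ler_normD _ _) _; apply: le_trans (lerD B2 B1) _.
rewrite mulrDr addrC; apply: lerD.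
  by rewrite ler_wpM2r ?expR_ge0// lerDl.
by rewrite ler_peMl//; have := normr_ge0 gam; lra.
Qed.

Lemma sum_inv_sq_le (M : nat) : \sum_(j < M) (j.+1%:R ^+ 2)^-1 <= 2 :> R.
Proof.
case: M => [|M]; first by rewrite big_ord0.
have : \sum_(j < M.+1) (j.+1%:R ^+ 2)^-1 <= 2 - M.+1%:R^-1 :> R.
  elim: M => [|M ih]; first by rewrite big_ord_recr big_ord0/= add0r expr1n invr1; lra.
  rewrite big_ord_recr/=; apply: le_trans (lerD ih (lexx _)) _.
  have m1 : 0 < M.+1%:R :> R by rewrite ltr0n.
  have -> : M.+2%:R = M.+1%:R + 1 :> R by rewrite -natr1.
  set x := M.+1%:R in m1 *.
  have x1 : 0 < x + 1 by rewrite addr_gt0.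
  rewrite -subr_ge0 (_ : _ - _ = (x * (x + 1) ^+ 2)^-1).
    by rewrite invr_ge0 mulr_ge0 ?sqr_ge0// ltW.
  by field; rewrite !lt0r_neq0.
by move/le_trans; apply; rewrite gerBl invr_ge0.
Qed.

End Harmonic.

Section EulerMaclaurin.
Variable R : realType.

(* One Euler-Maclaurin step: two applications of the mean value theorem to
   r |-> sum_m phi0 ((m + v + r) delta). *)
Lemma EM_step (phi0 phi1 phi2 : R -> R) (delta v B : R) (M : nat) : 0 < delta ->
  (forall t : R, is_derive t 1 phi0 (phi1 t)) ->
  (forall t : R, is_derive t 1 phi1 (phi2 t)) ->
  (forall r : R, 0 <= r <= 1 -> `|\sum_(k < M) delta * phi2 ((k%:R + (v + r)) * delta)| <= B) ->
  `|\sum_(k < M) delta * phi1 ((k%:R + v) * delta)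
    - (phi0 ((M%:R + v) * delta) - phi0 (v * delta))| <= delta * B.
Proof.
move=> d0 d1 d2 hB.
have dsum (g g' : R -> R) (r : R) : (forall t : R, is_derive t 1 g (g' t)) ->
    is_derive r 1 (fun r => \sum_(k < M) g ((k%:R + (v + r)) * delta))
      (\sum_(k < M) delta * g' ((k%:R + (v + r)) * delta)).
  move=> hg; rewrite (_ : (fun r => _) = \sum_(k < M) (fun r => g ((k%:R + (v + r)) * delta))); last first.
    by apply/funext => x; rewrite fct_sumE.
  apply: is_derive_sum => k.
  have dl : is_derive r 1 (fun r => (k%:R + (v + r)) * delta) delta.
    have := dlin delta (- (k%:R + v)) r; congr (is_derive _ _ _ _).
    by apply/funext => x; ring.
  by apply: is_derive_eq (dcomp (hg _) dl) _; rewrite mulrC.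
pose S r := \sum_(k < M) delta * phi1 ((k%:R + (v + r)) * delta).
have dS (r : R) : is_derive r 1 S (delta * \sum_(k < M) delta * phi2 ((k%:R + (v + r)) * delta)).
  have := dZ delta (dsum _ _ r d2); congr (is_derive _ _ _ _).
  by apply/funext => x; rewrite /S mulr_sumr.
have [|xi xi01] := @MVT_segment R (fun r => \sum_(k < M) phi0 ((k%:R + (v + r)) * delta)) S 0 1 ler01.
  by apply: derivable_within_continuous => x _; case: (dsum _ _ x d1).
rewrite subr0 mulr1 => E.
have {}E : phi0 ((M%:R + v) * delta) - phi0 (v * delta) = S xi.
  rewrite -E -sumrB.
  have := @telescope_sumr R 0 M (fun k => phi0 ((k%:R + v) * delta)) (leq0n _).
  rewrite add0r big_mkord => <-; apply: eq_bigr => k _.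
  by rewrite addr0 -natr1 -!addrA [1 + v]addrC.
rewrite E.
have -> : \sum_(k < M) delta * phi1 ((k%:R + v) * delta) = S 0.
  by apply: eq_bigr => k _; rewrite addr0.
move: xi01; rewrite in_itv/= => /andP[xi0 xi1].
have cmp := @mvt_compare R S (fun x => delta * B * (x - 0))
  (fun r => delta * \sum_(k < M) delta * phi2 ((k%:R + (v + r)) * delta)) (fun=> delta * B) 0 xi xi0
  (fun x _ => dS x) (fun x _ => dlin _ _ _).
rewrite distrC; apply: le_trans (cmp _) _.
  move=> x /andP[x0 xxi]; rewrite normrM gtr0_norm// ler_pM2l//; apply: hB.
  by rewrite x0 (le_trans xxi).
have B0 : 0 <= B by apply: le_trans (hB 0 _); rewrite ?normr_ge0// lexx ler01.
by rewrite subrr mulr0 !subr0 ler_piMr// mulr_ge0// ltW.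
Qed.

Section Chain.
Variable phi : nat -> R -> R.
Hypothesis dphi : forall i (t : R), is_derive t 1 (phi i) (phi i.+1 t).
Hypothesis phi0 : forall i (t : R), t <= 0 -> phi i t = 0.
Hypothesis phi_inv : forall i, exists2 K : R, 0 <= K & forall t : R, 0 < t -> `|phi i.+1 t| <= K / t.
Hypothesis phi_sq : forall i, exists2 K : R, 0 <= K & forall t : R, 0 <= t -> `|phi i.+1 t| <= K / (1 + t) ^+ 2.

Let S i delta M v := \sum_(k < M) delta * phi i ((k%:R + v) * delta).

(** A Riemann sum of K / (1 + t)^2 telescopes against 1 / (1 + t), uniformly in the shift v. The
    factor 2 comes from 1 + t + delta <= 2 (1 + t), which uses delta <= 1. *)
Lemma chain_base i : exists2 C : R, 0 <= C & forall (delta v : R) M,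
  0 < delta <= 1 -> `|S i.+1 delta M v| <= C.
Proof.
have [K K0 hK] := phi_sq i; exists (2 * K); first by rewrite mulr_ge0.
move=> delta v M /andP[d0 d1].
pose Bf (t : R) : R := (1 + Num.max t 0)^-1.
have p1 (t : R) : 0 < 1 + Num.max t 0 by rewrite ltr_wpDr// le_max lexx orbT.
have term t : delta * `|phi i.+1 t| <= 2 * K * (Bf t - Bf (t + delta)).
  have [t0|t0] := leP t 0.
    rewrite phi0// normr0 mulr0 mulr_ge0 ?mulr_ge0// subr_ge0 lef_pV2 ?posrE//.
    by rewrite lerD2l ge_max !le_max lexx orbT andbT (le_trans (lexx t))// lerDl (ltW d0).
  have td : 0 < t + delta by rewrite addr_gt0.
  rewrite /Bf (max_l (ltW t0)) (max_l (ltW td)).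
  apply: le_trans (ler_wpM2l (ltW d0) (hK t (ltW t0))) _.
  have t1 : 0 < 1 + t by rewrite addr_gt0. have t2 : 0 < 1 + (t + delta) by rewrite addr_gt0.
  have -> : (1 + t)^-1 - (1 + (t + delta))^-1 = delta / ((1 + t) * (1 + (t + delta))).
    by field; rewrite !lt0r_neq0.
  rewrite [2 * K]mulrC -!mulrA [delta * (K * _)]mulrCA ler_wpM2l// [2 * _]mulrCA ler_pM2l//.
  rewrite -[2 * _]invf_div lef_pV2 ?posrE ?divr_gt0 ?mulr_gt0 ?exprn_gt0//.
  by rewrite ler_pdivrMr// expr2 -mulrA ler_pM2l//; lra.
apply: le_trans (ler_norm_sum _ _ _) _.
apply: (@le_trans _ _ (\sum_(k < M) 2 * K * (Bf ((k%:R + v) * delta) - Bf ((k.+1%:R + v) * delta)))).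
  apply: ler_sum => k _; rewrite normrM gtr0_norm//; apply: le_trans (term _) _.
  rewrite le_eqVlt; apply/orP; left; apply/eqP; do 3! congr (_ _); congr Bf.
  by rewrite -natr1; ring.
rewrite -mulr_sumr ler_piMr ?mulr_ge0//.
have := @telescope_sumr R 0 M (fun k => - Bf ((k%:R + v) * delta)) (leq0n _).
rewrite big_mkord opprK => E.
rewrite (_ : \sum_(k < M) _ = \sum_(k < M) (- Bf ((k.+1%:R + v) * delta) - - Bf ((k%:R + v) * delta))); last first.
  by apply: eq_bigr => k _; rewrite opprK addrC.
have b1 t : Bf t <= 1 by rewrite invf_le1// lerDl le_max lexx orbT.
have b0 t : 0 <= Bf t by rewrite invr_ge0 ltW.
by rewrite E addrC; have := b1 ((0%:R + v) * delta); have := b0 ((M%:R + v) * delta); lra.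
Qed.

(** Each Euler-Maclaurin step trades one more derivative for a factor delta and may raise the shift
    v by up to 1. Hence v <= - n: through all n steps the left boundary term is taken at a
    nonpositive argument, where it vanishes. T bounds the right end M + v from below and controls
    the other boundary term. *)
Lemma chain_ind n : forall i, exists2 C : R, 0 <= C & forall (delta v T : R) M,
  0 < delta <= 1 -> v <= - n%:R -> 0 < T -> T <= M%:R + v ->
  `|S i.+2 delta M v| <= C * (delta ^+ n + (T * delta)^-1).
Proof.
elim: n => [|n ih] i.
  have [C C0 hC] := chain_base i.+1; exists C => // delta v T M d01 _ T0 _.
  apply: le_trans (hC delta v M d01) _; rewrite expr0 ler_peMr// lerDl invr_ge0.
  by rewrite mulr_ge0// ltW//; case/andP: d01.
have [C C0 hC] := ih i.+1; have [K K0 hK] := phi_inv i.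
exists (K + 2 * C); first by rewrite addr_ge0// mulr_ge0.
move=> delta v T M d01 vn T0 TM; have /andP[d0 d1] := d01.
have Td : 0 < T * delta by rewrite mulr_gt0.
have := @EM_step (phi i.+1) (phi i.+2) (phi i.+3) delta v (C * (delta ^+ n + (T * delta)^-1)) M d0
   (dphi i.+1) (dphi i.+2).
rewrite (phi0 _ (t := v * delta)); last first.
  apply: mulr_le0_ge0; last exact: ltW.
  by apply: le_trans vn _; rewrite oppr_le0.
rewrite subr0 => h.
have {}h : `|S i.+2 delta M v - phi i.+1 ((M%:R + v) * delta)| <= delta * (C * (delta ^+ n + (T * delta)^-1)).
  apply: h => r /andP[r0 r1]; apply: hC => //.
    by move: vn; rewrite -natr1 opprD; lra.
  by apply: le_trans TM _; rewrite lerD2l lerDl.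
have MT : T * delta <= (M%:R + v) * delta by rewrite ler_pM2r.
have hp : `|phi i.+1 ((M%:R + v) * delta)| <= K / (T * delta).
  apply: le_trans (hK _ (lt_le_trans Td MT)) _.
  by rewrite ler_wpM2l// lef_pV2 ?posrE// (lt_le_trans Td).
have -> : S i.+2 delta M v = (S i.+2 delta M v - phi i.+1 ((M%:R + v) * delta)) + phi i.+1 ((M%:R + v) * delta).
  by rewrite subrK.
apply: le_trans (ler_normD _ _) _; apply: le_trans (lerD h hp) _.
set X := (T * delta)^-1; have X0 : 0 <= X by rewrite invr_ge0 ltW.
rewrite exprS; set Y := delta ^+ n; have Y0 : 0 <= Y by rewrite exprn_ge0// ltW.
have a1 : C * (delta * X) <= C * X by rewrite ler_wpM2l// ler_piMl.
have a2 : 0 <= C * (delta * Y) by rewrite !mulr_ge0// ltW.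
have a3 : 0 <= K * (delta * Y) by rewrite !mulr_ge0// ltW.
have a4 : 0 <= C * X by rewrite mulr_ge0.
lra.
Qed.

Lemma chain_sum n : exists2 C : R, 0 <= C & forall (delta : R) M,
  0 < delta <= 1 -> (0 < M)%N ->
  `|\sum_(j < M) delta * phi 1%N (j%:R * delta) - phi 0%N (M%:R * delta)|
    <= C * (delta ^+ n.+1 + (M%:R * delta)^-1).
Proof.
have [C C0 hC] := chain_ind n 0%N; exists C => // delta M d01 M0.
have /andP[d0 d1] := d01; have Mp : 0 < M%:R :> R by rewrite ltr0n.
(* The sum is extended to the left by n + 1 zero terms, one for the step made here and n for
   [chain_ind]. *)
pose N := n.+1; pose v : R := - N%:R.
have Mv : (N + M)%:R + v = M%:R by rewrite /v natrD; ring.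
have := @EM_step (phi 0%N) (phi 1%N) (phi 2%N) delta v (C * (delta ^+ n + (M%:R * delta)^-1)) (N + M)%N d0
   (dphi 0%N) (dphi 1%N).
rewrite (phi0 _ (t := v * delta)); last by apply: mulr_le0_ge0; [rewrite oppr_le0|exact: ltW].
rewrite subr0 Mv => h.
have -> : \sum_(j < M) delta * phi 1%N (j%:R * delta) =
    \sum_(k < N + M) delta * phi 1%N ((k%:R + v) * delta).
  rewrite big_split_ord/= [X in _ = X + _]big1 ?add0r => [|k _].
    by apply: eq_bigr => k _; rewrite natrD /v addrC addKr.
  rewrite phi0 ?mulr0//; apply: mulr_le0_ge0; last exact: ltW.
  by rewrite subr_le0 ler_nat ltnW.
apply: le_trans (h _) _.
  move=> r /andP[r0 r1]; apply: hC => //.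
    by rewrite /v /N -natr1; lra.
  by rewrite addrA Mv lerDl.
rewrite exprS mulrCA ler_wpM2l// mulrDr lerD2l ler_piMl// invr_ge0.
by apply: mulr_ge0 => //; exact: ltW.
Qed.

End Chain.

End EulerMaclaurin.

(** * The sum of f(m^2 / Y) / m to arbitrary order *)

Section MainTerm.
Variable R : realType.
Local Notation mu := (@lebesgue_measure R).

(** The quadratic bound makes the difference quotient at 0 tend to 0, so the extension by zero is
    differentiable there. *)
Lemma glue_derive (g g' : R -> R) (K : R) :
  (forall t : R, 0 < t -> is_derive t 1 g (g' t)) ->
  (forall t : R, 0 < t -> `|g t| <= K * t ^+ 2) ->
  forall t : R, is_derive t 1 (fun t => if 0 < t then g t else 0) (if 0 < t then g' t else 0).
Proof.
move=> dg gK t; have [t0|t0|<-] := ltgtP 0 t.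
- apply: (near_eq_is_derive _ (dg t t0)).
  by near=> x; rewrite ifT//; near: x; exact: lt_nbhsr.
- apply: (near_eq_is_derive _ (dcst 0 t)).
  near=> x; rewrite ifF//; apply/negbTE; rewrite -leNgt ltW//.
  by near: x; exact: lt_nbhsl.
have K0 : 0 <= K by have := le_trans (normr_ge0 _) (gK 1 ltr01); rewrite expr1n mulr1.
have h : h^-1 *: ((if 0 < h *: (1 : R) + 0 then g (h *: 1 + 0) else 0) - (if 0 < (0 : R) then g 0 else 0))
    @[h --> 0^'] --> (0 : R).
  apply/cvgrPdist_le => /= e e0; near=> h.
  rewrite ltxx subr0 addr0 /GRing.scale/= mulr1 sub0r normrN normrM.
  have hn0 : h != 0 by near: h; exact: nbhs_dnbhs_neq.
  have he : `|h| < e / (K + 1).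
    near: h; apply: dnbhs0_lt; by rewrite divr_gt0// ltr_wpDl.
  have hp : 0 < `|h| by rewrite normr_gt0.
  case: ifP => [h0|_]; last by rewrite normr0 mulr0 ltW.
  rewrite normfV ler_pdivrMl//; apply: le_trans (gK h h0) _.
  rewrite -[h ^+ 2]real_normK ?num_real// expr2 mulrA mulrC ler_pM2l//.
  move: he; rewrite ltr_pdivlMr ?ltr_wpDl// => /ltW; apply: le_trans.
  by rewrite mulrC ler_wpM2l ?lerDl// ltW.
apply: DeriveDef; first by apply/cvg_ex; exists 0.
exact: cvg_lim h.
Unshelve. all: by end_near. Qed.

Variables (f1 : R -> R) (m a : R) (kap : nat -> R -> R).
Hypothesis fd : flat_data f1 m a kap.

Let df1 (u : R) : is_derive u 1 (fun u => f1 (expR u)) (- kap 0%N u).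
Proof. by case: fd => h _ _ _ _; exact: h. Qed.
Let dkap j (u : R) : is_derive u 1 (kap j) (- kap j.+1 u).
Proof. by case: fd => _ h _ _ _; exact: h. Qed.
Let kapK j (p : R) : exists2 K : R, 0 <= K & forall u, `|kap j u| <= K * expR (p * u).
Proof. by case: fd => _ _ h _ _; exact: h. Qed.
Let f1K c : 0 < c -> exists2 K : R, 0 <= K & forall u, `|f1 (expR u)| <= K * expR (- (c * u)).
Proof. by case: fd => _ _ _ h _; exact: h. Qed.
Let ikap : integrableR (kap 0%N). Proof. by case: fd => _ _ _ _ []. Qed.
Let iukap : integrableR (fun u => u * kap 0%N u). Proof. by case: fd => _ _ _ _ []. Qed.
Let kap_m : intR (kap 0%N) = m. Proof. by case: fd => _ _ _ _ []. Qed.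
Let kap_a : intR (fun u => u * kap 0%N u) = a. Proof. by case: fd => _ _ _ _ []. Qed.
Let ckap j : continuous (kap j).
Proof. by move=> u; exact: is_derive_continuous (dkap j u). Qed.

Lemma kap_exp_integrable (p : R) : integrableR (fun u => expR (p * u) * `|kap 0%N u|).
Proof.
have [K1 K10 h1] := kapK 0%N (- p + 1); have [K2 K20 h2] := kapK 0%N (- p - 1).
have cE : continuous (fun u => expR (p * u) * `|kap 0%N u|).
  move=> u; apply: cvgM; first exact: is_derive_continuous (exp_lin_derive p u).
  by apply: cvg_norm; exact: ckap.
apply: (@exp_abs_le_integrable R _ (K1 + K2) 1 ltr01); first exact: continuous_measurable.
move=> u; rewrite normrM normr_id ger0_norm ?expR_ge0//.
have [u0|u0] := leP 0 u.
  apply: le_trans (ler_wpM2l (expR_ge0 _) (h2 u)) _.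
  rewrite ger0_norm// mulrCA -expRD (_ : p * u + _ = - (1 * u)); last by ring.
  by rewrite ler_wpM2r ?expR_ge0// lerDr.
apply: le_trans (ler_wpM2l (expR_ge0 _) (h1 u)) _.
rewrite ltr0_norm// mulrCA -expRD (_ : p * u + _ = - (1 * - u)); last by ring.
by rewrite ler_wpM2r ?expR_ge0// lerDl.
Qed.

(** The difference of the two sides does not depend on v, and both tend to 0 at infinity. *)
Lemma f1_tail (v : R) : intR (kap 0%N \_ `[v, +oo[) = f1 (expR v).
Proof.
pose I v := intR (kap 0%N \_ `[v, +oo[).
have iI w : mu.-integrable `[w, +oo[ (EFin \o kap 0%N).
  by apply: integrableS ikap.
have IE w : I w = Rintegral mu `[w, +oo[ (kap 0%N) by rewrite Rintegral_mkcond.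
have iIR w : integrableR (kap 0%N \_ `[w, +oo[).
  apply: (integrableR_le _ ikap) => [|y].
    apply/(measurable_restrictT _ _).1 => //; apply: measurable_funTS.
    exact: integrableR_measurable ikap.
  by rewrite patchE; case: ifP => // _; rewrite normr0.
have step w : v < w -> I v - f1 (expR v) = I w - f1 (expR w).
  move=> vw; have := @Rintegral_itvB R (kap 0%N) (BLeft v) +oo%O w (iI v).
  rewrite !bnd_simp/= => /(_ (ltW vw) isT).
  rewrite Rintegral_itv_obnd_cbnd; last by apply: integrableS ikap.
  rewrite -!IE => <-.
  have F2 : Rintegral mu `[v, w] (kap 0%N) = f1 (expR v) - f1 (expR w).
    pose F u := - f1 (expR u).
    have dF (u : R) : is_derive u 1 F (kap 0%N u).
      by have := dZ (-1) (df1 u); rewrite mulN1r opprK; under eq_fun do rewrite mulN1r.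
    have cF : continuous F by move=> u; exact: is_derive_continuous (dF u).
    rewrite /Rintegral (@continuous_FTC2 _ _ F)//.
    - by rewrite /F/=; ring.
    - by apply: continuous_subspaceT => x; exact: ckap.
    - split; first by move=> x _; case: (dF x).
      + by apply: cvg_at_right_filter; exact: cF.
      + by apply: cvg_at_left_filter; exact: cF.
    - by move=> x _; rewrite derive1E; exact: derive_val.
  by rewrite F2; ring.
apply/eqP; rewrite -subr_eq0; apply/eqP; rewrite -/(I v).
have [K K0 hK] := f1K ltr01.
pose W := intR (fun u => expR (1 * u) * `|kap 0%N u|).
have W0 : 0 <= W by apply: Rintegral_ge0 => u _; rewrite mulr_ge0// expR_ge0.
have WK : 0 < W + K + 1 by rewrite ltr_wpDl// addr_ge0.
apply: (@le_all_eq0 _ _ (W + K)); first exact: addr_ge0.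
move=> e e0; have [w vw hw] := @expRN_small R 1 e ltr01 e0 (v + 1).
have {}vw : v < w by lra.
rewrite (step w vw); apply: le_trans (ler_normB _ _) _; rewrite mulrDr; apply: lerD; last first.
  by apply: le_trans (hK w) _; rewrite mulrC ler_wpM2r.
apply: (@le_trans _ _ (expR (- (1 * w)) * W)); last by rewrite ler_wpM2r.
rewrite /W -intRZ; last exact: kap_exp_integrable.
apply: norm_intR_le => //; first by apply: integrableRZ; exact: kap_exp_integrable.
move=> u; rewrite patchE; case: ifPn => [|_]; last first.
  by rewrite normr0 !mulr_ge0 ?expR_ge0.
rewrite inE/= in_itv/= andbT => wu'; have wu : w <= u := wu'.
by rewrite mulrA -expRD ler_peMl//; apply: le_trans (expR_ge1Dx _); lra.
Qed.

(** The difference is the integral of [kap 0] over the points below u. In particular m is the limit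
    of f1 at 0. *)
Lemma f1_at0 : exists2 K : R, 0 <= K & forall u, `|m - f1 (expR u)| <= K * expR u.
Proof.
pose W := intR (fun u => expR ((-1) * u) * `|kap 0%N u|).
have iW := kap_exp_integrable (-1).
exists W; first by apply: Rintegral_ge0 => u _; rewrite mulr_ge0// expR_ge0.
move=> v; rewrite -f1_tail -kap_m.
have iIR : integrableR (kap 0%N \_ `[v, +oo[).
  apply: (integrableR_le _ ikap) => [|y].
    apply/(measurable_restrictT _ _).1 => //; apply: measurable_funTS.
    exact: integrableR_measurable ikap.
  by rewrite patchE; case: ifP => // _; rewrite normr0.
rewrite -intRB// mulrC /W -intRZ//; apply: norm_intR_le.
- have := integrableRD ikap (integrableRZ (-1) iIR).
  by congr integrableR; apply/funext => u; rewrite mulN1r.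
- exact: integrableRZ.
move=> u; rewrite patchE; case: ifPn => [_|].
  by rewrite subrr normr0 !mulr_ge0 ?expR_ge0.
rewrite notin_setE/= in_itv/= andbT => /negP; rewrite -ltNge => uv'; have uv : u < v := uv'.
(* Outside its set a restriction takes the default value [point], which is 0 in R. *)
have -> : kap 0%N u - point = kap 0%N u by rewrite (_ : point = 0 :> R)// subr0.
by rewrite mulrA -expRD ler_peMl//; apply: le_trans (expR_ge1Dx _); lra.
Qed.

(** Differentiating t^-(i+1) h(2 ln t) gives t^-(i+2) times - (i+1) h + 2 h', whence the recursion:
    t^-(i+1) times [lk i 0 (2 ln t)] is the i-th derivative of [kap 0 (2 ln t)] / t. The index j
    counts further applications of - d/du. *)
Fixpoint lk (i j : nat) (u : R) : R :=
  if i is i'.+1 then - i'.+1%:R * lk i' j u - 2 * lk i' j.+1 u else kap j u.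

Lemma lk_derive i j (u : R) : is_derive u 1 (lk i j) (- lk i j.+1 u).
Proof.
elim: i j => [|i ih] j; first exact: dkap.
apply: is_derive_eq (dB (dZ (- i.+1%:R) (ih j)) (dZ 2 (ih j.+1))) _.
by rewrite /=; ring.
Qed.

Lemma lk_bound i : forall j (p : R), exists2 K : R, 0 <= K & forall u, `|lk i j u| <= K * expR (p * u).
Proof.
elim: i => [|i ih] j p; first exact: kapK.
have [K1 K10 h1] := ih j p; have [K2 K20 h2] := ih j.+1 p.
exists (i.+1%:R * K1 + 2 * K2); first by rewrite addr_ge0// mulr_ge0.
move=> u; rewrite mulrDl -!mulrA; apply: le_trans (ler_normB _ _) _.
by apply: lerD; rewrite normrM ?normrN normr_nat ler_wpM2l.
Qed.

Definition psi i (t : R) : R := expR (- i.+1%:R * ln t) * lk i 0 (2 * ln t).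

(** [phi 1 t] is [kap 0 (2 ln t)] / t, [phi 0] is its primitive vanishing at 0, and the others are
    its derivatives. The extension by zero to t <= 0 is what removes the left boundary terms of the
    Euler-Maclaurin steps. *)
Definition phi (i : nat) (t : R) : R :=
  if 0 < t then (if i is i'.+1 then psi i' t else 2^-1 * (m - f1 (expR (2 * ln t)))) else 0.

Lemma dln2 (t : R) : 0 < t -> is_derive t 1 (fun t => 2 * ln t) (2 / t).
Proof. by move=> t0; exact: dZ (is_derive1_ln t0). Qed.

Lemma psi_derive i (t : R) : 0 < t -> is_derive t 1 (psi i) (psi i.+1 t).
Proof.
move=> t0.
have d1 : is_derive t 1 (fun t => expR (- i.+1%:R * ln t)) (- i.+1%:R * expR (- i.+1%:R * ln t) * t^-1).
  exact: dcomp (exp_lin_derive _ _) (is_derive1_ln t0).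
have d2 : is_derive t 1 (fun t => lk i 0 (2 * ln t)) (- lk i 1 (2 * ln t) * (2 / t)).
  exact: dcomp (lk_derive _ _ _) (dln2 t0).
apply: is_derive_eq (dM d1 d2) _.
rewrite /psi /= (_ : - i.+2%:R * ln t = - i.+1%:R * ln t - ln t); last first.
  by rewrite -[i.+2%:R]natr1; ring.
by rewrite expRD expRN lnK ?posrE//; ring.
Qed.

(** Any power t^r is available: the rate (r + i + 1) / 2 for [lk], evaluated at 2 ln t, compensates
    the factor t^-(i+1). *)
Lemma psi_bound i (r : R) : exists2 K : R, 0 <= K & forall t : R, 0 < t -> `|psi i t| <= K * expR (r * ln t).
Proof.
have [K K0 hK] := lk_bound i 0 ((r + i.+1%:R) / 2); exists K => // t t0.
rewrite /psi normrM ger0_norm ?expR_ge0//.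
apply: le_trans (ler_wpM2l (expR_ge0 _) (hK _)) _; rewrite mulrCA -expRD.
rewrite (_ : _ + _ = r * ln t)//.
by field.
Qed.

Lemma expR2ln (t : R) : 0 < t -> expR (2 * ln t) = t ^+ 2.
Proof. by move=> t0; rewrite expRM_natl lnK ?posrE. Qed.

Lemma phi_derive i (t : R) : is_derive t 1 (phi i) (phi i.+1 t).
Proof.
case: i => [|i].
  have [K K0 hK] := f1_at0.
  apply: (@glue_derive _ _ (2^-1 * K)) => {}t t0; last first.
    rewrite normrM ger0_norm ?invr_ge0// -mulrA ler_wpM2l ?invr_ge0//.
    by rewrite -expR2ln.
  have d1 : is_derive t 1 (fun t => f1 (expR (2 * ln t))) (- kap 0%N (2 * ln t) * (2 / t)).
    exact: dcomp (df1 _) (dln2 t0).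
  apply: is_derive_eq (dZ 2^-1 (dB (dcst m t) d1)) _.
  rewrite /psi/= mulNr mul1r expRN lnK ?posrE//.
  by field; rewrite lt0r_neq0.
have [K K0 hK] := psi_bound i 2.
apply: (@glue_derive _ _ K) => {}t t0; first exact: psi_derive.
by rewrite -expR2ln// hK.
Qed.

Lemma phi_le0 i (t : R) : t <= 0 -> phi i t = 0.
Proof. by rewrite /phi leNgt => /negbTE ->. Qed.

Lemma phi_inv i : exists2 K : R, 0 <= K & forall t : R, 0 < t -> `|phi i.+1 t| <= K / t.
Proof.
have [K K0 hK] := psi_bound i (-1); exists K => // t t0; rewrite /phi t0.
by apply: le_trans (hK t t0) _; rewrite mulN1r expRN lnK ?posrE.
Qed.

Lemma phi_sq i : exists2 K : R, 0 <= K & forall t : R, 0 <= t -> `|phi i.+1 t| <= K / (1 + t) ^+ 2.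
Proof.
have [K1 K10 h1] := psi_bound i 0; have [K2 K20 h2] := psi_bound i (- 2).
exists (4 * (K1 + K2)); first by rewrite mulr_ge0// addr_ge0.
move=> t; rewrite le_eqVlt => /predU1P[<-|t0].
  by rewrite phi_le0// normr0 divr_ge0 ?mulr_ge0 ?addr_ge0 ?sqr_ge0.
rewrite /phi t0.
have t1 : 0 < 1 + t by rewrite addr_gt0.
rewrite ler_pdivlMr ?exprn_gt0//.
have [t1'|t1'] := leP t 1.
  have := h1 t t0; rewrite mul0r expR0 mulr1 => h.
  rewrite [4 * _]mulrC; apply: ler_pM => //; first by rewrite sqr_ge0.
    by apply: le_trans h _; rewrite lerDl.
  have -> : (4 : R) = 2 ^+ 2 by ring.
  by apply: lerXn2r; rewrite ?nnegrE; lra.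
have := h2 t t0; rewrite mulNr expRN expR2ln// => h.
apply: (@le_trans _ _ ((K2 / t ^+ 2) * (1 + t) ^+ 2)).
  by rewrite ler_wpM2r ?sqr_ge0.
rewrite mulrAC ler_pdivrMr ?exprn_gt0//.
apply: (@le_trans _ _ (K2 * (2 * t) ^+ 2)).
  by rewrite ler_wpM2l//; apply: lerXn2r; rewrite ?nnegrE; lra.
rewrite exprMn (_ : 2 ^+ 2 = 4 :> R); last by ring.
have := mulr_ge0 (mulr_ge0 (ler0n R 4) K10) (sqr_ge0 t); lra.
Qed.

(* The sum of f(j^2 / Y) / j over 0 < j < M, at Y = e^eta. *)
Definition Tsum (M : nat) (eta : R) : R :=
  \sum_(j < M) (if (0 < j)%N then j%:R^-1 * f1 (expR (2 * ln j%:R - eta)) else 0).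

Definition Tsum' (M : nat) (eta : R) : R :=
  \sum_(j < M) (if (0 < j)%N then j%:R^-1 * kap 0%N (2 * ln j%:R - eta) else 0).

Lemma Tsum_derive M (eta : R) : is_derive eta 1 (Tsum M) (Tsum' M eta).
Proof.
rewrite (_ : Tsum M = \sum_(j < M) (fun eta => if (0 < j)%N then j%:R^-1 * f1 (expR (2 * ln j%:R - eta)) else 0)); last first.
  by apply/funext => x; rewrite fct_sumE.
apply: is_derive_sum => j; case: ifP => _; last exact: dcst.
have dl : is_derive eta 1 (fun eta => 2 * ln j%:R - eta) (0 - 1).
  exact: dB (dcst _ _) (is_derive_id _ _).
by apply: is_derive_eq (dZ _ (dcomp (df1 _) dl)) _; ring.
Qed.

(** With delta = exp(- eta / 2) this derivative is the Riemann sum of [phi 1] with step delta, so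
    [chain_sum] compares it with [phi 0] at M delta, which is m / 2 up to a tail of f1. *)
Lemma Tsum'_bound n : exists2 C : R, 0 <= C & forall (M : nat) (eta : R), (0 < M)%N -> 0 <= eta ->
  `|Tsum' M eta - m / 2| <= C * (expR (- (n.+1%:R / 2 * eta)) + expR (2^-1 * eta) / M%:R).
Proof.
have [C C0 hC] := chain_sum phi_derive phi_le0 phi_inv phi_sq n.
have [K K0 hK] := @f1K 2^-1 (ltac:(by rewrite invr_gt0)).
exists (C + K); first exact: addr_ge0.
move=> M eta M0 eta0; have Mp : 0 < M%:R :> R by rewrite ltr0n.
pose delta := expR (- (2^-1 * eta)).
have d0 : 0 < delta by exact: expR_gt0.
have d1 : delta <= 1 by rewrite /delta -expR0 ler_expR oppr_le0 mulr_ge0// invr_ge0.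
have ld : ln delta = - (2^-1 * eta) by rewrite expRK.
have := hC delta M; rewrite d0 d1 => /(_ isT M0).
have -> : \sum_(j < M) delta * phi 1 (j%:R * delta) = Tsum' M eta.
  apply: eq_bigr => j _; case: ifPn => [j0|]; last first.
    by rewrite -eqn0Ngt => /eqP ->; rewrite mul0r phi_le0// mulr0.
  have jp : 0 < j%:R :> R by rewrite ltr0n.
  rewrite /phi mulr_gt0// /psi/= lnM ?posrE// ld mulNr mul1r expRN expRD lnK ?posrE// -/delta.
  rewrite (_ : 2 * (ln j%:R + _) = 2 * ln j%:R - eta); last by field.
  by field; rewrite !lt0r_neq0.
rewrite /phi mulr_gt0//.
have -> : delta ^+ n.+1 = expR (- (n.+1%:R / 2 * eta)).
  by rewrite /delta -expRM_natl; congr expR; rewrite mulrN; congr (- _); field.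
have Mi : (M%:R * delta)^-1 = expR (2^-1 * eta) / M%:R.
  by rewrite invfM /delta expRN invrK mulrC.
rewrite Mi; set A := expR (- (n.+1%:R / 2 * eta)); set B := _ / M%:R => h.
have l2 : `|f1 (expR (2 * ln (M%:R * delta)))| <= K * B.
  apply: le_trans (hK _) _; rewrite (_ : - _ = - ln (M%:R * delta)); last by field.
  by rewrite expRN lnK ?posrE ?mulr_gt0// Mi.
rewrite (_ : Tsum' M eta - m / 2 = (Tsum' M eta - 2^-1 * (m - f1 (expR (2 * ln (M%:R * delta)))))
   - 2^-1 * f1 (expR (2 * ln (M%:R * delta)))); last by field.
apply: le_trans (ler_normB _ _) _; rewrite [X in _ + X]normrM ger0_norm ?invr_ge0//.
have A0 : 0 <= A by exact: expR_ge0.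
have B0 : 0 <= B by rewrite divr_ge0// expR_ge0.
have := mulr_ge0 K0 A0; have := mulr_ge0 K0 B0.
have CA := mulr_ge0 C0 A0.
move: h l2; set z := `|f1 _|; set y := `|_ - _|; rewrite [C * (_ + _)]mulrDr; lra.
Qed.

(** By [f1_tail] the sum is the integral of [kap 0 u] times the harmonic sum [L u] over j <= exp((u
    + eta) / 2). Replacing it by (u + eta) / 2 + gamma yields the moments m and a, and thus the
    constants, but only an error of order exp(- eta / 2). *)
Lemma Tsum_const : exists2 C : R, 0 <= C & forall (M : nat) (eta : R), (0 < M)%N ->
  `|Tsum M eta - m / 2 * eta - a / 2 - euler_gamma * m| <=
    C * (expR (- (2^-1 * eta)) + expR (2^-1 * eta) / M%:R).
Proof.
have [C C0 hC] := harm_trunc R.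
pose W1 := intR (fun u => expR (- 2^-1 * u) * `|kap 0%N u|).
pose W2 := intR (fun u => expR (2^-1 * u) * `|kap 0%N u|).
have i1 := kap_exp_integrable (- 2^-1); have i2 := kap_exp_integrable 2^-1.
have W10 : 0 <= W1 by apply: Rintegral_ge0 => u _; rewrite mulr_ge0// expR_ge0.
have W20 : 0 <= W2 by apply: Rintegral_ge0 => u _; rewrite mulr_ge0// expR_ge0.
exists (C * (W1 + W2)); first by rewrite mulr_ge0// addr_ge0.
move=> M eta M0; have Mp : 0 < M%:R :> R by rewrite ltr0n.
pose L u : R := \sum_(j < M) (if (0 < j)%N && (ln j%:R <= 2^-1 * (u + eta)) then (j%:R)^-1 else 0).
have iI w : integrableR (kap 0%N \_ `[w, +oo[).
  apply: (integrableR_le _ ikap) => [|y].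
    apply/(measurable_restrictT _ _).1 => //; apply: measurable_funTS.
    exact: integrableR_measurable ikap.
  by rewrite patchE; case: ifP => // _; rewrite normr0.
have [iL vL] : integrableR (fun u => kap 0%N u * L u) /\ intR (fun u => kap 0%N u * L u) = Tsum M eta.
  pose g (j : 'I_M) u := (if (0 < j)%N then j%:R^-1 else 0) * (kap 0%N \_ `[2 * ln j%:R - eta, +oo[) u.
  have [g1 g2] := @intR_sum R _ (index_enum 'I_M) g (fun j => integrableRZ _ (iI _)).
  have E : (fun u => kap 0%N u * L u) = (fun u => \sum_(j < M) g j u).
    apply/funext => u; rewrite /L mulr_sumr; apply: eq_bigr => j _; rewrite /g patchE.
    case: (0 < j)%N => /=; last by rewrite mulr0 mul0r.
    rewrite (_ : (u \in _) = (ln j%:R <= 2^-1 * (u + eta))); last first.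
      set y := ln _; apply/idP/idP; rewrite in_setE/= in_itv/= andbT => h.
        by have {}h : 2 * y - eta <= u := h; lra.
      by rewrite -[_ <= _]/(2 * y - eta <= u); lra.
    by case: ifP => _; rewrite ?mulr0// mulrC.
  rewrite E; split; first exact: g1.
  rewrite g2; apply: eq_bigr => j _; rewrite /g intRZ// f1_tail.
  by case: ifP => _; rewrite ?mul0r.
have -> : Tsum M eta - m / 2 * eta - a / 2 - euler_gamma * m =
   intR (fun u => kap 0%N u * L u - (2^-1 * (u * kap 0%N u) + (2^-1 * eta + euler_gamma) * kap 0%N u)).
  rewrite intRB//; last by apply: integrableRD; exact: integrableRZ.
  rewrite intRD ?intRZ// ?vL ?kap_m ?kap_a; [by field|exact: integrableRZ|exact: integrableRZ].
have -> : C * (W1 + W2) * (expR (- (2^-1 * eta)) + expR (2^-1 * eta) / M%:R) =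
  (C * (expR (- (2^-1 * eta)) + expR (2^-1 * eta) / M%:R)) * (W1 + W2) by ring.
set e1 := expR (- _); set e2 := expR _ / M%:R.
have e10 : 0 <= e1 by exact: expR_ge0.
have e20 : 0 <= e2 by rewrite divr_ge0 ?expR_ge0.
rewrite -intRD// -intRZ; last exact: integrableRD.
apply: norm_intR_le.
- have j1 : integrableR (fun u => 2^-1 * (u * kap 0%N u) + (2^-1 * eta + euler_gamma) * kap 0%N u).
    by apply: integrableRD; exact: integrableRZ.
  have := integrableRD iL (integrableRZ (-1) j1).
  by congr integrableR; apply/funext => u; rewrite mulN1r.
- by apply: integrableRZ; exact: integrableRD.
move=> u; set y := 2^-1 * (u + eta).
rewrite (_ : _ - _ = kap 0%N u * (L u - y - euler_gamma)); last by rewrite /y; ring.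
rewrite normrM; apply: le_trans (ler_wpM2l (normr_ge0 _) (hC M y M0)) _.
rewrite -mulrDl mulrCA -[C * _ * _]mulrA ler_wpM2l// mulrC mulrA ler_wpM2r//.
have -> : expR (- y) = e1 * expR (- 2^-1 * u) by rewrite /e1 -expRD; congr expR; rewrite /y; ring.
have -> : expR y / M%:R = e2 * expR (2^-1 * u).
  by rewrite /e2 mulrAC -expRD; congr (expR _ / _); rewrite /y; ring.
set x1 := expR (- _ * _); set x2 := expR (_ * _).
have x10 : 0 <= x1 by exact: expR_ge0. have x20 : 0 <= x2 by exact: expR_ge0.
have := mulr_ge0 e10 x20; have := mulr_ge0 e20 x10; lra.
Qed.

(** The expansion holds with negligible error at a very large w by [Tsum_const]; integrating the
    sharp bound for the derivative from eta to w carries it back to eta. *)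
Lemma main_term (A : R) : 0 < A -> exists2 K : R, 0 <= K & forall eta e : R, 0 < e ->
  exists M0 : nat, forall M : nat, (M0 <= M)%N ->
  `|Tsum M eta - m / 2 * eta - a / 2 - euler_gamma * m| <= K * expR (- (A * eta)) + e.
Proof.
move=> A0.
(* The order of Euler-Maclaurin is chosen so that the rate q is at least A. *)
pose n := Num.truncn (2 * A); pose q : R := n.+1%:R / 2.
have q0 : 0 < q by rewrite divr_gt0// ltr0n.
have Aq : A <= q.
  rewrite /q ler_pdivlMr// mulrC ltW// truncnS_gt//.
have [C C0 hC] := Tsum'_bound n; have [C2 C20 hC2] := Tsum_const.
have [K3 K30 hK3] := f1K ltr01.
pose cc : R := `|m| + `|a| + `|euler_gamma * m| + 2 * K3.
have cc0 : 0 <= cc by rewrite !addr_ge0// mulr_ge0.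
exists (C / q + cc * (1 + A^-1)).
  apply: addr_ge0; first by rewrite divr_ge0 ?(ltW q0).
  by apply: mulr_ge0 => //; rewrite addr_ge0// invr_ge0 ltW.
move=> eta e e0.
(* Negative eta = ln(X / a) occurs when a > X. Then exp(- A eta) >= 1 dominates every term
   separately: the sum by f1(x) = O(1/x), and |eta| by exp(- A eta) / A. *)
have [eta0|eta0] := leP 0 eta; last first.
  exists 0%N => M _; apply: ler_wpDr; first exact: ltW.
  have TM : `|Tsum M eta| <= 2 * K3.
    apply: le_trans (ler_norm_sum _ _ _) _.
    apply: (@le_trans _ _ (\sum_(j < M) (if (0 < j)%N then K3 * (j%:R ^+ 2)^-1 else 0))).
      apply: ler_sum => j _; case: ifP => [j0|_]; last by rewrite normr0.
      have jp : 0 < j%:R :> R by rewrite ltr0n.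
      rewrite normrM ger0_norm ?invr_ge0// mulrC.
      apply: (@le_trans _ _ (`|f1 (expR (2 * ln j%:R - eta))| * 1)).
        by rewrite ler_wpM2l// invf_le1// ler1n.
      rewrite mulr1; apply: le_trans (hK3 _) _; rewrite ler_wpM2l// mul1r opprB expRD.
      rewrite expRN expR2ln// ler_piMl ?invr_ge0 ?sqr_ge0// -expR0 ler_expR ltW//.
    case: M => [|M]; first by rewrite big_ord0 mulr_ge0.
    rewrite big_ord_recl/= add0r -mulr_sumr mulrC ler_wpM2r//.
    exact: sum_inv_sq_le.
  have E1 : 1 <= expR (- (A * eta)).
    by rewrite -expR0 ler_expR oppr_ge0 mulr_ge0_le0// ltW.
  have E2 : - eta <= A^-1 * expR (- (A * eta)).
    rewrite ler_pdivlMl// mulrN; apply: le_trans (expR_ge1Dx _); lra.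
  set E := expR _ in E1 E2 *.
  have ce : `|m / 2 * eta| <= cc * (A^-1 * E).
    rewrite normrM (ltr0_norm eta0); apply: ler_pM => //; first by rewrite oppr_ge0 ltW.
    rewrite normrM [`|2^-1|]ger0_norm ?invr_ge0// /cc.
    have := normr_ge0 m; have := normr_ge0 a; have := normr_ge0 (euler_gamma * m); have := mulr_ge0 (ler0n R 2) K30; lra.
  have c1 : cc <= cc * E by rewrite ler_peMr.
  have CE : 0 <= C / q * E by rewrite mulr_ge0 ?divr_ge0// ltW// (lt_le_trans ltr01).
  apply: le_trans (ler_normB _ _) _; apply: le_trans (lerD (ler_normB _ _) (lexx _)) _.
  apply: le_trans (lerD (lerD (ler_normB _ _) (lexx _)) (lexx _)) _.
  have : `|a / 2| <= `|a| by rewrite normrM ler_piMr// ger0_norm ?invr_ge0// invf_le1// ler1n.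
  rewrite (_ : (C / q + cc * (1 + A^-1)) * E = C / q * E + cc * E + cc * (A^-1 * E)); last by ring.
  have ccE : cc = `|m| + `|a| + `|euler_gamma * m| + 2 * K3 by [].
  move: ce c1 CE TM ccE; clearbody cc q E; have := normr_ge0 m; lra.
pose c2 := C2 + 1.
(* First w is taken so large that the error of [Tsum_const] at w is small; only then is M chosen,
   because the truncation errors grow like exp(w / 2) / M. *)
have [w ew hw] := @expRN_small R 2^-1 (e / (2 * (C2 + 1))) (ltac:(by rewrite invr_gt0))
  (ltac:(by rewrite divr_gt0// mulr_gt0// ltr_wpDl)) eta.
have C21 : 0 < C2 + 1 by rewrite ltr_wpDl.
pose Z := (2 * C + C2) * expR (2^-1 * w).
have Z0 : 0 <= Z by rewrite mulr_ge0 ?expR_ge0// addr_ge0// mulr_ge0.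
exists (Num.truncn (Z / (e / 2))).+1 => M M0M.
have M0 : (0 < M)%N by exact: leq_trans M0M.
have Mp : 0 < M%:R :> R by rewrite ltr0n.
have ZM : Z / M%:R <= e / 2.
  rewrite ler_pdivrMr// mulrC -ler_pdivrMr ?divr_gt0//.
  by apply: ltW; apply: lt_le_trans (truncnS_gt _) _; rewrite ?ler_nat.
pose D x := Tsum M x - m / 2 * (x - 0).
have derD (x : R) : is_derive x 1 D (Tsum' M x - m / 2) by exact: dB (Tsum_derive _ _) (dlin _ _ _).
(* A primitive of the bound of [Tsum'_bound], to be used in [mvt_compare]. *)
pose E (x : R) : R := - (C / q) * expR (- q * x) + 2 * C / M%:R * expR (2^-1 * x).
have dE (x : R) : is_derive x 1 E (C * (expR (- (q * x)) + expR (2^-1 * x) / M%:R)).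
  apply: is_derive_eq (dD (dZ _ (exp_lin_derive _ _)) (dZ _ (exp_lin_derive _ _))) _.
  rewrite [- q * x]mulNr; set x1 := expR _; set x2 := expR _.
  have qn : q != 0 by rewrite lt0r_neq0.
  by move: qn; clearbody q x1 x2 => qn; field; rewrite qn lt0r_neq0.
have cmp := @mvt_compare R D E (fun x => Tsum' M x - m / 2)
   (fun x => C * (expR (- (q * x)) + expR (2^-1 * x) / M%:R)) eta w ew (fun x _ => derD x) (fun x _ => dE x).
have {}cmp := cmp (fun x xi => hC M x M0 (le_trans eta0 (andP xi).1)).
have hDw := hC2 M w M0.
have -> : Tsum M eta - m / 2 * eta - a / 2 - euler_gamma * m =
   - (D w - D eta) + (Tsum M w - m / 2 * w - a / 2 - euler_gamma * m) by rewrite /D; ring.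
apply: le_trans (ler_normD _ _) _; rewrite normrN; apply: le_trans (lerD cmp hDw) _.
have h1 : C2 * expR (- (2^-1 * w)) <= e / 2.
  apply: le_trans (ler_wpM2l C20 hw) _.
  rewrite invfM [e * (_ * _)]mulrA mulrCA ler_piMr ?divr_ge0 ?(ltW e0)//.
  by rewrite ler_pdivrMr// mul1r lerDl.
have h2 : C / q * expR (- q * eta) <= C / q * expR (- (A * eta)).
  by rewrite ler_wpM2l ?divr_ge0 ?(ltW q0)// mulNr ler_expR lerN2 ler_wpM2r.
have h3 : 0 <= C / q * expR (- q * w) by rewrite mulr_ge0 ?expR_ge0 ?divr_ge0 ?(ltW q0).
have h4 : 0 <= 2 * C / M%:R * expR (2^-1 * eta) by rewrite mulr_ge0 ?expR_ge0 ?divr_ge0 ?mulr_ge0.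
have h5 : 0 <= cc * (1 + A^-1) * expR (- (A * eta)).
  apply: mulr_ge0; last exact: expR_ge0.
  by apply: mulr_ge0 => //; rewrite addr_ge0// invr_ge0 ltW.
have h6 : 2 * C / M%:R * expR (2^-1 * w) + C2 * (expR (2^-1 * w) / M%:R) = Z / M%:R.
  by rewrite /Z; ring.
rewrite /E mulrDr mulrDl; lra.
Qed.

End MainTerm.

(** * Unordered sums *)

Section UnorderedSums.
Variables (R : realType) (T : choiceType).
Implicit Types (D : set T) (u v w : T -> R) (A : nat -> seq T).

(** Along such finite sets an unordered sum is a limit of ordinary sums; they will be initial
    segments of nat and squares of pairs. *)
Definition exhausts A := (forall M, uniq (A M)) /\
  forall x, exists M0, forall M, (M0 <= M)%N -> x \in A M.

Lemma exhausts_finite A (F : set T) : exhausts A -> finite_set F ->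
  exists M0, forall M, (M0 <= M)%N -> F `<=` [set` A M].
Proof.
move=> [_ hA] /finite_seqP[s ->]; elim: s => [|x s [M1 h1]]; first by exists 0%N.
have [M2 h2] := hA x; exists (maxn M1 M2) => M; rewrite geq_max => /andP[m1 m2] y /=.
by rewrite inE => /predU1P[->|ys]; [exact: h2|exact: (h1 M m1 y)].
Qed.

Lemma partial_fsum A D w M : exhausts A ->
  (\sum_(x <- A M | x \in D) w x)%:E =
  (\sum_(x \in [set` [seq x <- A M | x \in D]]) (w x)%:E)%E.
Proof.
move=> [uA _]; rewrite -big_filter -sumEFin fsbig_seq//; exact: filter_uniq.
Qed.

Lemma partial_le_esum A D w M : exhausts A ->
  ((\sum_(x <- A M | x \in D) w x)%:E <= \esum_(x in D) (w x)%:E)%E.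
Proof.
move=> eA; apply: esum_ge; exists [set` [seq x <- A M | x \in D]].
  split; first exact: finite_seq.
  by move=> x /=; rewrite mem_filter => /andP[]; rewrite in_setE.
by rewrite -partial_fsum.
Qed.

Lemma fsum_le_partial A D w (F : set T) : exhausts A -> (forall x, 0 <= w x) ->
  finite_set F -> F `<=` D -> exists M0, forall M, (M0 <= M)%N ->
  (\sum_(x \in F) (w x)%:E <= (\sum_(x <- A M | x \in D) w x)%:E)%E.
Proof.
move=> eA w0 finF FD; have [M0 h] := exhausts_finite eA finF; exists M0 => M m0.
rewrite partial_fsum//; apply: lee_fsum_nneg_subset => //.
  by move=> x; rewrite !in_setE/= mem_filter => Fx; apply/andP; split; [exact/mem_set/FD|exact: (h M m0 x)].
by move=> x _; rewrite lee_fin.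
Qed.

Lemma esum_le_partial A D w (K : R) : exhausts A -> (forall x, 0 <= w x) ->
  (forall M, \sum_(x <- A M | x \in D) w x <= K) ->
  (\esum_(x in D) (w x)%:E <= K%:E)%E.
Proof.
move=> eA w0 hK; apply: ge_ereal_sup => _ [F [finF FD] <-].
have [M0 h] := fsum_le_partial eA w0 finF FD.
by apply: le_trans (h M0 (leqnn _)) _; rewrite lee_fin.
Qed.

Definition abs_summable D u := (\esum_(x in D) `|u x|%:E < +oo)%E.

Lemma abs_summable_bound A D u (K : R) : exhausts A ->
  (forall M, \sum_(x <- A M | x \in D) `|u x| <= K) -> abs_summable D u.
Proof. by move=> eA h; apply: le_lt_trans (esum_le_partial eA _ h) (ltry _). Qed.

Lemma abs_summableS D D' u : D' `<=` D -> abs_summable D u -> abs_summable D' u.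
Proof.
move=> DD; apply: le_lt_trans; apply: ge_ereal_sup => _ [F [finF FD] <-].
by apply: ereal_sup_ubound; exists F => //; split => // x /FD /DD.
Qed.

Lemma abs_summable_le D u w : (forall x, `|w x| <= `|u x|) ->
  abs_summable D u -> (\esum_(x in D) (w x)%:E < +oo)%E.
Proof.
by move=> wu; apply: le_lt_trans; apply: le_esum => x _; rewrite lee_fin (le_trans (ler_norm _)).
Qed.

Lemma esum_partial_lim A D w : exhausts A -> (forall x, 0 <= w x) ->
  (\esum_(x in D) (w x)%:E < +oo)%E -> forall e : R, 0 < e -> exists M0, forall M, (M0 <= M)%N ->
  `|fine (\esum_(x in D) (w x)%:E)%E - \sum_(x <- A M | x \in D) w x| <= e.
Proof.
move=> eA w0 fin e e0; set S := (\esum_(x in D) _)%E.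
have Sfin : S \is a fin_num.
  by rewrite fin_numElt fin andbT (lt_le_trans (ltNyr 0))//; apply: esum_ge0 => x _; rewrite lee_fin.
have [_ [F [finF FD] <-]] := ub_ereal_sup_adherent e0 Sfin; rewrite -/(esum _ _) -/S => hF.
have [M0 h] := fsum_le_partial eA w0 finF FD; exists M0 => M m0.
have {}h := lt_le_trans hF (h M m0).
have h2 := @partial_le_esum A D w M eA.
move: h h2; rewrite -/S -(fineK Sfin) -EFinB lte_fin lee_fin => h h2.
by rewrite ger0_norm ?subr_ge0//; lra.
Qed.

Lemma rsumE D u : rsum D u =
  fine (\esum_(x in D) (Num.max (u x) 0)%:E)%E - fine (\esum_(x in D) (Num.max (- u x) 0)%:E)%E.
Proof. by rewrite /rsum; congr (fine _ - fine _); apply: eq_esum => x _; rewrite EFin_max ?funeposE ?funenegE. Qed.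

Lemma abs_summable_max D u (s : bool) : abs_summable D u ->
  (\esum_(x in D) (Num.max ((-1) ^+ s * u x) 0)%:E < +oo)%E.
Proof.
apply: abs_summable_le => x.
rewrite ger0_norm ?le_max ?lexx ?orbT// ge_max normr_ge0 andbT.
by rewrite (le_trans (ler_norm _))// normrM normr_sign mul1r.
Qed.

Lemma rsum_lim A D u : exhausts A -> abs_summable D u ->
  forall e : R, 0 < e -> exists M0, forall M, (M0 <= M)%N ->
  `|rsum D u - \sum_(x <- A M | x \in D) u x| <= e.
Proof.
move=> eA su e e0; have e20 : 0 < e / 2 by rewrite divr_gt0.
have max0 (x : R) : 0 <= Num.max x 0 by rewrite le_max lexx orbT.
have sp : (\esum_(x in D) (Num.max (u x) 0)%:E < +oo)%E.
  by have := abs_summable_max false su; under eq_esum do rewrite expr0 mul1r.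
have sn : (\esum_(x in D) (Num.max (- u x) 0)%:E < +oo)%E.
  by have := abs_summable_max true su; under eq_esum do rewrite expr1 mulN1r.
have [M1 h1] := esum_partial_lim eA (fun x => max0 (u x)) sp e20.
have [M2 h2] := esum_partial_lim eA (fun x => max0 (- u x)) sn e20.
exists (maxn M1 M2) => M; rewrite geq_max => /andP[m1 m2].
have -> : \sum_(x <- A M | x \in D) u x = \sum_(x <- A M | x \in D) Num.max (u x) 0
    - \sum_(x <- A M | x \in D) Num.max (- u x) 0.
  rewrite -sumrB; apply: eq_bigr => x _.
  by have [h|h] := leP (u x) 0; have [h'|h'] := leP (- u x) 0; lra.
rewrite rsumE; have := h1 M m1; have := h2 M m2.
set a := fine _; set b := fine _; set c := \sum_(_ <- _ | _) _; set d := \sum_(_ <- _ | _) _.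
by rewrite !ler_norml => /andP[? ?] /andP[? ?]; apply/andP; split; lra.
Qed.

(** The gateway from finite to infinite sums: an estimate for the partial sums with arbitrarily
    small loss e becomes one for the unordered sum. *)
Lemma rsum_dist A D u (L K : R) : exhausts A -> abs_summable D u ->
  (forall e : R, 0 < e -> exists M0, forall M, (M0 <= M)%N ->
    `|\sum_(x <- A M | x \in D) u x - L| <= K + e) ->
  `|rsum D u - L| <= K.
Proof.
move=> eA su h; apply/ler_addgt0Pr => e e0.
have e20 : 0 < e / 2 by rewrite divr_gt0.
have [M1 h1] := rsum_lim eA su e20; have [M2 h2] := h _ e20.
have := h1 (maxn M1 M2) (leq_maxl _ _); have := h2 (maxn M1 M2) (leq_maxr _ _).
set s := \sum_(_ <- _ | _) _ => k2 k1.
rewrite (_ : _ - L = (rsum D u - s) + (s - L)); last by ring.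
by apply: le_trans (ler_normD _ _) _; lra.
Qed.

Lemma rsumID D (B : set T) u : abs_summable D u ->
  rsum D u = rsum (D `&` B) u + rsum (D `&` ~` B) u.
Proof.
move=> su; rewrite !rsumE.
have sub1 : D `&` B `<=` D by exact: subIsetl.
have sub2 : D `&` ~` B `<=` D by exact: subIsetl.
have finp (s : bool) D' : D' `<=` D -> (\esum_(x in D') (Num.max ((-1) ^+ s * u x) 0)%:E)%E \is a fin_num.
  move=> DD; rewrite fin_numElt (abs_summable_max s (abs_summableS DD su)) andbT.
  by rewrite (lt_le_trans (ltNyr 0))//; apply: esum_ge0 => x _; rewrite lee_fin le_max lexx orbT.
have E (s : bool) : fine (\esum_(x in D) (Num.max ((-1) ^+ s * u x) 0)%:E)%E =
    fine (\esum_(x in D `&` B) (Num.max ((-1) ^+ s * u x) 0)%:E)%E +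
    fine (\esum_(x in D `&` ~` B) (Num.max ((-1) ^+ s * u x) 0)%:E)%E.
  rewrite (esumID B) ?fineD ?finp// => x _; by rewrite lee_fin le_max lexx orbT.
have p D' : fine (\esum_(x in D') (Num.max (u x) 0)%:E)%E =
    fine (\esum_(x in D') (Num.max ((-1) ^+ false * u x) 0)%:E)%E.
  by congr fine; apply: eq_esum => x _; rewrite expr0 mul1r.
have n D' : fine (\esum_(x in D') (Num.max (- u x) 0)%:E)%E =
    fine (\esum_(x in D') (Num.max ((-1) ^+ true * u x) 0)%:E)%E.
  by congr fine; apply: eq_esum => x _; rewrite expr1 mulN1r.
by rewrite !p !n !E; ring.
Qed.

Lemma eq_rsum D u v : (forall x, D x -> u x = v x) -> rsum D u = rsum D v.
Proof.
by move=> uv; rewrite !rsumE; congr (fine _ - fine _); apply: eq_esum => x Dx; rewrite uv.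
Qed.

End UnorderedSums.

Section Reindexing.
Variables (R : realType) (T T' : choiceType).

Lemma rsum_reindex (P : set T) (Q : set T') (h : T -> T') (u : T' -> R) :
  set_bij P Q h -> rsum Q u = rsum P (u \o h).
Proof. by move=> b; rewrite !rsumE !(reindex_esum P Q h). Qed.

Lemma abs_summable_reindex (P : set T) (Q : set T') (h : T -> T') (u : T' -> R) :
  set_bij P Q h -> abs_summable Q u -> abs_summable P (u \o h).
Proof. by move=> b; rewrite /abs_summable (reindex_esum P Q h). Qed.

End Reindexing.

Section Squares.
Variable R : realType.

Lemma mem_setb (T : Type) (P : pred T) x : (x \in [set y | P y]) = P x.
Proof. by apply/idP/idP; rewrite in_setE. Qed.

Lemma exhausts_iota : exhausts (fun M => index_iota 0 M).
Proof.
split=> [M|x]; first exact: iota_uniq.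
by exists x.+1 => M xM; rewrite mem_index_iota.
Qed.

Definition square M : seq (nat * nat) := [seq (i, j) | i <- index_iota 0 M, j <- index_iota 0 M].

Lemma exhausts_square : exhausts square.
Proof.
split=> [M|[x y]]; first by apply: allpairs_uniq; [exact: iota_uniq|exact: iota_uniq|move=> [? ?] [? ?]].
exists (maxn x y).+1 => M xM; apply/allpairsP; exists (x, y) => /=.
by rewrite !mem_index_iota/=; split => //; apply: leq_trans xM; rewrite ltnS ?leq_maxl ?leq_maxr.
Qed.

Lemma sum_iota (D : set nat) (u : nat -> R) M :
  \sum_(x <- index_iota 0 M | x \in D) u x = \sum_(j < M) (if (j : nat) \in D then u j else 0).
Proof. by rewrite big_mkcond big_mkord. Qed.

Lemma sum_square (D : set (nat * nat)) (u : nat * nat -> R) M :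
  \sum_(x <- square M | x \in D) u x =
  \sum_(i < M) \sum_(j < M) (if (i : nat, j : nat) \in D then u (i : nat, j : nat) else 0).
Proof.
rewrite big_mkcond big_allpairs big_mkord; apply: eq_bigr => i _.
by rewrite big_mkord.
Qed.

Lemma sum_square_le (D : set (nat * nat)) (w : nat * nat -> R) (al be : nat -> R) (Ka Kb : R) M :
  (forall i, 0 <= al i) -> (forall i, 0 <= be i) ->
  (forall i j, (i, j) \in D -> w (i, j) <= al i * be j) ->
  \sum_(i < M) al i <= Ka -> \sum_(j < M) be j <= Kb ->
  \sum_(x <- square M | x \in D) w x <= Ka * Kb.
Proof.
move=> al0 be0 h hA hB; rewrite sum_square.
apply: (@le_trans _ _ ((\sum_(i < M) al i) * (\sum_(j < M) be j))); last first.
  by apply: ler_pM => //; apply: sumr_ge0.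
rewrite mulr_suml; apply: ler_sum => i _; rewrite mulr_sumr; apply: ler_sum => j _.
by case: ifP => [/h//|_]; rewrite mulr_ge0.
Qed.

End Squares.

(** * The function k as a double sum *)

Section TailSums.
Variable R : realType.

Lemma sum_inv_sq_tail (M N : nat) : (0 < M <= N)%N ->
  \sum_(M <= n < N) (n%:R ^+ 2)^-1 <= 2 / M%:R - 2 / N%:R :> R.
Proof.
move=> /andP[M0]; elim: N => [|N ih]; first by rewrite leqn0 => /eqP M0'; rewrite M0' in M0.
rewrite leq_eqVlt => /predU1P[->|]; first by rewrite big_geq// subrr.
rewrite ltnS => MN; rewrite big_nat_recr//=.
have N0 : 0 < N%:R :> R by rewrite ltr0n (leq_trans M0).
apply: le_trans (lerD (ih MN) (lexx _)) _.
have N1 : 1 <= N%:R :> R by rewrite ler1n (leq_trans M0).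
rewrite -[N.+1%:R]natr1; move: N0 N1; set x : R := N%:R => x0 x1.
suff : (x ^+ 2)^-1 <= 2 / x - 2 / (x + 1) by lra.
rewrite (_ : 2 / x - 2 / (x + 1) = 2 / (x * (x + 1))); last by field; rewrite !lt0r_neq0// addr_gt0.
rewrite ler_pdivlMr ?mulr_gt0 ?addr_gt0// mulrC ler_pdivrMr ?exprn_gt0//; nra.
Qed.

Variables (c : nat -> R) (hc : forall n, (0 < n)%N -> `|c n| <= (n%:R ^+ 2)^-1).

Lemma abs_summable_inv_sq : abs_summable [set n | (0 < n)%N] c.
Proof.
apply: (abs_summable_bound (K := 2) exhausts_iota) => M; rewrite sum_iota.
case: M => [|M]; first by rewrite big_ord0.
rewrite big_ord_recl mem_setb/= add0r.
by apply: le_trans (sum_inv_sq_le R M); apply: ler_sum => j _; rewrite mem_setb/= hc.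
Qed.

Lemma rsum_inv_sq_tail M : (0 < M)%N ->
  `|rsum [set n | (0 < n)%N] c - \sum_(j < M) (if (0 < j)%N then c j else 0)| <= 2 / M%:R.
Proof.
move=> M0; apply: (rsum_dist exhausts_iota abs_summable_inv_sq) => e e0.
exists M => N MN; rewrite sum_iota.
rewrite (eq_bigr (fun j : 'I_N => if (0 < j)%N then c j else 0)); last first.
  by move=> j _; rewrite mem_setb.
rewrite -!(big_mkord xpredT (fun j => if (0 < j)%N then c j else 0)).
rewrite (big_cat_nat (n := M))//= [X in `|X|]addrAC subrr add0r.
apply: le_trans (ler_norm_sum _ _ _) _.
apply: (@le_trans _ _ (\sum_(M <= n < N) (n%:R ^+ 2)^-1)).
  rewrite big_nat [leRHS]big_nat; apply: ler_sum => n /andP[Mn _].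
  by rewrite (leq_trans M0)// hc// (leq_trans M0).
apply: le_trans (sum_inv_sq_tail _) _; first by rewrite M0.
have : 0 <= 2 / N%:R :> R by rewrite divr_ge0.
lra.
Qed.

End TailSums.

Section ZetaLine.
Local Open Scope complex_scope.
Import Normc.
Variable R : realType.
Local Notation C := R[i].
Local Notation Re := (@complex.Re R).
Local Notation Im := (@complex.Im R).
Implicit Types (z s : C) (F : C -> C).

Definition zetaM M s : C := \sum_(n < M) (if (0 < n)%N then cpow n%:R (- s) else 0).

Lemma Re_sum (I : Type) (r : seq I) (P : pred I) (g : I -> C) :
  Re (\sum_(i <- r | P i) g i) = \sum_(i <- r | P i) Re (g i).
Proof. by rewrite (big_morph Re (@cReD R) (erefl _ : Re 0 = 0)). Qed.

Lemma Im_sum (I : Type) (r : seq I) (P : pred I) (g : I -> C) :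
  Im (\sum_(i <- r | P i) g i) = \sum_(i <- r | P i) Im (g i).
Proof. by rewrite (big_morph Im (@cImD R) (erefl _ : Im 0 = 0)). Qed.

Lemma normc_cpow_le s n : 2 <= Re s -> (0 < n)%N -> normc (cpow (n%:R : R) (- s)) <= (n%:R ^+ 2)^-1.
Proof.
move=> s2 n0; have np : 0 < n%:R :> R by rewrite ltr0n.
rewrite cpow_cexp// normc_cexp cReM/= cReN !mul0r subr0.
rewrite -(expR2ln np) -expRN ler_expR mulrN lerN2 [leRHS]mulrC ler_wpM2r//.
by rewrite ln_ge0// ler1n.
Qed.

Lemma zetaM_dist s M : 2 <= Re s -> (0 < M)%N -> normc (zeta s - zetaM M s) <= 4 / M%:R.
Proof.
move=> s2 M0; apply: le_trans (normc_le _) _.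
rewrite cReD cReN cImD cImN Re_sum Im_sum.
rewrite (_ : 4 / M%:R = 2 / M%:R + 2 / M%:R); last by ring.
apply: lerD.
  under [X in _ - X]eq_bigr do rewrite (fun_if Re).
  apply: rsum_inv_sq_tail => // n n0.
  exact: le_trans (Re_le_normc _) (normc_cpow_le s2 n0).
under [X in _ - X]eq_bigr do rewrite (fun_if Im).
apply: rsum_inv_sq_tail => // n n0.
exact: le_trans (Im_le_normc _) (normc_cpow_le s2 n0).
Qed.

(** The constant is 4 times 12 from the factorization of a difference of squares: [zetaM 1] is 0, so
    |zeta s| <= 4, and |zetaM M s| <= 8. *)
Lemma zeta_sq_dist s M : 2 <= Re s -> (0 < M)%N ->
  normc (zeta s ^+ 2 - zetaM M s ^+ 2) <= 48 / M%:R.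
Proof.
move=> s2 M0; have Mp : 0 < M%:R :> R by rewrite ltr0n.
have h := zetaM_dist s2 M0; have h1 := zetaM_dist s2 (ltn0Sn 0).
have z4 : normc (zeta s) <= 4.
  have z1 : zetaM 1 s = 0 by rewrite /zetaM big_ord1.
  by move: h1; rewrite z1 subr0 divr1.
have zM : normc (zeta s + zetaM M s) <= 12.
  rewrite (_ : zeta s + _ = zeta s + zeta s - (zeta s - zetaM M s)); last by ring.
  apply: le_trans (normcB _ _) _; apply: le_trans (lerD (normcD _ _) (lexx _)) _.
  have : 4 / M%:R <= 4 :> R by rewrite ler_pdivrMr// ler_peMr// ler1n.
  by move: h z4; lra.
rewrite subr_sqr normcM (_ : 48 / M%:R = 4 / M%:R * 12); last by ring.
by apply: ler_pM => //; exact: normc_ge0.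
Qed.

Definition line2 F (u t : R) : R := Re (F (2 +i* t) * cexp (- (u%:C * (2 +i* t)))).

Lemma line2E F u t : line2 F u t = expR (- (2 * u)) *
  (rline F 2 t * cos (t * u) + iline F 2 t * sin (t * u)).
Proof.
rewrite /line2 Re_mul_cexp cReN cImN cReM cImM/= !mul0r subr0 addr0 cosN sinN.
by rewrite ![u * _]mulrC mulrN opprK.
Qed.

Lemma line2_int F u : decays 2 (rline F 2) -> decays 2 (iline F 2) ->
  integrableR (line2 F u) /\ intR (line2 F u) = LM F 2 u.
Proof.
move=> d1 d2.
have i1 := decays_integrable d1; have i2 := decays_integrable d2.
have j1 : integrableR (fun t => rline F 2 t * cos (t * u) + iline F 2 t * sin (t * u)).
  apply: integrableRD; apply: integrableRM => //.
  - by apply: continuous_measurable; exact: cont_cosl.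
  - by exists 1 => t; exact: abs_cos_le1.
  - by apply: continuous_measurable; exact: cont_sinl.
  - by exists 1 => t; exact: abs_sin_le1.
rewrite (_ : line2 F u = fun t => expR (- (2 * u)) * (rline F 2 t * cos (t * u) + iline F 2 t * sin (t * u))); last first.
  by apply/funext => t; exact: line2E.
by split; [exact: integrableRZ|rewrite intRZ].
Qed.

(** Expanding the square, the pair (i, j) contributes (i j)^(-1/2) F(s) (i j y)^(-s), the inversion
    integrand at u = ln(i j y). *)
Lemma Re_zetaM_integrand F (y : R) M t : 0 < y -> let s := 2 +i* t in
  Re (cpow y (- s) * F s * zetaM M (2^-1 + s) ^+ 2) =
  \sum_(i < M) \sum_(j < M) (if (0 < i)%N && (0 < j)%N then
     expR (- (2^-1 * (ln i%:R + ln j%:R))) else 0) * line2 F (ln i%:R + ln j%:R + ln y) t.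
Proof.
move=> y0 s; rewrite /zetaM expr2 big_distrlr/= mulr_sumr Re_sum; apply: eq_bigr => i _.
rewrite mulr_sumr Re_sum; apply: eq_bigr => j _.
have [i0|] := boolP (0 < i)%N; last by rewrite !mul0r mulr0.
have [j0|] := boolP (0 < j)%N; last by rewrite mul0r !mulr0.
have half : (2^-1 : C) = (2^-1 : R)%:C by rewrite fmorphV rmorph_nat.
have ip : 0 < i%:R :> R by rewrite ltr0n.
have jp : 0 < j%:R :> R by rewrite ltr0n.
rewrite /= (cpow_cexp _ y0) (cpow_cexp _ ip) (cpow_cexp _ jp) half.
rewrite (_ : forall c f z w : C, c * f * (z * w) = f * (c * (z * w))); last by move=> *; ring.
rewrite -!cexpD line2E Re_mul_cexp.
set li := ln i%:R; set lj := ln j%:R; set ly := ln y.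
set e := (_ + _ : C).
have -> : Re e = - (2^-1 * (li + lj)) - 2 * (li + lj + ly).
  by rewrite /e /s !(cReD, cReM, cReN)/=; field.
have -> : Im e = - (t * (li + lj + ly)).
  by rewrite /e /s !(cImD, cImM, cImN)/=; ring.
rewrite cosN sinN mulrN opprK expRD -mulrA; congr (_ * _).
Qed.

(** On the line of integration zeta has argument of real part 5/2, so truncating it costs O(1/M)
    uniformly against the integrable F; the truncated integrand is a finite combination of inversion
    integrands. *)
Lemma kfun_lim F (y : R) : 0 < y -> decays 2 (rline F 2) -> decays 2 (iline F 2) ->
  exists2 c : R, 0 <= c & forall M, (0 < M)%N ->
  `|Re (kfun F y) - (2 * pi)^-1 * \sum_(i < M) \sum_(j < M) (if (0 < i)%N && (0 < j)%N then
     expR (- (2^-1 * (ln i%:R + ln j%:R))) else 0) * LM F 2 (ln i%:R + ln j%:R + ln y)| <= c / M%:R.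
Proof.
move=> y0 d1 d2.
pose H (t : R) : R := let s := 2 +i* t in Re (cpow y (- s) * F s * zeta (2^-1 + s) ^+ 2).
pose h M (t : R) : R := let s := 2 +i* t in Re (cpow y (- s) * F s * zetaM M (2^-1 + s) ^+ 2).
pose b (t : R) : R := `|rline F 2 t| + `|iline F 2 t|.
have ib : integrableR b.
  by apply: integrableRD; apply: integrableR_norm; [exact: decays_integrable d1|exact: decays_integrable d2].
pose k := 48 * expR (- (2 * ln y)).
have k0 : 0 <= k by rewrite mulr_ge0// expR_ge0.
have pi2 : 0 < (2 * pi)^-1 :> R by rewrite invr_gt0 mulr_gt0// pi_gt0.
have hH M t : (0 < M)%N -> `|H t - h M t| <= k / M%:R * b t.
  move=> M0; rewrite /H /h/= -cReN -cReD -mulrBr.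
  apply: le_trans (Re_le_normc _) _.
  rewrite (normcM (cpow y _ * F _)) (normcM (cpow y _) (F _)).
  have s2 : 2 <= Re (2^-1 + (2 +i* t)).
    have half : (2^-1 : C) = (2^-1 : R)%:C by rewrite fmorphV rmorph_nat.
    by rewrite half cReD/= lerDr invr_ge0.
  rewrite (_ : k / M%:R * b t = expR (- (2 * ln y)) * b t * (48 / M%:R)); last by rewrite /k; ring.
  apply: ler_pM; [by apply: mulr_ge0; exact: normc_ge0|exact: normc_ge0| |exact: zeta_sq_dist].
  rewrite cpow_cexp// normc_cexp cReM cReN/= !mul0r subr0 mulrN [ln y * 2]mulrC ler_wpM2l ?expR_ge0//.
  exact: normc_le.
have sumE M : h M = fun t => \sum_(i < M) \sum_(j < M) (if (0 < i)%N && (0 < j)%N then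
     expR (- (2^-1 * (ln i%:R + ln j%:R))) else 0) * line2 F (ln i%:R + ln j%:R + ln y) t.
  by apply/funext => t; rewrite /h Re_zetaM_integrand.
have hM M : integrableR (h M) /\ intR (h M) = \sum_(i < M) \sum_(j < M) (if (0 < i)%N && (0 < j)%N then
     expR (- (2^-1 * (ln i%:R + ln j%:R))) else 0) * LM F 2 (ln i%:R + ln j%:R + ln y).
  rewrite sumE.
  have t1 (i j : 'I_M) := line2_int (ln i%:R + ln j%:R + ln y) d1 d2.
  pose co (i j : 'I_M) : R := if (0 < i)%N && (0 < j)%N then expR (- (2^-1 * (ln i%:R + ln j%:R))) else 0.
  have t2 (i : 'I_M) := @intR_sum R _ (index_enum 'I_M) (fun j t => co i j * line2 F (ln i%:R + ln j%:R + ln y) t)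
    (fun j => integrableRZ _ (t1 i j).1).
  have [t3 t4] := @intR_sum R _ (index_enum 'I_M) (fun i t => \sum_(j < M) co i j * line2 F (ln i%:R + ln j%:R + ln y) t)
    (fun i => (t2 i).1).
  split; first exact: t3.
  rewrite t4; apply: eq_bigr => i _; rewrite (t2 i).2; apply: eq_bigr => j _.
  by rewrite intRZ ?(t1 i j).2//; exact: (t1 i j).1.
(* The infinite sum in [zeta] makes measurability a limit statement: H is the pointwise limit of the
   truncated integrands. *)
have mH : measurable_fun setT H.
  apply: (measurable_fun_cvg (h := fun n => h n.+1)) => [n|t _].
    exact: integrableR_measurable (hM n.+1).1.
  apply/cvgrPdist_le => /= e e0.
  exists (Num.truncn (k * b t / e)) => // n /= hn.
  apply: le_trans (hH _ _ (ltn0Sn n)) _.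
  rewrite mulrAC ler_pdivrMr ?ltr0n// [e * _]mulrC -ler_pdivrMr//.
  by apply: ltW; apply: lt_le_trans (truncnS_gt _) _; rewrite ?ler_nat ?ltnS.
have iH : integrableR H.
  apply: (@integrableR_le _ _ (fun t => `|h 1%N t| + k * b t)) => //.
    apply: integrableRD; first exact: integrableR_norm (hM 1%N).1.
    exact: integrableRZ.
  move=> t; have b0 : 0 <= b t by rewrite addr_ge0.
  rewrite [leRHS]ger0_norm ?addr_ge0 ?mulr_ge0//.
  have := hH 1%N t isT; rewrite divr1.
  rewrite (_ : `|H t| = `|h 1%N t + (H t - h 1%N t)|); last by congr `|_|; ring.
  by move=> q; apply: le_trans (ler_normD _ _) _; rewrite lerD2l.
exists ((2 * pi)^-1 * (k * intR b)).
  apply: mulr_ge0; first exact: ltW.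
  by apply: mulr_ge0 => //; apply: Rintegral_ge0 => t _; rewrite addr_ge0.
move=> M M0.
have -> : Re (kfun F y) = (2 * pi)^-1 * intR H.
  by rewrite /kfun cReM/= mul0r subr0.
rewrite -(hM M).2 -mulrBr normrM (ger0_norm (ltW pi2)) -mulrA ler_wpM2l ?(ltW pi2)//.
rewrite -intRB//; last exact: (hM M).1.
rewrite mulrAC -intRZ//; apply: norm_intR_le.
- have := integrableRD iH (integrableRZ (-1) (hM M).1).
  by congr integrableR; apply/funext => u; rewrite mulN1r.
- exact: integrableRZ.
- by move=> t; exact: hH.
Qed.

Lemma Im_kfun F (y : R) : Im (kfun F y) = Re (kfun (fun s => (0 -i* 1) * F s) y).
Proof.
rewrite /kfun cReM cImM/= !mul0r subr0 addr0; congr (_ * _).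
apply: eq_Rintegral => t _ /=.
by case: (cpow _ _) (F _) (_ ^+ 2) => [c1 c2] [f1 f2] [z1 z2] /=; ring.
Qed.

End ZetaLine.

(** * Congruence classes *)

Section Congruences.

Definition cong_pairs (r : nat) (b : int) : set (nat * nat) :=
  [set p | [/\ (0 < p.1)%N, (0 < p.2)%N & (p.2%:Z = b * p.1%:Z %[mod r%:Z])%Z]].

Lemma modz_eq_dvd (x y d : int) : (x = y %[mod d])%Z <-> (d %| x - y)%Z.
Proof. by rewrite -eqz_mod_dvd; split => [->|/eqP]. Qed.

Lemma cong_ge (q a m n : nat) : (a * m <= n)%N ->
  (n%:Z = a%:Z * m%:Z %[mod q%:Z])%Z <-> (q %| n - a * m)%N.
Proof. by move=> h; rewrite modz_eq_dvd -PoszM subzn// dvdzE. Qed.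

Lemma cong_le (q a m n : nat) : (n <= a * m)%N ->
  (n%:Z = a%:Z * m%:Z %[mod q%:Z])%Z <-> (q %| a * m - n)%N.
Proof. by move=> h; rewrite modz_eq_dvd -PoszM -opprB rpredN subzn// dvdzE. Qed.

Lemma cong_opp (q a l n : nat) :
  (n%:Z = - q%:Z * l%:Z %[mod a%:Z])%Z <-> (a %| n + q * l)%N.
Proof. by rewrite modz_eq_dvd mulNr opprK -PoszM -PoszD dvdzE. Qed.

Definition pos_pairs : set (nat * nat) := [set p | (0 < p.1)%N && (0 < p.2)%N].

Variables (q a : nat).
Hypotheses (q0 : (0 < q)%N) (a0 : (0 < a)%N).
Let D := cong_pairs q a%:Z.
Let diag : set (nat * nat) := [set p | p.2 = (a * p.1)%N].
Let above : set (nat * nat) := [set p | (a * p.1 < p.2)%N].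

Lemma diag_bij : set_bij [set n : nat | (0 < n)%N] (D `&` diag) (fun m => (m, (a * m)%N)).
Proof.
split.
- move=> m /= m0; split => //; split => //=; first by rewrite muln_gt0 a0.
- by move=> m m' _ _ [].
- by move=> [m n] /= [[/= m0 n0 _] E]; exists m => //; rewrite -E.
Qed.

Lemma above_bij : set_bij pos_pairs ((D `&` ~` diag) `&` above)
  (fun p => (p.1, (a * p.1 + q * p.2)%N)).
Proof.
split.
- move=> [m l] /= /andP[m0 l0].
  have h : (a * m < a * m + q * l)%N by rewrite -[X in (X < _)%N]addn0 ltn_add2l muln_gt0 q0.
  split => //; split; last by move=> /= /eqP; rewrite /diag/= gtn_eqF.
  split => //=; first exact: leq_ltn_trans h.
  by apply/cong_ge; [exact: ltnW|rewrite addKn dvdn_mulr].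
- move=> [m l] [m' l'] _ _ [-> /eqP]; rewrite eqn_add2l eqn_pmul2l// => /eqP ->.
  by [].
- move=> [m n] /= [[[/= m0 n0 h] _] mn].
  have {}mn : (a * m < n)%N := mn.
  move: h => /(cong_ge _ (ltnW mn)) /dvdnP[l hl].
  have E : n = (a * m + q * l)%N by rewrite [(q * l)%N]mulnC -hl subnKC// ltnW.
  exists (m, l) => /=; last by rewrite -E.
  apply/andP; split => //=; case: l hl E => // _ E; move: mn; rewrite E muln0 addn0 ltnn.
  by [].
Qed.

(** The congruence on (l, n) says exactly that a divides n + q l, so the division giving m is
    exact. *)
Lemma below_bij : set_bij (cong_pairs a (- q%:Z)) ((D `&` ~` diag) `&` ~` above)
  (fun p => (((p.2 + q * p.1) %/ a)%N, p.2)).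
Proof.
split.
- move=> [l n] [/= l0 n0 /cong_opp h].
  have E : (a * ((n + q * l) %/ a) = n + q * l)%N by rewrite mulnC divnK.
  have lt : (n < a * ((n + q * l) %/ a))%N by rewrite E -[X in (X < _)%N]addn0 ltn_add2l muln_gt0 q0.
  split; last by rewrite /above/= => h'; have := ltn_trans lt h'; rewrite ltnn.
  split; last by rewrite /diag/= => h'; move: lt; rewrite -h' ltnn.
  split => //=; first by rewrite divn_gt0// dvdn_leq// addn_gt0 n0.
  by apply/cong_le; [exact: ltnW|rewrite E addKn dvdn_mulr].
- move=> [l n] [l' n']; rewrite !inE => -[/= _ _ /cong_opp h] [/= _ _ /cong_opp h'] [E En].
  subst n'; have : ((n + q * l) %/ a * a = (n + q * l') %/ a * a)%N by rewrite E.
  by rewrite !divnK// => /eqP; rewrite eqn_add2l eqn_pmul2l// => /eqP ->.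
- move=> [m n] /= [[[/= m0 n0 h] h1] h2].
  have nm : (n < a * m)%N.
    by rewrite ltn_neqAle; apply/andP; split; [apply/eqP|rewrite leqNgt; apply/negP].
  move: h => /(cong_le _ (ltnW nm)) /dvdnP[l hl].
  have E : (n + q * l = a * m)%N by rewrite [(q * l)%N]mulnC -hl subnKC// ltnW.
  exists (l, n) => /=; last by rewrite E mulKn.
  split => //=; last by apply/cong_opp; rewrite E dvdn_mulr.
  by case: l hl E => // _ E; move: nm; rewrite -E muln0 addn0 ltnn.
Qed.

End Congruences.

(** * Bounds for power sums and sums over pairs *)

Section SumBounds.
Variable R : realType.

(** Telescoping: n^(-1-eps) is at most ((n-1)^(-eps) - n^(-eps)) / eps for n >= 2. *)
Lemma sum_powN_le (eps : R) : 0 < eps -> exists2 Z : R, 0 <= Z & forall M,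
  \sum_(i < M) (if (0 < i)%N then expR (- ((1 + eps) * ln i%:R)) else 0) <= Z.
Proof.
move=> e0; exists (1 + eps^-1); first by rewrite addr_ge0 ?invr_ge0// ltW.
have step (M : nat) : \sum_(i < M.+2) (if (0 < i)%N then expR (- ((1 + eps) * ln i%:R)) else 0)
    <= 1 + eps^-1 * (1 - expR (- (eps * ln M.+1%:R))).
  elim: M => [|M ih].
    by rewrite !big_ord_recl big_ord0/= ln1 !mulr0 oppr0 expR0 subrr mulr0 add0r.
  rewrite big_ord_recr/=; apply: le_trans (lerD ih (lexx _)) _.
  have p1 : 0 < M.+1%:R :> R by []. have p2 : 0 < M.+2%:R :> R by [].
  set x := ln M.+1%:R; set y := ln M.+2%:R.
  have d : M.+2%:R^-1 <= y - x.
    have := @ln_lower R (M.+2%:R / M.+1%:R) (divr_gt0 p2 p1).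
    rewrite ln_div ?posrE// invf_div; apply: le_trans.
    rewrite -[X in 1 - X / _]/(M.+1%:R) -[M.+2%:R]natr1 -natr1.
    set z : R := M%:R; have z0 : 0 <= z by exact: ler0n.
    have zn : z + 1 + 1 != 0 by rewrite lt0r_neq0//; lra.
    by rewrite le_eqVlt; apply/orP; left; apply/eqP; field.
  have E1 : expR (- ((1 + eps) * y)) = expR (- (eps * y)) * M.+2%:R^-1.
    by rewrite mulrDl mul1r opprD addrC expRD [expR (- y)]expRN lnK.
  have E2 : expR (- (eps * x)) = expR (- (eps * y)) * expR (eps * (y - x)).
    by rewrite -expRD; congr expR; ring.
  have E3 : 1 + eps * M.+2%:R^-1 <= expR (eps * (y - x)).
    by apply: le_trans (expR_ge1Dx _); rewrite lerD2l ler_wpM2l// ltW.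
  rewrite E1 E2; move: E3; set w := M.+2%:R^-1; set u := expR (- (eps * y)); set v := expR (eps * _) => E3.
  have u0 : 0 <= u by exact: expR_ge0.
  have ei : eps^-1 * eps = 1 by rewrite mulVf ?lt0r_neq0.
  have : eps^-1 * (u * (1 + eps * w)) <= eps^-1 * (u * v) by rewrite ler_wpM2l ?invr_ge0 ?(ltW e0)// ler_wpM2l.
  rewrite (_ : eps^-1 * (u * (1 + eps * w)) = eps^-1 * u + eps^-1 * eps * (u * w)); last by ring.
  rewrite ei mul1r !mulrDr !mulrN; lra.
case=> [|[|M]].
- by rewrite big_ord0 addr_ge0 ?invr_ge0// ltW.
- by rewrite big_ord1/= addr_ge0 ?invr_ge0// ltW.
apply: le_trans (step M) _; rewrite lerD2l ler_piMr ?invr_ge0 ?(ltW e0)// gerBl expR_ge0.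
Qed.

Lemma sum_inv_sq_le0 M : \sum_(i < M) (if (0 < i)%N then (i%:R ^+ 2)^-1 else 0) <= 2 :> R.
Proof.
case: M => [|M]; first by rewrite big_ord0.
by rewrite big_ord_recl/= add0r; exact: sum_inv_sq_le.
Qed.

Lemma sum_inj_le (P : pred nat) (h : nat -> nat) (be : nat -> R) M :
  {in P &, injective h} -> (forall j, (h j <= j)%N) -> (forall j, 0 <= be j) ->
  \sum_(j < M | P j) be (h j) <= \sum_(j < M) be j.
Proof.
move=> inj hj be0.
rewrite -(big_mkord P (fun j => be (h j))) -(big_mkord xpredT be) -big_filter -(big_map h xpredT be).
set s := map h _; set t := index_iota 0 M.
have us : uniq s.
  rewrite map_inj_in_uniq ?filter_uniq ?iota_uniq// => x y.
  by rewrite !mem_filter => /andP[Px _] /andP[Py _]; exact: inj.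
have st : {subset s <= t}.
  move=> _ /mapP[j + ->]; rewrite mem_filter !mem_index_iota/= => /andP[_].
  exact: leq_ltn_trans.
rewrite [leRHS](bigID (mem s))/= -[X in _ <= X + _]big_filter.
rewrite (perm_big s (r1 := [seq i <- t | i \in s]))/=; last first.
  apply: uniq_perm => //; first by rewrite filter_uniq ?iota_uniq.
  by move=> x; rewrite mem_filter andb_idr// => /st.
by rewrite lerDl sumr_ge0.
Qed.

(** In each row i the column j is renamed h i j. Injectivity on D and h i j <= j keep the renamed
    columns distinct and inside the square, so thin rows of D are counted once per value of h. *)
Lemma sum_square_inj_le (D : set (nat * nat)) (w : nat * nat -> R) (h : nat -> nat -> nat)
    (al be : nat -> R) (Ka Kb : R) M :
  (forall i, 0 <= al i) -> (forall i, 0 <= be i) ->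
  (forall i j j', (i, j) \in D -> (i, j') \in D -> h i j = h i j' -> j = j') ->
  (forall i j, (h i j <= j)%N) ->
  (forall i j, (i, j) \in D -> w (i, j) <= al i * be (h i j)) ->
  \sum_(i < M) al i <= Ka -> \sum_(j < M) be j <= Kb ->
  \sum_(x <- square M | x \in D) w x <= Ka * Kb.
Proof.
move=> al0 be0 inj hj hw hA hB; rewrite sum_square.
apply: (@le_trans _ _ ((\sum_(i < M) al i) * (\sum_(j < M) be j))); last first.
  by apply: ler_pM => //; apply: sumr_ge0.
rewrite mulr_suml; apply: ler_sum => i _; rewrite -big_mkcond/=.
apply: (@le_trans _ _ (\sum_(j < M | (i : nat, j : nat) \in D) al i * be (h i j))).
  by apply: ler_sum => j; exact: hw.
rewrite -mulr_sumr ler_wpM2l//.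
apply: (@sum_inj_le (fun j => (i : nat, j) \in D) (h i)) => // j j'; exact: inj.
Qed.

End SumBounds.

(** * The three ranges of the sum *)

Section Reciprocity.
Variable R : realType.
Variables (f1 : R -> R) (m1 m0 : R) (kap : nat -> R -> R).
Hypothesis fd : flat_data f1 m1 m0 kap.

Let df1 (u : R) : is_derive u 1 (fun u => f1 (expR u)) (- kap 0%N u).
Proof. by case: fd => h _ _ _ _; exact: h. Qed.
Let kapK j (p : R) : exists2 K : R, 0 <= K & forall u, `|kap j u| <= K * expR (p * u).
Proof. by case: fd => _ _ h _ _; exact: h. Qed.
Let f1K (c : R) : 0 < c -> exists2 K : R, 0 <= K & forall u, `|f1 (expR u)| <= K * expR (- (c * u)).
Proof. by case: fd => _ _ _ h _; exact: h. Qed.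

(* x^(-1/2) f(x / X) at x = e^v, X = e^xi. *)
Definition wt (xi v : R) : R := expR (- (2^-1 * v)) * f1 (expR (v - xi)).

Lemma wt_bound (xi B : R) : 0 < B -> exists2 K : R, 0 <= K & forall v,
  `|wt xi v| <= K * expR (- ((B + 2^-1) * v)).
Proof.
move=> B0; have [K K0 hK] := f1K B0; exists (K * expR (B * xi)); first by rewrite mulr_ge0 ?expR_ge0.
move=> v; rewrite /wt normrM ger0_norm ?expR_ge0//.
apply: le_trans (ler_wpM2l (expR_ge0 _) (hK _)) _.
by rewrite mulrCA -mulrA -!expRD ler_wpM2l// ler_expR; lra.
Qed.

(** The mean value theorem gives w - v times a bound for the derivative. It is weakened to exp(w -
    v) - 1 because exp(w - v) is the factor 1 + a m / (q l) or 1 + n / (q l) being dropped. B is the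
    decay rate of f and x f'(x), left free. *)
Lemma wt_diff (B : R) : 0 < B -> exists2 K : R, 0 <= K & forall xi v w, v <= w ->
  `|wt xi w - wt xi v| <= K * expR (B * xi - (B + 2^-1) * v) * (expR (w - v) - 1).
Proof.
move=> B0; have [K1 K10 h1] := f1K B0; have [K2 K20 h2] := kapK 0%N (- B).
exists (K1 + K2); first exact: addr_ge0.
move=> xi v w vw.
have dw (t : R) : is_derive t 1 (wt xi)
    (- 2^-1 * expR (- 2^-1 * t) * f1 (expR (t - xi)) + expR (- 2^-1 * t) * (- kap 0%N (t - xi) * (1 - 0))).
  rewrite (_ : wt xi = fun t => expR (- 2^-1 * t) * f1 (expR (t - xi))); last first.
    by apply/funext => x; rewrite /wt mulNr.
  have dl : is_derive t 1 (fun t : R => t - xi) (1 - 0) by exact: dB (is_derive_id _ _) (dcst _ _).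
  by apply: is_derive_eq (dM (exp_lin_derive (- 2^-1) t) (dcomp (df1 _) dl)) _; ring.
set Q := (K1 + K2) * expR (B * xi - (B + 2^-1) * v).
have Q0 : 0 <= Q by rewrite mulr_ge0 ?expR_ge0// addr_ge0.
apply: (@le_trans _ _ (Q * (w - v) - Q * (v - v))).
  apply: (@mvt_compare R (wt xi) (fun t => Q * (t - v)) _ (fun=> Q) v w vw (fun t _ => dw t)
    (fun t _ => dlin Q v t)) => t /andP[vt tw].
  rewrite subr0 mulr1 (_ : _ + _ = expR (- 2^-1 * t) * (- 2^-1 * f1 (expR (t - xi)) - kap 0%N (t - xi))); last by ring.
  rewrite normrM ger0_norm ?expR_ge0//.
  apply: (@le_trans _ _ (expR (- 2^-1 * t) * ((K1 + K2) * expR (- (B * (t - xi)))))).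
    rewrite ler_wpM2l ?expR_ge0//; apply: le_trans (ler_normB _ _) _; rewrite mulrDl; apply: lerD.
      apply: le_trans (h1 _); rewrite normrM normrN [`|2^-1|]ger0_norm ?invr_ge0//.
      by rewrite ler_piMl// invf_le1// ler1n.
    by rewrite -mulNr; exact: h2.
  rewrite mulrCA -expRD /Q ler_wpM2l ?addr_ge0// ler_expR.
  have : 0 <= (B + 2^-1) * (t - v) by rewrite mulr_ge0 ?subr_ge0//; lra.
  lra.
rewrite subrr mulr0 subr0 ler_wpM2l//.
have := expR_ge1Dx (w - v); lra.
Qed.

Lemma wt_summable (xi g : R) D : D `<=` pos_pairs ->
  abs_summable D (fun p : nat * nat => wt xi (ln p.1%:R + ln p.2%:R + g)).
Proof.
move=> Dp; have [K K0 hK] := @wt_bound xi (3 / 2) (ltac:(by rewrite divr_gt0)).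
pose c i : R := if (0 < i)%N then (i%:R ^+ 2)^-1 else 0.
have c0 i : 0 <= c i by rewrite /c; case: ifP => // _; rewrite invr_ge0 sqr_ge0.
pose L := K * expR (- (2 * g)).
have L0 : 0 <= L by rewrite mulr_ge0 ?expR_ge0.
apply: (abs_summable_bound (K := L * 2 * 2) exhausts_square) => M.
apply: (@sum_square_le _ _ _ (fun i => L * c i) c) => //.
- by move=> i; rewrite mulr_ge0.
- move=> i j; rewrite in_setE => /Dp /andP[/= i0 j0].
  apply: le_trans (hK _) _; rewrite /c i0 j0 -!expR2ln ?ltr0n// -!expRN /L -!mulrA -!expRD.
  by rewrite ler_wpM2l// ler_expR; lra.
- by rewrite -mulr_sumr ler_wpM2l// sum_inv_sq_le0.
- exact: sum_inv_sq_le0.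
Qed.

Variables (A eps : R).
Hypotheses (A0 : 0 < A) (eps0 : 0 < eps).

(** Partial sums of k(q / X), which is the sum of (i j)^(-1/2) f(i j q / X), at X = exp xi. *)
Definition k_sum (xi : R) (q M : nat) : R :=
  \sum_(i < M) \sum_(j < M) (if (0 < i)%N && (0 < j)%N then
     expR (- (2^-1 * (ln i%:R + ln j%:R))) * f1 (expR (ln i%:R + ln j%:R + (ln q%:R - xi))) else 0).

Lemma diag_sum : exists2 K : R, 0 <= K & forall (a : nat) (xi : R), (0 < a)%N ->
  `|rsum [set n : nat | (0 < n)%N] (fun m => wt xi (ln m%:R + ln (a * m)%:R))
     - expR (- (2^-1 * ln a%:R)) * (m1 / 2 * (xi - ln a%:R) + m0 / 2 + euler_gamma * m1)|
  <= K * (expR (- (2^-1 * ln a%:R)) * expR (- (A * (xi - ln a%:R)))).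
Proof.
have [K K0 hK] := main_term fd A0; exists K => // a xi a0.
have ap : 0 < a%:R :> R by rewrite ltr0n.
have la : 0 <= ln a%:R :> R by rewrite ln_ge0// ler1n.
set al := ln a%:R in la *; set E := expR (- (2^-1 * al)).
have E1 : E <= 1 by rewrite -expR0 ler_expR oppr_le0 mulr_ge0.
have E0 : 0 <= E by exact: expR_ge0.
apply: (rsum_dist exhausts_iota).
  have [K' K'0 hK'] := @wt_bound xi 2^-1 (ltac:(by rewrite invr_gt0)).
  apply: (abs_summable_bound (K := K' * 2) exhausts_iota) => M; rewrite sum_iota.
  apply: (@le_trans _ _ (\sum_(j < M) K' * (if (0 < j)%N then (j%:R ^+ 2)^-1 else 0))).
    apply: ler_sum => j _; rewrite mem_setb; case: ifP => [j0|]; last by rewrite mulr0.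
    have jp : 0 < j%:R :> R by rewrite ltr0n.
    apply: le_trans (hK' _) _; rewrite ler_wpM2l// -expR2ln// -expRN ler_expR.
    by rewrite natrM lnM ?posrE// -/al; lra.
  by rewrite -mulr_sumr ler_wpM2l// sum_inv_sq_le0.
move=> e e0; have [M0 h] := hK (xi - al) e e0; exists M0 => M MM; rewrite sum_iota.
rewrite (_ : \sum_(j < M) _ = E * Tsum f1 M (xi - al)); last first.
  rewrite mulr_sumr; apply: eq_bigr => j _; rewrite mem_setb; case: ifP => [j0|]; last by rewrite mulr0.
  have jp : 0 < j%:R :> R by rewrite ltr0n.
  rewrite /wt natrM lnM ?posrE// -/al (_ : ln j%:R + (al + ln j%:R) - xi = 2 * ln j%:R - (xi - al)); last by ring.
  rewrite mulrA; congr (_ * _); rewrite -[X in _ = _ * X^-1](lnK jp) /E -expRN -expRD; congr expR.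
  by field.
rewrite -mulrBr !opprD !addrA normrM (ger0_norm E0).
apply: le_trans (ler_wpM2l E0 (h M MM)) _; rewrite mulrDr mulrCA; apply: lerD => //.
by rewrite ler_piMl// ltW.
Qed.

(** The relative error a m / (q l) raises the exponent of m by 1, so [wt_diff] leaves m^(1/2 - B).
    The choice B = 3/2 + eps makes this m^(-1-eps); the same B gives l^(-3-eps), X^(3/2+eps) and a
    q^(-3-eps). *)
Lemma above_sum : exists2 K : R, 0 <= K & forall (q a : nat) (xi kk : R), (0 < a)%N -> (0 < q)%N ->
  abs_summable pos_pairs (fun p : nat * nat => wt xi (ln p.1%:R + ln (a * p.1 + q * p.2)%:R)) ->
  (forall e : R, 0 < e -> exists M0, forall M, (M0 <= M)%N -> `|kk - k_sum xi q M| <= e) ->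
  `|rsum pos_pairs (fun p : nat * nat => wt xi (ln p.1%:R + ln (a * p.1 + q * p.2)%:R))
     - expR (- (2^-1 * ln q%:R)) * kk|
  <= K * expR (ln a%:R + (3 / 2 + eps) * xi - (3 + eps) * ln q%:R).
Proof.
have B0 : 0 < 3 / 2 + eps by rewrite addr_gt0// divr_gt0.
have [K K0 hK] := wt_diff B0; have [Z Z0 hZ] := sum_powN_le eps0.
exists (K * Z * 2); first by rewrite !mulr_ge0.
move=> q a xi kk a0 q0 su hkk.
have ap : 0 < a%:R :> R by rewrite ltr0n. have qp : 0 < q%:R :> R by rewrite ltr0n.
set al := ln a%:R; set ka := ln q%:R.
set E := expR (- (2^-1 * ka)); have E0 : 0 < E by exact: expR_gt0.
set P := expR (al + _ - _); have P0 : 0 <= P by exact: expR_ge0.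
have ka0 : 0 <= ka by rewrite ln_ge0// ler1n.
have E1 : E <= 1 by rewrite -expR0 ler_expR oppr_le0 mulr_ge0.
apply: (rsum_dist exhausts_square su) => e e0.
have [M0 h] := hkk e e0; exists M0 => M MM.
have kE : E * k_sum xi q M = \sum_(x <- square M | x \in pos_pairs) wt xi (ln x.1%:R + ln x.2%:R + ka).
  rewrite sum_square mulr_sumr; apply: eq_bigr => i _; rewrite mulr_sumr; apply: eq_bigr => j _.
  rewrite mem_setb/=; case: ifP => _; last by rewrite mulr0.
  rewrite mulrA -expRD /wt -/ka -addrA; congr (expR _ * f1 (expR _)); ring.
rewrite -(subrKA (E * k_sum xi q M)) {1}kE -sumrB.
apply: le_trans (ler_normD _ _) _; apply: lerD; last first.
  rewrite -mulrBr normrM (gtr0_norm E0) distrC; apply: le_trans (ler_wpM2l (ltW E0) (h M MM)) _.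
  by rewrite ler_piMl// ltW.
apply: le_trans (ler_norm_sum _ _ _) _.
rewrite (_ : K * Z * 2 * P = (K * P * Z) * 2); last by ring.
pose c (i : nat) : R := if (0 < i)%N then (i%:R ^+ 2)^-1 else 0.
have c0 i : 0 <= c i by rewrite /c; case: ifP => // _; rewrite invr_ge0 sqr_ge0.
pose d (i : nat) : R := if (0 < i)%N then expR (- ((1 + eps) * ln i%:R)) else 0.
have d0 i : 0 <= d i by rewrite /d; case: ifP => // _; rewrite expR_ge0.
have KP : 0 <= K * P by rewrite mulr_ge0.
apply: (@sum_square_le _ _ _ (fun i => K * P * d i) c) => //.
- by move=> i; rewrite mulr_ge0.
- move=> m l; rewrite mem_setb/= => /andP[mp lp].
  have mp' : 0 < m%:R :> R by rewrite ltr0n. have lp' : 0 < l%:R :> R by rewrite ltr0n.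
  rewrite natrD !natrM.
  set x := ln m%:R; set y := ln l%:R.
  (* In multiplicative notation: (a m + q l) / (q l) - 1 = a m / (q l). *)
  have wE : expR (x + ln (a%:R * m%:R + q%:R * l%:R) - (x + y + ka)) - 1 = expR (al + x - ka - y).
    rewrite (_ : x + _ - _ = ln (a%:R * m%:R + q%:R * l%:R) - (ka + y)); last by ring.
    rewrite (_ : al + x - ka - y = (al + x) - (ka + y)); last by ring.
    rewrite /al /x /ka /y -!lnM ?posrE// ![expR (_ - _)]expRD !expRN !lnK ?posrE ?addr_gt0 ?mulr_gt0//.
    by field; rewrite !lt0r_neq0.
  have vw : x + y + ka <= x + ln (a%:R * m%:R + q%:R * l%:R).
    by rewrite -subr_ge0 -ler_expR expR0 -subr_ge0 wE expR_ge0.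
  apply: le_trans (hK xi _ _ vw) _; rewrite wE /d /c mp lp -expR2ln// -expRN /P -/y.
  rewrite -!mulrA -!expRD ler_wpM2l// ler_expR -/x.
  have y0 : 0 <= y by rewrite ln_ge0// ler1n.
  have := mulr_ge0 (ltW eps0) y0; lra.
- by rewrite -mulr_sumr ler_wpM2l// hZ.
- exact: sum_inv_sq_le0.
Qed.

(* A pair (l, n) is indexed by l and j = (n - 1) / a, which determine it; the
   terms with j = 0 need the weaker exponent B = 1/2. *)
Lemma below_sum : exists2 K : R, 0 <= K & forall (q a : nat) (xi : R), (0 < a)%N -> (0 < q)%N ->
  let D := cong_pairs a (- q%:Z) in
  let u := fun p : nat * nat => wt xi (ln ((p.2 + q * p.1) %/ a)%:R + ln p.2%:R) in
  abs_summable D u ->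
  `|rsum D u - rsum D (fun p : nat * nat => wt xi (ln p.1%:R + ln p.2%:R + (ln q%:R - ln a%:R)))|
  <= K * (expR (ln a%:R + 2^-1 * xi - 2 * ln q%:R)
          + expR (ln a%:R + (3 / 2 + eps) * xi - (3 + eps) * ln q%:R)).
Proof.
have B0 : 0 < 3 / 2 + eps by rewrite addr_gt0// divr_gt0.
have [K K0 hK] := wt_diff B0; have [Z Z0 hZ] := sum_powN_le eps0.
(* With B = 1/2 the powers of n cancel exactly and a X^(1/2) q^(-2) l^(-2) remains. With B = 3/2 +
   eps a factor n^(-1-eps) remains, and n >= a j turns it into (a j)^(-1-eps). *)
have [K1 K10 hK1] := @wt_diff 2^-1 (ltac:(by rewrite invr_gt0)).
exists (2 * (K1 + K * Z)); first by rewrite !(mulr_ge0, addr_ge0).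
move=> q a xi a0 q0 D u su.
have ap : 0 < a%:R :> R by rewrite ltr0n. have qp : 0 < q%:R :> R by rewrite ltr0n.
set al := ln a%:R; set ka := ln q%:R; set v := fun p : nat * nat => _.
have Dpos : D `<=` pos_pairs by move=> [i j] [/= ? ? _]; apply/andP.
have sv : abs_summable D v by exact: wt_summable.
apply: (rsum_dist exhausts_square su) => e e0.
have [M0 h] := rsum_lim exhausts_square sv e0; exists M0 => M MM.
rewrite -(subrKA (\sum_(x <- square M | x \in D) v x)) -sumrB.
apply: le_trans (ler_normD _ _) _; apply: lerD; last by rewrite distrC h.
apply: le_trans (ler_norm_sum _ _ _) _.
set P2 := expR (al + 2^-1 * _ - _); set P := expR (al + _ - _).
have P0 : 0 <= P by exact: expR_ge0. have P20 : 0 <= P2 by exact: expR_ge0.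
apply: (@le_trans _ _ (2 * (K1 * P2 + K * P * Z))); last first.
  rewrite -[leRHS]mulrA ler_wpM2l//.
  have := mulr_ge0 K10 P0; have := mulr_ge0 (mulr_ge0 K0 Z0) P20; lra.
pose c (i : nat) : R := if (0 < i)%N then (i%:R ^+ 2)^-1 else 0.
have c0 i : 0 <= c i by rewrite /c; case: ifP => // _; rewrite invr_ge0 sqr_ge0.
pose d (i : nat) : R := if (0 < i)%N then K * P * expR (- ((1 + eps) * ln i%:R)) else K1 * P2.
have d0 i : 0 <= d i by rewrite /d; case: ifP => _; rewrite !mulr_ge0 ?expR_ge0.
apply: (@sum_square_inj_le _ _ _ (fun _ n => (n.-1 %/ a)%N) c d) => //.
(* For given l the congruence fixes n, hence n - 1, modulo a; the quotient (n - 1) / a then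
   determines n. *)
- move=> l n n'; rewrite !in_setE => -[/= l0 n0 /cong_opp h1] [/= _ n0' /cong_opp h2] E.
  have M1 : (n + q * l = n' + q * l %[mod a])%N by rewrite (eqP h1) (eqP h2).
  have {}M1 : (n = n' %[mod a])%N by apply/eqP; rewrite -(eqn_modDr (q * l)); apply/eqP.
  have M2 : (n.-1 = n'.-1 %[mod a])%N.
    by apply/eqP; rewrite -(eqn_modDr 1) !addn1 !prednK//; apply/eqP.
  by rewrite -(prednK n0) -(prednK n0') (divn_eq n.-1 a) (divn_eq n'.-1 a) E M2.
- by move=> _ n; apply: leq_trans (leq_div _ _) (leq_pred _).
- move=> l n; rewrite in_setE => -[/= l0 n0 /cong_opp hd].
  have lp : 0 < l%:R :> R by rewrite ltr0n. have np : 0 < n%:R :> R by rewrite ltr0n.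
  have mE : ln ((n + q * l) %/ a)%:R = ln (n%:R + q%:R * l%:R) - al :> R.
    rewrite -[in RHS]natrM -natrD -{2}(divnK hd) natrM lnM ?posrE ?ltr0n//; first by rewrite -/al; ring.
    by rewrite divn_gt0// dvdn_leq// addn_gt0 n0.
  rewrite /u /v/= mE -/al -/ka; set x := ln l%:R; set y := ln n%:R.
  set s := ln (n%:R + _).
  have wE : expR (s - al + y - (x + y + (ka - al))) - 1 = expR (y - ka - x).
    rewrite (_ : s - al + _ - _ = s - (ka + x)); last by ring.
    rewrite (_ : y - ka - x = y - (ka + x)); last by ring.
    rewrite /s /x /ka /y -lnM ?posrE// ![expR (_ - _)]expRD !expRN !lnK ?posrE ?addr_gt0 ?mulr_gt0//.
    by field; rewrite !lt0r_neq0.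
  have vw : x + y + (ka - al) <= s - al + y.
    by rewrite -subr_ge0 -ler_expR expR0 -subr_ge0 wE expR_ge0.
  have x0 : 0 <= x by rewrite ln_ge0// ler1n.
  rewrite /c /d l0 -expR2ln// -expRN -/x; case: ifPn => [j0|_].
    apply: le_trans (hK xi _ _ vw) _; rewrite wE -mulrA -expRD mulrCA -!mulrA ler_wpM2l// -!expRD ler_expR.
    have jp : 0 < (n.-1 %/ a)%:R :> R by rewrite ltr0n.
    have jn : ln (n.-1 %/ a)%:R + al <= y.
      rewrite -lnM ?posrE// -natrM; rewrite ler_ln ?posrE ?ltr0n ?muln_gt0 ?j0// ler_nat.
      exact: leq_trans (leq_divM _ _) (leq_pred _).
    have := mulr_ge0 (ltW eps0) x0.
    have : 0 <= (1 + eps) * (y - (ln (n.-1 %/ a)%:R + al)).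
      by rewrite mulr_ge0 ?subr_ge0// addr_ge0// ltW.
    lra.
  apply: le_trans (hK1 xi _ _ vw) _; rewrite wE -mulrA -expRD mulrCA ler_wpM2l// -!expRD ler_expR; lra.
- exact: sum_inv_sq_le0.
case: M {MM} => [|M]; first by rewrite big_ord0 addr_ge0// !mulr_ge0.
rewrite big_ord_recl {1}/d/= lerD2l.
have := hZ M.+1; rewrite big_ord_recl/= add0r => hZ'.
apply: le_trans (ler_wpM2l (mulr_ge0 K0 P0) hZ'); rewrite mulr_sumr.
by apply: ler_sum => j _; rewrite /d.
Qed.

End Reciprocity.

(** * The reciprocity formula for real-valued functions *)

Section RealReciprocity.
Variable R : realType.

Lemma rsumZ (T : choiceType) (E : nat -> seq T) (D : set T) (u : T -> R) (k : R) : exhausts E ->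
  abs_summable D u -> abs_summable D (fun x => k * u x) -> rsum D (fun x => k * u x) = k * rsum D u.
Proof.
move=> eE su sk; apply/eqP; rewrite -subr_eq0 -normr_le0; apply: (rsum_dist eE sk) => e e0.
have k0 : 0 < `|k| + 1 by rewrite ltr_wpDl.
have [M0 h] := rsum_lim eE su (divr_gt0 e0 k0); exists M0 => M MM.
rewrite -mulr_sumr -mulrBr normrM distrC add0r.
apply: le_trans (ler_wpM2l (normr_ge0 k) (h M MM)) _.
by rewrite mulrCA ler_piMr ?(ltW e0)// ler_pdivrMr// mul1r lerDl.
Qed.

Lemma sqrt_expR_ln (x : R) : 0 < x -> Num.sqrt x = expR (2^-1 * ln x).
Proof.
move=> x0; rewrite -[in LHS](lnK x0) (_ : ln x = 2 * (2^-1 * ln x)); last by field.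
by rewrite expRM_natl sqrtr_sqr ger0_norm ?expR_ge0// mulrA mulVf ?mul1r.
Qed.

Lemma powR_expR (x y : R) : 0 < x -> x `^ y = expR (y * ln x).
Proof. by move=> x0; rewrite /powR gt_eqF. Qed.

Variables (f1 : R -> R) (m1 m0 : R) (kap : nat -> R -> R).
Hypothesis fd : flat_data f1 m1 m0 kap.

Definition weight (X : R) (p : nat * nat) : R :=
  (Num.sqrt (p.1%:R * p.2%:R))^-1 * f1 (p.1%:R * p.2%:R / X).

Lemma weightE (X : R) p : 0 < X -> pos_pairs p ->
  weight X p = wt f1 (ln X) (ln p.1%:R + ln p.2%:R).
Proof.
case: p => i j X0 /andP[/= i0 j0].
have ip : 0 < i%:R :> R by rewrite ltr0n. have jp : 0 < j%:R :> R by rewrite ltr0n.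
rewrite /weight/= /wt -lnM ?posrE// sqrt_expR_ln ?mulr_gt0// -expRN expRD [expR (- ln X)]expRN !lnK//.
by rewrite posrE mulr_gt0.
Qed.

(** The value of k enters only as a number [kk] approximated by [k_sum], so that the same statement
    applies to the real and to the imaginary part of k. *)
Lemma reciprocity_real (A eps : R) : 0 < A -> 0 < eps ->
  exists2 K : R, 0 <= K & forall (q a : nat) (X kk : R), (0 < a < q)%N -> 1 <= X ->
  (forall e : R, 0 < e -> exists M0, forall M, (M0 <= M)%N -> `|kk - k_sum f1 (ln X) q M| <= e) ->
  `|rsum (cong_pairs q a%:Z) (weight X)
     - (Num.sqrt (a%:R / q%:R) * rsum (cong_pairs a (- q%:Z)) (weight (a%:R * X / q%:R))
        + (a%:R : R) `^ (- 2^-1) * (m1 / 2 * ln (X / a%:R) + m0 / 2 + euler_gamma * m1)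
        + (q%:R : R) `^ (- 2^-1) * kk)|
  <= K * ((a%:R : R) `^ (- 2^-1) * (X / a%:R) `^ (- A)
          + (q%:R : R) `^ (- 2^-1) * (a%:R / q%:R) * (X / q%:R) `^ 2^-1
            * (1 + X / q%:R) * (q%:R * X) `^ eps).
Proof.
move=> A0 eps0.
have [K1 K10 h1] := diag_sum fd A0.
have [K2 K20 h2] := above_sum fd eps0.
have [K3 K30 h3] := below_sum fd eps0.
exists (K1 + K2 + 2 * K3); first by rewrite !(addr_ge0, mulr_ge0).
move=> q a X kk /andP[a0 aq] X1 hk.
have q0 : (0 < q)%N by exact: ltn_trans aq.
have ap : 0 < a%:R :> R by rewrite ltr0n. have qp : 0 < q%:R :> R by rewrite ltr0n.
have Xp : 0 < X by exact: lt_le_trans X1.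
set D := cong_pairs q a%:Z; set D' := cong_pairs a (- q%:Z).
pose diag : set (nat * nat) := [set p | p.2 = (a * p.1)%N].
pose above : set (nat * nat) := [set p | (a * p.1 < p.2)%N].
have Dpos : D `<=` pos_pairs by move=> [i j] [/= ? ? _]; apply/andP.
have D'pos : D' `<=` pos_pairs by move=> [i j] [/= ? ? _]; apply/andP.
pose u (p : nat * nat) := wt f1 (ln X) (ln p.1%:R + ln p.2%:R).
have su : abs_summable D u.
  by have := @wt_summable R f1 m1 m0 kap fd (ln X) 0 D Dpos; under eq_fun do rewrite addr0.
rewrite (@eq_rsum _ _ D _ u); last by move=> p /Dpos; exact: weightE.
have s1 : abs_summable (D `&` diag) u by apply: abs_summableS su => p [].
have s2 : abs_summable (D `&` ~` diag) u by apply: abs_summableS su => p [].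
have s3 : abs_summable ((D `&` ~` diag) `&` above) u by apply: abs_summableS s2 => p [].
have s4 : abs_summable ((D `&` ~` diag) `&` ~` above) u by apply: abs_summableS s2 => p [].
rewrite (rsumID diag su) (rsumID above s2).
rewrite (rsum_reindex u (diag_bij q a0)) (rsum_reindex u (above_bij a q0))
  (rsum_reindex u (below_bij q0 a0)).
have s3' := abs_summable_reindex (above_bij a q0) s3.
have s4' := abs_summable_reindex (below_bij q0 a0) s4.
pose v (p : nat * nat) := wt f1 (ln X) (ln p.1%:R + ln p.2%:R + (ln q%:R - ln a%:R)).
have X'p : 0 < a%:R * X / q%:R by rewrite divr_gt0// mulr_gt0.
have lX' : ln (a%:R * X / q%:R) = ln a%:R + ln X - ln q%:R by rewrite ln_div ?posrE ?mulr_gt0// lnM ?posrE.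
have sq : Num.sqrt (a%:R / q%:R : R) = expR (2^-1 * (ln a%:R - ln q%:R)).
  by rewrite sqrt_expR_ln ?divr_gt0// ln_div ?posrE.
(* The factor sqrt(a / q) is what turns the weight (n l)^(-1/2) into (n l q / a)^(-1/2), so the dual
   sum at a X / q is the sum of [wt] at n l q / a with the original X. *)
have ES2 : Num.sqrt (a%:R / q%:R) * rsum D' (weight (a%:R * X / q%:R)) = rsum D' v.
  pose w (p : nat * nat) := wt f1 (ln (a%:R * X / q%:R)) (ln p.1%:R + ln p.2%:R).
  have kw p : Num.sqrt (a%:R / q%:R) * w p = v p.
    rewrite sq /w /v /wt lX' mulrA -expRD; congr (expR _ * f1 (expR _)); ring.
  have sw : abs_summable D' w.
    by have := @wt_summable R f1 m1 m0 kap fd (ln (a%:R * X / q%:R)) 0 D' D'pos; under eq_fun do rewrite addr0.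
  have sv : abs_summable D' (fun p => Num.sqrt (a%:R / q%:R) * w p).
    by rewrite (_ : (fun p => _) = v); [exact: (wt_summable fd)|apply/funext].
  rewrite (@eq_rsum _ _ D' _ w); last by move=> p /D'pos; exact: weightE.
  by rewrite -(rsumZ exhausts_square sw sv); apply: eq_rsum.
rewrite ES2 !powR_expR ?divr_gt0 ?mulr_gt0// ln_div ?posrE// ln_div ?posrE// lnM ?posrE//.
have {}h1 := h1 a (ln X) a0.
have {}h2 := h2 q a (ln X) kk a0 q0 s3' hk.
have {}h3 := h3 q a (ln X) a0 q0 s4'.
move: h1 h2 h3; rewrite -/D' -/v.
set al := ln a%:R; set ka := ln q%:R; set xi := ln X.
set r1 := rsum _ _; set r2 := rsum _ _; set r3 := rsum _ _; set r4 := rsum _ _.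
rewrite !mulNr; set mt := expR _ * (_ + _ + _); set kt := expR _ * kk.
set E0 := expR _ * expR _; set P2 := expR (al + 2^-1 * xi - _); set P := expR (al + (_ + _) * xi - _).
move=> h1 h2 h3.
have xi0 : 0 <= xi by rewrite ln_ge0.
have ka0 : 0 <= ka by rewrite ln_ge0// ler1n.
set E1 := (_ * _ * _ * _ * _).
have XE : X / q%:R = expR (xi - ka) by rewrite expRD expRN !lnK ?posrE.
have aE : a%:R / q%:R = expR (al - ka) by rewrite expRD expRN !lnK ?posrE.
have E1E : E1 = expR (al + 2^-1 * xi - 2 * ka + eps * (ka + xi)) + expR (al + 3 / 2 * xi - 3 * ka + eps * (ka + xi)).
  rewrite /E1 XE aE -!expRD mulrDr mulr1 mulrDl -!expRD; congr (expR _ + expR _); lra.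
(* [P2] and [P] are the two summands of the error from 1 + X / q, apart from the eps-powers; (q
   X)^eps dominates these since q >= 1 and X >= 1. *)
have PP : P2 <= E1 /\ P <= E1.
  have e1 := mulr_ge0 (ltW eps0) xi0; have e2 := mulr_ge0 (ltW eps0) ka0.
  rewrite E1E; split.
    by apply: ler_wpDr; rewrite ?expR_ge0// ler_expR; lra.
  by apply: ler_wpDl; rewrite ?expR_ge0// ler_expR; lra.
case: PP => PP2 PP.
have E00 : 0 <= E0 by rewrite mulr_ge0 ?expR_ge0.
have E10 : 0 <= E1 by apply: le_trans PP2; exact: expR_ge0.
rewrite (_ : _ - _ = (r1 - mt) + (r2 - kt) + (r3 - r4)); last by ring.
apply: le_trans (ler_normD _ _) _; apply: le_trans (lerD (ler_normD _ _) (lexx _)) _.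
have := ler_wpM2l K20 PP; have := ler_wpM2l K30 PP; have := ler_wpM2l K30 PP2.
have := mulr_ge0 K20 E00; have := mulr_ge0 K30 E00; have := mulr_ge0 K10 E10.
move: h3; rewrite !mulrDl !mulrDr => h3; lra.
Qed.

End RealReciprocity.

Local Open Scope complex_scope.

(** * Real and imaginary parts of the formula *)

Section ComplexParts.
Variable R : realType.
Local Notation C := R[i].
Local Notation Re := (@complex.Re R).
Local Notation Im := (@complex.Im R).

Lemma Re_main_terms (S1 S2 k m a : C) (c1 c2 c3 l g : R) :
  Re (S1 - (c1%:C * S2 + c2%:C * (m / 2 * l%:C + a / 2 + g%:C * m) + c3%:C * k)) =
  Re S1 - (c1 * Re S2 + c2 * (Re m / 2 * l + Re a / 2 + g * Re m) + c3 * Re k).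
Proof.
have -> : (2^-1 : C) = (2^-1 : R)%:C by rewrite fmorphV rmorph_nat.
by case: S1 S2 k m a => [? ?] [? ?] [? ?] [? ?] [? ?] /=; ring.
Qed.

Lemma Im_main_terms (S1 S2 k m a : C) (c1 c2 c3 l g : R) :
  Im (S1 - (c1%:C * S2 + c2%:C * (m / 2 * l%:C + a / 2 + g%:C * m) + c3%:C * k)) =
  Im S1 - (c1 * Im S2 + c2 * (Im m / 2 * l + Im a / 2 + g * Im m) + c3 * Im k).
Proof.
have -> : (2^-1 : C) = (2^-1 : R)%:C by rewrite fmorphV rmorph_nat.
by case: S1 S2 k m a => [? ?] [? ?] [? ?] [? ?] [? ?] /=; ring.
Qed.

Lemma Re_Ssum (r : nat) (b : int) (f : R -> C) (Y : R) :
  Re (Ssum r b f Y) = rsum (cong_pairs r b) (weight (fun x => Re (f x)) Y).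
Proof. by apply: eq_rsum => p _; rewrite cReM/= mul0r subr0. Qed.

Lemma Im_Ssum (r : nat) (b : int) (f : R -> C) (Y : R) :
  Im (Ssum r b f Y) = rsum (cong_pairs r b) (weight (fun x => Im (f x)) Y).
Proof. by apply: eq_rsum => p _; rewrite cImM/= mul0r addr0. Qed.

End ComplexParts.

Theorem theorem4p1 (R : realType) (f : R -> R[i]) (F : R[i] -> R[i])
    (am1 a0 : R[i])
    (f_smooth : smooth_pos f)
    (F_mellin : extends_mellin f F)
    (F_hol : holomorphic_off0 F)
    (F_laurent : laurent0 F am1 a0)
    (F_decay : rapid_decay F)
    (A eps : R) (A_gt0 : 0 < A) (eps_gt0 : 0 < eps) :
  exists K : R, forall (q a : nat) (X : R),
    (0 < a < q)%N -> coprime a q -> 1 <= X ->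
    Normc.normc (Ssum q a%:Z f X
          - ((Num.sqrt (a%:R / q%:R))%:C * Ssum a (- q%:Z) f (a%:R * X / q%:R)
             + ((a%:R : R) `^ (- 2^-1))%:C
                 * (am1 / 2 * (ln (X / a%:R))%:C + a0 / 2
                    + euler_gamma%:C * am1)
             + ((q%:R : R) `^ (- 2^-1))%:C * kfun F (q%:R / X)))
    <= K * ((a%:R : R) `^ (- 2^-1) * (X / a%:R) `^ (- A)
            + (q%:R : R) `^ (- 2^-1) * (a%:R / q%:R) * (X / q%:R) `^ 2^-1
              * (1 + X / q%:R) * (q%:R * X) `^ eps).
Proof.
have [[k1 d1] [k2 d2] L1 L2] := flat_of_mellin f_smooth F_mellin F_hol F_laurent F_decay.
have [K1 K10 h1] := reciprocity_real d1 A_gt0 eps_gt0.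
have [K2 K20 h2] := reciprocity_real d2 A_gt0 eps_gt0.
exists (K1 + K2) => q a X aq _ X1.
have Xp : 0 < X by exact: lt_le_trans X1.
have qp : 0 < q%:R :> R by case/andP: aq => a0' /(ltn_trans a0'); rewrite ltr0n.
have yp : 0 < q%:R / X by rewrite divr_gt0.
have pip : 2 * pi != 0 :> R by rewrite lt0r_neq0// mulr_gt0// pi_gt0.
(* Inversion on Re s = 2, the line in the definition of k, turns each truncated integral into values
   of f1; used for F with Re f and for -i F with Im f. *)
have lim (G : R[i] -> R[i]) (f1 : R -> R) : decays 2 (rline G 2) -> decays 2 (iline G 2) ->
    (forall u, LM G 2 u = 2 * pi * f1 (expR u)) ->
    forall e : R, 0 < e -> exists M0, forall M, (M0 <= M)%N ->
      `|complex.Re (kfun G (q%:R / X)) - k_sum f1 (ln X) q M| <= e.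
  move=> g1 g2 gL e e0; have [c c0 hc] := kfun_lim yp g1 g2.
  exists (Num.truncn (c / e)).+1 => M hM.
  have Mp : 0 < M%:R :> R by rewrite ltr0n (leq_trans _ hM).
  have := hc M (leq_trans (ltn0Sn _) hM).
  rewrite mulr_sumr (_ : \sum_(i < M) _ = k_sum f1 (ln X) q M); last first.
    apply: eq_bigr => i _; rewrite mulr_sumr; apply: eq_bigr => j _.
    rewrite gL ln_div ?posrE//; case: ifP => _; last by rewrite !(mul0r, mulr0).
    by rewrite mulrCA mulKf.
  move=> /le_trans; apply; rewrite ler_pdivrMr// mulrC -ler_pdivrMr//.
  by apply: ltW; apply: lt_le_trans (truncnS_gt _) _; rewrite ?ler_nat.
have n2 : (2 : R) != 0 by [].
have [r1 r2] := F_line_decays F_hol F_laurent F_decay 2 n2.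
have h1' := h1 q a X _ aq X1 (lim F _ r1 r2 L1).
have i1 : decays 2 (rline (fun s => (0 -i* 1) * F s) 2).
  by move: r2; congr decays; apply/funext => t; rewrite rot_rline.
have i2 : decays 2 (iline (fun s => (0 -i* 1) * F s) 2).
  by have := decaysN r1; congr decays; apply/funext => t; rewrite rot_iline.
have h2' := h2 q a X _ aq X1 (lim (fun s => (0 -i* 1) * F s) _ i1 i2 L2).
(* The modulus is at most |Re| + |Im|, hence the constant K1 + K2. *)
apply: le_trans (normc_le _) _; rewrite mulrDl Re_main_terms Im_main_terms !Re_Ssum !Im_Ssum Im_kfun.
exact: lerD h1' h2'.
Qed.
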